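(* Let $q\ge1$ and let $\mathcal{H}$ be a $q$-color-critical graph family with $p(\mathcal{H})=p\ge2$. Then $\mathcal{M}(\mathcal{H})$ is matching-good, and consequently $\mathrm{SPEX}(n,\mathcal{H})=\{H(n,p,q)\}$ for sufficiently large $n$, where $H(n,p,q)=K_{q-1}\nabla T_p(n-q+1)$.
   Context: All graphs are finite and simple; a family $\mathcal{H}$ is finite if the orders of its members are bounded. $p(\mathcal{H})=\min_{H\in\mathcal{H}}\chi(H)-1$. $T_p(n)$ is the $p$-partite Turán graph; $\nabla$ denotes join; $K_0$ is the empty graph, so $H(n,p,1)=T_p(n)$. $\mathrm{EX}(n,\mathcal{H})$ is the set of $n$-vertex graphs containing no member of $\mathcal{H}$ with the maximum number of edges; $\mathrm{SPEX}(n,\mathcal{H})$ is the set of $n$-vertex such graphs with maximum adjacency spectral radius. A finite family $\mathcal{H}$ with $p(\mathcal{H})=p\ge2$ is $q$-color-critical if (i) for every $H\in\mathcal{H}$ and every $(q-1)$-subset $S\subseteq V(H)$, $\chi(H-S)\ge p+1$; and (ii) some $H\in\mathcal{H}$ has a proper $(p+1)$-coloring in which the subgraph induced by the first two color classes consists of $q$ independent edges and possibly isolated vertices. Decomposition family: $\mathcal{M}(\mathcal{H})$ consists of the minimal (under subgraphs) graphs $M$ such that for some $H\in\mathcal{H}$ and a constant $t=t(\mathcal{H})$, $H\subseteq (M\cup E_t)\nabla T_{p-1}((p-1)t)$, where $E_t$ is the edgeless graph on $t$ vertices and $\cup$ is disjoint union. $\beta(M)$ = minimum vertex cover size, $\beta=\min_{M\in\mathcal{M}(\mathcal{H})}\beta(M)$;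 for bipartite $M$, $\gamma(M)$ = minimum size of an independent set meeting all edges, $\gamma=\min\{\gamma(M): M\in\mathcal{M}(\mathcal{H})\text{ bipartite}\}$. If $\beta=\gamma$, $\mathcal{B}(\mathcal{H})=\{K_\gamma\}$; otherwise $\mathcal{B}(\mathcal{H})=\{M[S]: M\in\mathcal{M}(\mathcal{H}), S\text{ a vertex cover of }M, |S|<\gamma\}$. $\mathcal{M}(\mathcal{H})$ is matching-good if (i) $p(\mathcal{H})\ge2$ and $\mathcal{M}(\mathcal{H})$ contains a matching; and (ii) for sufficiently large $n$ there is $G^\star\in\mathrm{EX}(n,\mathcal{H})$ with $G^\star=H_1\nabla H_2$, $H_1\in\mathrm{EX}(\gamma-1,\mathcal{B}(\mathcal{H}))$ and $H_2$ differing from $T_p(n-\gamma+1)$ by $O(1)$ added/deleted edges.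
   Formalization: In condition (i) of q-color-critical, every H in the family is also required to have at least q-1 vertices; otherwise (i) is vacuous for small H and the claim fails, e.g. for {K_3, 5K_3} with q=5, p=2. *)

(* Defs.v *)
From HB Require Import structures.
From mathcomp Require Import all_boot all_order all_algebra all_field.
From Stdlib Require Import ClassicalEpsilon.

Set Implicit Arguments.
Unset Strict Implicit.
Unset Printing Implicit Defensive.

Import Order.TTheory GRing.Theory Num.Theory.

(* The minimum of a nonempty set of naturals; unspecified on the empty set. *)
Definition min_nat (P : nat -> Prop) : nat :=
  epsilon (inhabits 0) (fun k => P k /\ forall j, P j -> k <= j).

Record graph := Graph {
  vertex :> finType;
  adj : rel vertex;
  adj_sym : symmetric adj;
  adj_irr : irreflexive adj }.

Definition edges (G : graph) : {set {set G}} :=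
  [set [set x; y] | x in G, y in G & adj x y].

Definition iso (G H : graph) : Prop :=
  exists2 f : G -> H, bijective f & forall x y, adj (f x) (f y) = adj x y.

(* Containment as a not necessarily induced subgraph, up to isomorphism. *)
Definition subgraph (H G : graph) : Prop :=
  exists2 f : H -> G, injective f & forall x y, adj x y -> adj (f x) (f y).

Section Constructions.

Definition complete_adj n : rel 'I_n := fun i j => i != j.
Fact complete_sym n : symmetric (@complete_adj n).
Proof. by move=> i j; rewrite /complete_adj eq_sym. Qed.
Fact complete_irr n : irreflexive (@complete_adj n).
Proof. by move=> i; rewrite /complete_adj eqxx. Qed.
Definition complete n : graph := Graph (@complete_sym n) (@complete_irr n).

Definition edgeless_adj n : rel 'I_n := fun _ _ => false.
Fact edgeless_sym n : symmetric (@edgeless_adj n). Proof. by []. Qed.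
Fact edgeless_irr n : irreflexive (@edgeless_adj n). Proof. by []. Qed.
Definition edgeless n : graph := Graph (@edgeless_sym n) (@edgeless_irr n).

(* The parts are the residue classes modulo p, whose sizes differ by at most
   one; only meaningful for p > 0. *)
Definition turan_adj p n : rel 'I_n := fun i j => i %% p != j %% p.
Fact turan_sym p n : symmetric (@turan_adj p n).
Proof. by move=> i j; rewrite /turan_adj eq_sym. Qed.
Fact turan_irr p n : irreflexive (@turan_adj p n).
Proof. by move=> i; rewrite /turan_adj eqxx. Qed.
Definition turan p n : graph := Graph (@turan_sym p n) (@turan_irr p n).

(* [cross] tells whether vertices on different sides are adjacent. *)
Definition sum_adj (cross : bool) (G H : graph) : rel (G + H)%type :=
  fun u v => match u, v with
  | inl x, inl y => adj x y
  | inr x, inr y => adj x y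
  | _, _ => cross
  end.
Fact sum_sym c G H : symmetric (@sum_adj c G H).
Proof. by move=> [x|x] [y|y] //=; rewrite adj_sym. Qed.
Fact sum_irr c G H : irreflexive (@sum_adj c G H).
Proof. by move=> [x|x] /=; rewrite adj_irr. Qed.
Definition disjoint_union G H : graph :=
  Graph (@sum_sym false G H) (@sum_irr false G H).
Definition join G H : graph :=
  Graph (@sum_sym true G H) (@sum_irr true G H).

Definition induced_adj (G : graph) (S : {set G}) : rel {x : G | x \in S} :=
  fun u v => adj (val u) (val v).
Fact induced_sym (G : graph) (S : {set G}) : symmetric (@induced_adj G S).
Proof. by move=> u v; rewrite /induced_adj adj_sym. Qed.
Fact induced_irr (G : graph) (S : {set G}) : irreflexive (@induced_adj G S).
Proof. by move=> u; rewrite /induced_adj adj_irr. Qed.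
Definition induced (G : graph) (S : {set G}) : graph :=
  Graph (@induced_sym G S) (@induced_irr G S).

End Constructions.

Definition H_graph n p q : graph :=
  join (complete (q - 1)) (turan p (n - (q - 1))).

Definition proper_coloring (G : graph) k (c : G -> 'I_k) : Prop :=
  forall x y, adj x y -> c x != c y.

Definition colorable (G : graph) k : Prop :=
  exists c : G -> 'I_k, proper_coloring c.

Definition chi (G : graph) : nat := min_nat (colorable G).

Definition bipartite (G : graph) : Prop := colorable G 2.

Definition degree (G : graph) (x : G) : nat := #|[set y | adj x y]|.

Definition is_matching (G : graph) : Prop := forall x : G, degree x = 1.

Definition independent_edges q (G : graph) : Prop :=
  (forall x : G, degree x <= 1) /\ #|edges G| = q.

Definition vertex_cover (G : graph) (S : {set G}) : Prop :=
  forall x y, adj x y -> (x \in S) || (y \in S).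

Definition independent (G : graph) (S : {set G}) : Prop :=
  forall x y, x \in S -> y \in S -> ~~ adj x y.

Definition beta (M : graph) : nat :=
  min_nat (fun k => exists2 S : {set M}, vertex_cover S & #|S| = k).

Definition gamma (M : graph) : nat :=
  min_nat (fun k => exists S : {set M},
    [/\ independent S, vertex_cover S & #|S| = k]).

(* A graph family is an arbitrary predicate on graphs; it need not be closed
   under isomorphism, since it only matters through [subgraph]. *)
Definition graph_family := graph -> Prop.

Definition finite_family (F : graph_family) : Prop :=
  exists N, forall H, F H -> #|H| <= N.

Definition p_of (F : graph_family) : nat :=
  (min_nat (fun k => exists2 H, F H & chi H = k)).-1.

Definition avoids (F : graph_family) (G : graph) : Prop :=
  forall H, F H -> ~ subgraph H G.

Definition EX n (F : graph_family) (G : graph) : Prop :=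
  [/\ #|G| = n, avoids F G &
      forall G' : graph, #|G'| = n -> avoids F G' -> #|edges G'| <= #|edges G|].

Definition adjacency_mx (G : graph) : 'M[algC]_#|G| :=
  \matrix_(i, j) (adj (enum_val i) (enum_val j))%:R%R.

(* Eigenvalues are taken in algC, which contains all the complex eigenvalues
   of an integer matrix: the sequence below lists the roots of the
   characteristic polynomial. *)
Definition eigenvalues n (A : 'M[algC]_n) : seq algC :=
  sval (closed_field_poly_normal (char_poly A)).

Definition spectral_radius (G : graph) : algC :=
  (\big[Num.max/0]_(a <- eigenvalues (adjacency_mx G)) `|a|)%R.

Definition SPEX n (F : graph_family) (G : graph) : Prop :=
  [/\ #|G| = n, avoids F G &
      forall G' : graph, #|G'| = n -> avoids F G' ->
        (spectral_radius G' <= spectral_radius G)%R].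

(* Deleting q - 1 vertices from every member presupposes that every member has
   at least q - 1 vertices. Without that clause the condition on S would be
   void for smaller members: {K_3, 5K_3} would be 5-color-critical. *)
Definition color_critical q (F : graph_family) : Prop :=
  [/\ finite_family F,
      2 <= p_of F,
      forall H, F H -> q - 1 <= #|H| /\
        forall S : {set H}, #|S| = q - 1 -> (p_of F).+1 <= chi (induced (~: S))
    & exists2 H, F H & exists2 c : H -> 'I_(p_of F).+1,
        proper_coloring c & independent_edges q (induced [set x | c x < 2])].

Definition decomposes (F : graph_family) (M : graph) : Prop :=
  exists2 H, F H & exists t, subgraph H
    (join (disjoint_union M (edgeless t))
          (turan (p_of F - 1) ((p_of F - 1) * t))).

Definition decomposition_family (F : graph_family) : graph_family := fun M =>
  decomposes F M /\
  forall M', decomposes F M' -> subgraph M' M -> iso M' M.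

Definition beta_fam (F : graph_family) : nat :=
  min_nat (fun k => exists2 M, decomposition_family F M & beta M = k).

Definition gamma_fam (F : graph_family) : nat :=
  min_nat (fun k => exists M,
    [/\ decomposition_family F M, bipartite M & gamma M = k]).

Definition B_fam (F : graph_family) : graph_family := fun G =>
  if beta_fam F == gamma_fam F then iso G (complete (gamma_fam F))
  else exists2 M, decomposition_family F M & exists S : {set M},
    [/\ vertex_cover S, #|S| < gamma_fam F & iso G (induced S)].

(* Up to relabelling, G and H differ in at most C edges. *)
Definition edit_close C (G H : graph) : Prop :=
  exists2 f : G -> H, bijective f &
    let E := [set f @: e | e : {set G} in edges G] in
    #|E :\: edges H| + #|edges H :\: E| <= C.

Definition matching_good (F : graph_family) : Prop :=
  [/\ 2 <= p_of F,
      exists2 M, decomposition_family F M & is_matching M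
    & exists C N, forall n, N <= n -> exists H1 H2 : graph,
        [/\ EX n F (join H1 H2),
            EX (gamma_fam F - 1) (B_fam F) H1
          & edit_close C H2 (turan (p_of F) (n - (gamma_fam F - 1)))]].

(* Main.v *)
(* Call star graph the join of a complete graph on a set A with a complete multipartite graph. Its
   spectral radius l solves sum_i n_i / (l + n_i) + |A| / (l + 1) = 1, where the n_i are the sizes
   of the parts; by concavity, for |A| = q - 1 and p parts it is largest exactly for H(n,p,q).

   Deleting a vertex of least Perron weight (progressive induction) reduces the claim to a graph G
   of minimum degree close to (1 - 1/p) n. By an Erdős–Stone argument, G is p-partite and nearly
   complete off a bounded set B. Call a vertex heavy if it has many neighbours in every part, and
   put every other vertex of B in a part where it has few. As G does not contain a large complete
   p-partite graph with q independent edges added to one part, for every q heavy vertices and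
   every part some other part contains few of their common neighbours. Double counting the
   non-adjacent pairs, one sees that making the q - 1 heavy vertices of largest Perron weight
   dominating and moving the other ones to a single part gains at least as much weight as
   completing G to a star graph loses; the Rayleigh quotient then compares the spectral radii.
   Constant weights give the number of edges.

   Deleting a vertex cover of a decomposing graph from a copy of a member of the family makes that
   member p-colorable, so that by criticality the cover has at least q vertices. Hence q
   independent edges form a minimal decomposing graph, and beta = gamma = q. *)

Require Import Defs.
From mathcomp Require Import all_boot all_order all_algebra all_field.
From mathcomp Require Import perm zify ring lra.
From Stdlib Require Import ClassicalEpsilon.

Set Implicit Arguments.
Unset Strict Implicit.
Unset Printing Implicit Defensive.
Import Order.TTheory GRing.Theory Num.Theory.

(** * The spectral radius of a graph *)

Section Spectral.
Local Open Scope ring_scope.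
Local Open Scope sesquilinear_scope.
Implicit Type G : graph.

(** The obstacle is that a graph avoiding the family may have more than q - 1 heavy vertices, up to
    p (q - 1). Each one beyond the first q - 1 forces, on average, about p/(p - 1) times n/p
    non-adjacent pairs between heavy vertices and parts, whereas placing it in a part costs only its
    n/p pairs with that part. The errors are linear too: the exceptional set, the missing edges and
    every threshold for being few are fixed fractions of n, chosen far below the surplus. Weights
    must not spoil the cancellation between p/(p - 1) and 1, so off the exceptional set they have to
    agree up to a factor 1 + O(1/p) with a small constant. The Perron weights do so only under the
    minimum degree condition, which is why the progressive induction comes first. The comparison is
    stated for arbitrary weights in an ordered field, so that the spectral radius and the number of
    edges are two instances of it. *)

Definition qform (R : realFieldType) G (x : G -> R) : R :=
  \sum_u \sum_(v | adj u v) x u * x v.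

Lemma eigenvaluesP n (A : 'M[algC]_n) a :
  (a \in eigenvalues A) = eigenvalue A a.
Proof.
rewrite eigenvalue_root_char /eigenvalues.
case: closed_field_poly_normal => r /= ->.
rewrite (monicP (char_poly_monic A)) scale1r.
by rewrite -root_prod_XsubC.
Qed.

(** [algC] is only partially ordered; [Num.max] yields a genuine maximum here because norms are
    real, hence comparable. *)
Lemma bigmax_norm (s : seq algC) (m := \big[Num.max/0]_(a <- s) `|a|) :
  [/\ 0 <= m, {in s, forall a, `|a| <= m} &
      s != [::] -> exists2 a, a \in s & `|a| = m].
Proof.
rewrite {}/m; elim: s => [|b s [IH0 IH1 IH2]]; first by rewrite big_nil.
rewrite big_cons; set m := \big[Num.max/0]_(a <- s) `|a| in IH0 IH1 IH2 *.
have mR : m \is Num.real by rewrite ger0_real.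
have bR : `|b| \is Num.real by rewrite normr_real.
have [lbm|lmb] := real_leP bR mR.
  split=> // [a|_].
    by rewrite inE => /orP[/eqP->//|/IH1].
  have [s0|/IH2 [a aS ea]] := eqVneq s [::]; last by exists a; rewrite // inE aS orbT.
  move: lbm; rewrite /m s0 big_nil normr_le0 => /eqP ->.
  by exists 0; rewrite ?inE ?eqxx ?normr0.
split=> // [a|_].
  by rewrite inE => /orP[/eqP->//|/IH1 am]; apply: le_trans am (ltW lmb).
by exists b; rewrite ?inE ?eqxx.
Qed.

Lemma spectral_radius_ge0 G : 0 <= spectral_radius G.
Proof. by case: (bigmax_norm (eigenvalues (adjacency_mx G))). Qed.

Lemma eigenvalue_le_spectral_radius G a :
  eigenvalue (adjacency_mx G) a -> `|a| <= spectral_radius G.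
Proof.
rewrite -eigenvaluesP => aE.
by case: (bigmax_norm (eigenvalues (adjacency_mx G))) => _ /(_ _ aE).
Qed.

Lemma spectral_radius_eigenvalue G : (0 < #|G|)%N ->
  exists2 a, eigenvalue (adjacency_mx G) a & `|a| = spectral_radius G.
Proof.
move=> G0; case: (bigmax_norm (eigenvalues (adjacency_mx G))) => _ _ [].
  have [a] := eigenvalue_closed (adjacency_mx G) G0.
  by rewrite -eigenvaluesP; case: (eigenvalues _).
by move=> a; rewrite eigenvaluesP => aE ea; exists a.
Qed.

(** Moving to the totally ordered field [algR] makes [lra] and the lemmas on [realFieldType]
    available. *)
Definition rho G : algR := in_algR (ger0_real (spectral_radius_ge0 G)).

Lemma rho_val G : algRval (rho G) = spectral_radius G. Proof. by []. Qed.

Lemma rho_ge0 G : 0 <= rho G. Proof. exact: spectral_radius_ge0. Qed.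

Lemma adjacency_mx_normal G : adjacency_mx G \is normalmx.
Proof.
apply: symmetric_normalmx; last first.
  by apply/mxOverP=> i j; rewrite mxE realn.
by apply/is_hermitianmxP; apply/matrixP=> i j; rewrite !mxE expr0 mul1r adj_sym.
Qed.

(* The norms of the entries are those of [z := y P^*], where [A = P^* D P]. *)
Lemma adjacency_form_le G (y : 'rV[algC]_#|G|) :
  `|(y *m adjacency_mx G *m y ^t*) 0 0| <=
  spectral_radius G * \sum_i `|y 0 i| ^+ 2.
Proof.
set A := adjacency_mx G.
have /orthomx_spectralP eA := adjacency_mx_normal G; rewrite -/A in eA.
set P := spectralmx A in eA; set D := spectral_diag A in eA.
have PU : P \is unitarymx := spectral_unitarymx A.
have Pinv : invmx P = P ^t* := invmx_unitary PU.
have Punit : P \in unitmx := spectral_unit A.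
have DE i : `|D 0 i| <= spectral_radius G.
  apply: eigenvalue_le_spectral_radius; apply/eigenvalueP; exists (row i P).
    rewrite -row_mul -/A {1}eA !mulmxA mulmxV // mul1mx.
    by apply/rowP=> j; rewrite mul_diag_mx !mxE.
  apply/negP=> /eqP P0; have := congr1 (fun v => v *m invmx P) P0.
  rewrite mul0mx -row_mul mulmxV // => /rowP/(_ i).
  by rewrite !mxE eqxx => /eqP; rewrite oner_eq0.
pose z := y *m P ^t*.
have eyy : (z *m z ^t*) = y *m y ^t*.
  rewrite /z trmx_mul map_mxM /= trmxCK mulmxA -(mulmxA y) -Pinv mulVmx //.
  by rewrite mulmx1.
have eyA : y *m A *m y ^t* = z *m diag_mx D *m z ^t*.
  by rewrite eA Pinv /z trmx_mul map_mxM /= trmxCK !mulmxA.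
have eS (n : nat) (w : 'rV[algC]_n) : (w *m w ^t*) 0 0 = \sum_i `|w 0 i| ^+ 2.
  by rewrite mxE; apply: eq_bigr => i _; rewrite !mxE normCK.
rewrite eyA -eS -eyy eS mxE mulr_sumr.
apply: le_trans (ler_norm_sum _ _ _) _; apply: ler_sum => i _.
rewrite mul_mx_diag !mxE mulrAC -normCK normrM mulrC normrX normr_id.
by rewrite ler_wpM2r // exprn_ge0.
Qed.

Lemma adjacency_formE G (y : 'rV[algC]_#|G|) :
  (y *m adjacency_mx G *m y ^t*) 0 0 =
  \sum_(u : G) \sum_(v | adj u v) y 0 (enum_rank u) * (y 0 (enum_rank v))^*.
Proof.
rewrite -mulmxA mxE (reindex (@enum_rank G)) /=; last first.
  by apply: onW_bij; exists enum_val; [apply: enum_rankK|apply: enum_valK].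
apply: eq_bigr => u _; rewrite mxE (reindex (@enum_rank G)) /=; last first.
  by apply: onW_bij; exists enum_val; [apply: enum_rankK|apply: enum_valK].
rewrite mulr_sumr [RHS]big_mkcond; apply: eq_bigr => v _ /=.
by rewrite !mxE !enum_rankK; case: ifP => _; rewrite ?mul1r ?mul0r ?mulr0.
Qed.

Lemma sum_enum_rank (V : nmodType) G (f : 'I_#|G| -> V) :
  \sum_i f i = \sum_(u : G) f (enum_rank u).
Proof.
rewrite (reindex (@enum_rank G)) //=.
by apply: onW_bij; exists enum_val; [apply: enum_rankK|apply: enum_valK].
Qed.

Lemma rayleigh G (x : G -> algR) : qform x <= rho G * \sum_u x u ^+ 2.
Proof.
pose y : 'rV[algC]_#|G| := \row_i algRval (x (enum_val i)).
have yE u : y 0 (enum_rank u) = algRval (x u) by rewrite mxE enum_rankK.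
have := adjacency_form_le y; rewrite adjacency_formE sum_enum_rank.
under eq_bigr => u _ do under eq_bigr => v _ do
  rewrite !yE (conj_Creal (algRvalP _)) -rmorphM.
under [in X in _ <= X]eq_bigr => u _ do
  rewrite yE -normrX ger0_norm ?real_exprn_even_ge0 ?algRvalP // -rmorphXn.
under eq_bigr => u _ do rewrite -rmorph_sum.
rewrite -!rmorph_sum /= -rho_val -rmorphM -/(qform x) => le.
have : algRval (qform x) <= algRval (rho G * \sum_u x u ^+ 2).
  by apply: le_trans le; apply: real_ler_norm; apply: algRvalP.
by [].
Qed.

(** The Rayleigh bound at x + t e_u becomes 2 t d <= rho t^2 for all t, where d is the defect of the
    eigenvalue equation at u; this forces d = 0. *)
Lemma rayleigh_eq G (x : G -> algR) u :
  qform x = rho G * \sum_v x v ^+ 2 -> \sum_(v | adj u v) x v = rho G * x u.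
Proof.
move=> qx; apply/eqP; rewrite -subr_eq0; set d := _ - _.
(* first variation of the Rayleigh quotient in direction [u] *)
have var t : 2 * t * d <= rho G * t ^+ 2.
  pose z v := x v + t * (v == u)%:R.
  have := rayleigh z.
  have -> : \sum_v z v ^+ 2 = \sum_v x v ^+ 2 + 2 * t * x u + t ^+ 2.
    rewrite (bigD1 u) //= [in RHS](bigD1 u) //= /z eqxx mulr1.
    under eq_bigr => v /negPf -> do rewrite mulr0 addr0.
    by ring.
  have -> : qform z = qform x + 2 * t * \sum_(v | adj u v) x v.
    rewrite /qform.
    have zz v : \sum_(w | adj v w) z v * z w =
        \sum_(w | adj v w) x v * x w + t * (v == u)%:R * \sum_(w | adj v w) x w
        + (adj v u)%:R * t * x v.
      rewrite mulr_sumr -big_split /=.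
      have -> : (adj v u)%:R * t * x v = \sum_(w | adj v w) (t * (w == u)%:R * x v).
        case: (boolP (adj v u)) => vu.
          rewrite (bigD1 u) //= eqxx mulr1 mul1r big1 ?addr0 // => w /andP[_ /negPf ->].
          by rewrite mulr0 mul0r.
        rewrite big1 ?mul0r // => w vw; case: eqP => [e|_]; last by rewrite mulr0 mul0r.
        by move: vw; rewrite e (negPf vu).
      rewrite -big_split /=; apply: eq_bigr => w vw; rewrite /z.
      have [ev|nv] := eqVneq v u; last by rewrite mulr0n; ring.
      have -> : (w == u) = false by apply/eqP => ew; rewrite ev ew adj_irr in vw.
      by rewrite mulr0n; ring.
    under eq_bigr => v _ do rewrite zz.
    rewrite !big_split /= -addrA; congr (_ + _).
    rewrite (bigD1 u) //= eqxx mulr1 [X in _ + X + _]big1 ?addr0; last first.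
      by move=> v /negPf ->; rewrite mulr0 mul0r.
    have -> : \sum_v (adj v u)%:R * t * x v = t * \sum_(v | adj u v) x v.
      rewrite mulr_sumr [RHS]big_mkcond; apply: eq_bigr => v _ /=.
      by rewrite adj_sym; case: ifP => _; rewrite ?mul1r ?mul0r.
    by ring.
  by rewrite qx /d; lra.
have [//|d0] := eqVneq d 0.
have r0 := rho_ge0 G; set r := rho G in r0 var *.
have r1 : 0 < r + 1 by lra.
have d2 : 0 < d ^+ 2 by rewrite exprn_even_gt0.
(* The bound is tested at t = d / (r + 1); the summand 1 covers r = 0. *)
pose s := (r + 1)^-1.
have s0 : 0 < s by rewrite invr_gt0.
have rs : r * s = 1 - s by rewrite /s; field; lra.
have := var (d * s).
have -> : 2 * (d * s) * d = d ^+ 2 * s * 2 by ring.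
have -> : r * (d * s) ^+ 2 = d ^+ 2 * s * (r * s) by ring.
rewrite rs ler_pM2l; first by lra.
by rewrite mulr_gt0.
Qed.

(** By the triangle inequality, the entrywise modulus of an eigenvector for an eigenvalue of largest
    norm attains the Rayleigh bound, so it is an eigenvector by [rayleigh_eq]. Connectivity is not
    assumed, so entries may vanish. *)
Lemma perron G : (0 < #|G|)%N -> exists x : G -> algR,
  [/\ forall u, 0 <= x u, exists u, x u != 0 &
      forall u, \sum_(v | adj u v) x v = rho G * x u].
Proof.
move=> /spectral_radius_eigenvalue[a /eigenvalueP[y yA y0] ea].
pose x u : algR := in_algR (normr_real (y 0 (enum_rank u))).
have x0 u : 0 <= x u by apply: (normr_ge0 (y 0 (enum_rank u))).
exists x; split=> //.
  have /rV0Pn[i yi] := y0; exists (enum_val i).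
  by apply/eqP => /(congr1 algRval) /= /eqP; rewrite enum_valK normr_eq0 (negPf yi).
have qx : qform x = rho G * \sum_u x u ^+ 2.
  apply/eqP; rewrite eq_le rayleigh /=.
  have e1 : algRval (rho G * \sum_u x u ^+ 2) = `|(y *m adjacency_mx G *m y ^t*) 0 0|.
    rewrite yA -scalemxAl mxE normrM ea rmorphM; congr (_ * _).
    rewrite rmorph_sum mxE sum_enum_rank ger0_norm.
      by apply: eq_bigr => u _; rewrite !mxE -normCK rmorphXn.
    by apply: sumr_ge0 => u _; rewrite !mxE -normCK exprn_ge0.
  suff : algRval (rho G * \sum_u x u ^+ 2) <= algRval (qform x) by [].
  rewrite e1 adjacency_formE rmorph_sum.
  apply: le_trans (ler_norm_sum _ _ _) _; apply: ler_sum => u _.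
  rewrite rmorph_sum; apply: le_trans (ler_norm_sum _ _ _) _.
  by apply: ler_sum => v _; rewrite normrM norm_conjC rmorphM.
by move=> u; apply: rayleigh_eq.
Qed.
End Spectral.

Section Iso.
Implicit Types G H : graph.

Lemma iso_sym G H : iso G H -> iso H G.
Proof.
case=> f [g fK gK] fa; exists g; first by exists f.
by move=> x y; rewrite -fa !gK.
Qed.

Lemma iso_trans G H K : iso G H -> iso H K -> iso G K.
Proof.
move=> [f fb fa] [g gb ga]; exists (g \o f); first exact: bij_comp.
by move=> x y; rewrite /= ga fa.
Qed.

Lemma iso_card G H : iso G H -> #|G| = #|H|.
Proof. by case=> f /bij_eq_card. Qed.

Lemma iso_subgraph G H : iso G H -> subgraph G H.
Proof.
case=> f /bij_inj fi fa; exists f => // x y; by rewrite fa.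
Qed.

Lemma subgraph_trans G H K : subgraph G H -> subgraph H K -> subgraph G K.
Proof.
move=> [f fi fa] [g gi ga]; exists (g \o f); first exact: inj_comp.
by move=> x y /fa /ga.
Qed.

Lemma iso_avoids (F : graph_family) G H : iso G H -> avoids F G -> avoids F H.
Proof.
move=> iGH aG K FK sKH; apply: (aG K FK).
exact: subgraph_trans sKH (iso_subgraph (iso_sym iGH)).
Qed.

Lemma iso_rho_le G H : iso G H -> (rho G <= rho H)%R.
Proof.
case=> f [g fK gK] fa.
have [G0|G0] := posnP #|G|; last first.
  have [x [x0 [u xu] xE]] := perron G0.
  have fbij : bijective f by exists g.

  have s2 : (0 < \sum_u x u ^+ 2)%R.
    rewrite (bigD1 u) //= ltr_wpDr ?sumr_ge0 // => [v _|].
      by rewrite exprn_ge0.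
    by rewrite exprn_even_gt0.
  have := rayleigh (x \o g).
  have -> : qform (x \o g) = qform x.
    rewrite /qform (reindex f) /=; last exact: onW_bij.
    apply: eq_bigr => a _.
    rewrite (reindex f) /=; last exact: onW_bij.
    apply: eq_big => [b|b _]; first by rewrite fa.
    by rewrite !fK.
  have -> : (\sum_u (x \o g) u ^+ 2 = \sum_u x u ^+ 2)%R.
    rewrite (reindex f) /=; last exact: onW_bij.
    by apply: eq_bigr => a _; rewrite fK.
  have -> : (qform x = rho G * \sum_u x u ^+ 2)%R.
    rewrite /qform mulr_sumr; apply: eq_bigr => a _.
    by rewrite -mulr_sumr xE; ring.
  by rewrite ler_pM2r.
have -> : rho G = 0%R; last exact: rho_ge0.
apply/eqP/negP => /negP r0.
have e0 : eigenvalues (adjacency_mx G) = [::].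
  case: (eigenvalues _) (@eigenvaluesP _ (adjacency_mx G)) => [//|a s] /(_ a).
  rewrite inE eqxx /= => /esym/eigenvalueP[v _ /rV0Pn[i _]].
  by case: i; rewrite G0.
by case/eqP: r0; apply: val_inj; rewrite /= /spectral_radius e0 big_nil.
Qed.

Lemma iso_rho G H : iso G H -> rho G = rho H.
Proof.
by move=> i; apply/eqP; rewrite eq_le !iso_rho_le //; apply: iso_sym.
Qed.
End Iso.

(** * Spectral radius of star graphs *)

Section Star.
Local Open Scope ring_scope.
Variables (V : finType) (I : finType).

Definition star_adj (A : {set V}) (c : V -> I) : rel V :=
  fun u v => (u != v) && [|| u \in A, v \in A | c u != c v].
Fact star_sym A c : symmetric (star_adj A c).
Proof.
move=> u v; rewrite /star_adj eq_sym [c u == _]eq_sym.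
by rewrite orbCA.
Qed.
Fact star_irr A c : irreflexive (star_adj A c).
Proof. by move=> u; rewrite /star_adj eqxx. Qed.
Definition star_graph A c : graph := Graph (star_sym A c) (star_irr A c).

Definition part (A : {set V}) (c : V -> I) i : {set V} :=
  [set v | (v \notin A) && (c v == i)].

Lemma sum_parts (M : nmodType) (A : {set V}) (c : V -> I) (f : V -> M) :
  \sum_v f v = \sum_(v in A) f v + \sum_i \sum_(v in part A c i) f v.
Proof.
rewrite (bigID (mem A)) /=; congr (_ + _).
rewrite (partition_big c predT) //=; apply: eq_bigr => i _.
by apply: eq_bigl => v; rewrite inE.
Qed.

Lemma star_neighbors_in (M : zmodType) (A : {set V}) (c : V -> I) (f : V -> M) u : u \in A ->
  \sum_(v | @adj (star_graph A c) u v) f v = \sum_v f v - f u.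
Proof.
move=> uA; rewrite [in RHS](bigD1 u) //= addrAC subrr add0r.
by apply: eq_bigl => v; rewrite /= /star_adj uA eq_sym andbT.
Qed.

Lemma star_neighbors_out (M : zmodType) (A : {set V}) (c : V -> I) (f : V -> M) u : u \notin A ->
  \sum_(v | @adj (star_graph A c) u v) f v =
  \sum_v f v - \sum_(v in part A c (c u)) f v.
Proof.
move=> uA; rewrite [in RHS](bigID (mem (part A c (c u)))) /= addrAC subrr add0r.
apply: eq_bigl => v; rewrite /= /star_adj (negPf uA) inE negb_and negbK /=.
rewrite [c u == _]eq_sym; case: eqP => [<-|_] /=; last by [].
by rewrite (negPf uA) eqxx.
Qed.

(* By the eigenvalue equations, the Perron vector of a star graph takes the value S / (l + n_i) on
   the i-th part and S / (l + 1) on A, where S is the sum of its entries; summing up,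
   [starf l = 1]. *)
Definition starf (A : {set V}) (c : V -> I) (l : algR) : algR :=
  \sum_i #|part A c i|%:R / (l + #|part A c i|%:R) + #|A|%:R / (l + 1).

Lemma starf_rho (A : {set V}) (c : V -> I) : 0 < rho (star_graph A c) ->
  starf A c (rho (star_graph A c)) = 1.
Proof.
set G := star_graph A c; set l := rho G => l0.
have [G0|G0] := posnP #|G|.
  move: l0; have -> : l = 0; last by rewrite ltxx.
  apply/eqP; rewrite eq_le rho_ge0 andbT.
  have e0 : eigenvalues (adjacency_mx G) = [::].
    case: (eigenvalues _) (@eigenvaluesP _ (adjacency_mx G)) => [//|a s] /(_ a).
    rewrite inE eqxx /= => /esym/eigenvalueP[v _ /rV0Pn[i _]].
    by case: i; rewrite G0.
  have -> : l = 0 by apply: val_inj; rewrite /= /spectral_radius e0 big_nil.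
  by [].
have [x [x0 [w xw] xE]] := perron G0.
set S := \sum_v x v.
have S0 : S != 0.
  by rewrite lt0r_neq0 // /S (bigD1 w) //= ltr_wpDr ?sumr_ge0 // lt_def xw x0.
have xA u : u \in A -> x u = S / (l + 1).
  move=> uA; have := xE u; rewrite star_neighbors_in // -/S -/l => h.
  by apply: (mulIf (_ : l + 1 != 0)); [lra|rewrite mulfVK //; lra].
have xP i : \sum_(v in part A c i) x v = #|part A c i|%:R / (l + #|part A c i|%:R) * S.
  set Y := \sum_(v in _) _.
  have : l * Y = #|part A c i|%:R * (S - Y).
    rewrite mulr_sumr -sum1_card natr_sum mulr_suml; apply: eq_bigr => v.
    rewrite inE => /andP[vA /eqP vi]; have := xE v.
    by rewrite star_neighbors_out // vi -/S -/Y -/l mul1r => ->.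
  have n0 : (0 : algR) <= #|part A c i|%:R by rewrite ler0n.
  move=> h; have ln : l + #|part A c i|%:R != 0 by lra.
  by apply: (mulIf ln); rewrite mulrAC mulfVK //; lra.
apply: (mulIf S0); rewrite mul1r {2}/S (sum_parts A c) /starf mulrDl addrC.
congr (_ + _).
  by rewrite (eq_bigr _ xA) sumr_const -mulr_natl; ring.
by rewrite mulr_suml; apply: eq_bigr => i _; rewrite xP.
Qed.

(** The Perron vector that a trial eigenvalue [l] would have, scaled to S = 1; its entries then sum
    to [starf A c l]. *)
Definition star_vec (A : {set V}) (c : V -> I) (l : algR) : V -> algR := fun v =>
  if v \in A then (l + 1)^-1 else (l + #|part A c (c v)|%:R)^-1.

(** With f = [starf A c l], the neighbours of u contribute l y(u) + (f - 1) to the vector y =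
    [star_vec A c l]. Hence its quadratic form exceeds l times its square norm by exactly (f - 1) f,
    and a value f >= 1 certifies that [l] is a lower bound for the spectral radius. *)
Lemma star_test (A : {set V}) (c : V -> I) (l : algR) : 0 < l ->
  (starf A c l - 1) * starf A c l <=
  (rho (star_graph A c) - l) * \sum_v star_vec A c l v ^+ 2.
Proof.
move=> l0; set y := star_vec A c l; set G := star_graph A c.
have n0 i : (0 : algR) <= #|part A c i|%:R by rewrite ler0n.
have yP i v : v \in part A c i -> y v = (l + #|part A c i|%:R)^-1.
  by rewrite inE => /andP[/negPf vA /eqP <-]; rewrite /y /star_vec vA.
have yA v : v \in A -> y v = (l + 1)^-1 by rewrite /y /star_vec => ->.
have sP i : \sum_(v in part A c i) y v = #|part A c i|%:R / (l + #|part A c i|%:R).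
  by rewrite (eq_bigr _ (yP i)) sumr_const mulr_natl.
have S : \sum_v y v = starf A c l.
  rewrite (sum_parts A c) addrC; congr (_ + _); first exact: eq_bigr.
  by rewrite (eq_bigr _ yA) sumr_const mulr_natl.
have Ay u : \sum_(v | @adj G u v) y v = l * y u + (starf A c l - 1).
  have [uA|uA] := boolP (u \in A).
    by rewrite star_neighbors_in // S yA //; field; lra.
  rewrite star_neighbors_out // S sP (yP (c u)); last by rewrite inE uA eqxx.
  by have := n0 (c u) => h; field; lra.
have := @rayleigh G y.
have -> : @qform _ G y = l * \sum_v y v ^+ 2 + (starf A c l - 1) * starf A c l.
  rewrite /qform.
  under eq_bigr => u _ do rewrite -mulr_sumr Ay mulrDr.
  rewrite big_split /= -mulr_suml S; congr (_ + _); last exact: mulrC.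
  rewrite mulr_sumr.
  by apply: eq_bigr => u _; ring.
by rewrite mulrBl; lra.
Qed.

Lemma star_rho_ge (A : {set V}) (c : V -> I) (l : algR) :
  0 < l -> 1 <= starf A c l -> l <= rho (star_graph A c).
Proof.
move=> l0 f1; rewrite leNgt; apply/negP => rl.
have := star_test A c l0.
have s0 : 0 <= \sum_v star_vec A c l v ^+ 2.
  by apply: sumr_ge0 => v _; rewrite exprn_even_ge0.
have [f2|f2] := eqVneq (\sum_v star_vec A c l v ^+ 2) 0.
  have y0 v : star_vec A c l v = 0.
    apply/eqP; rewrite -(@sqrf_eq0 algR); apply/eqP.
    by apply: (psumr_eq0P _ f2) => // w _; rewrite exprn_even_ge0.
  move: f1; have -> : starf A c l = 0; last by rewrite ler10.
  rewrite /starf; have [A0|[v vA]] := set_0Vmem A.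
    rewrite A0 cards0 mul0r addr0 big1 // => i _.
    have [p0|[v vp]] := set_0Vmem (part set0 c i); first by rewrite p0 cards0 mul0r.
    have := y0 v; rewrite /star_vec A0 inE; move: vp; rewrite inE => /andP[_ /eqP ->].
    by move=> ->; rewrite mulr0.
  have := y0 v; rewrite /star_vec vA => /eqP; rewrite invr_eq0; lra.
have s1 : 0 < \sum_v star_vec A c l v ^+ 2 by rewrite lt_def f2.
rewrite leNgt => /negP; apply.
apply: (@lt_le_trans _ _ 0); first by rewrite pmulr_llt0 // subr_lt0.
by rewrite mulr_ge0 //; lra.
Qed.

Lemma star_rho_gt (A : {set V}) (c : V -> I) (l : algR) :
  0 < l -> 1 < starf A c l -> l < rho (star_graph A c).
Proof.
move=> l0 f1; rewrite lt_def star_rho_ge // 1?ltW // andbT.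
apply/negP => /eqP rl; have := star_test A c l0.
rewrite rl subrr mul0r leNgt => /negP; apply.
by rewrite mulr_gt0; lra.
Qed.
End Star.

(** * Balanced partitions and H(n,p,q) as a star graph *)

Definition balanced p m i : nat := m %/ p + (i < m %% p).

Lemma sum_ltn_ord p r : r <= p -> \sum_(i < p) (i < r) = r.
Proof.
move=> rp; transitivity (\sum_(i < p | i < r) 1).
  by rewrite [RHS]big_mkcond; apply: eq_bigr => i _; case: (_ < _).
by rewrite -(big_ord_widen p (fun _ => 1) rp) sum1_card card_ord.
Qed.

Lemma sum_balanced p m : 0 < p -> \sum_(i < p) balanced p m i = m.
Proof.
move=> p0; rewrite big_split /= sum_nat_const card_ord sum_ltn_ord.
  by rewrite mulnC -divn_eq.
by rewrite ltnW // ltn_pmod.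
Qed.

Lemma balancedS p m i : 0 < p -> i < p ->
  balanced p m.+1 i = balanced p m i + (i == m %% p).
Proof.
move=> p0 ip; rewrite /balanced; have rp := ltn_pmod m p0.
have [r1|r1] := ltnP (m %% p).+1 p.
  have -> : m.+1 %/ p = m %/ p.
    by rewrite {1}(divn_eq m p) -addnS divnMDl // (divn_small r1) addn0.
  have -> : m.+1 %% p = (m %% p).+1.
    by rewrite {1}(divn_eq m p) -addnS modnMDl modn_small.
  by rewrite ltnS leq_eqVlt; case: eqP => [->|_]; rewrite ?ltnn /=; lia.
have er : (m %% p).+1 = p by lia.
have -> : m.+1 %/ p = (m %/ p).+1.
  by rewrite {1}(divn_eq m p) -addnS er -mulSnr mulnK.
have -> : m.+1 %% p = 0 by rewrite {1}(divn_eq m p) -addnS er -mulSnr modnMl.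
by rewrite -er ltnS in ip; rewrite ltn0; case: eqP; case: ltnP; lia.
Qed.

(** This identifies [balanced] with the part sizes of the Turán graph: by induction on m, the new
    element m enters the class of m modulo p. *)
Lemma card_residue p m i : 0 < p -> i < p ->
  #|[set j : 'I_m | j %% p == i]| = balanced p m i.
Proof.
move=> p0 ip; rewrite -sum1_card.
transitivity (\sum_(j < m) (j %% p == i)).
  by rewrite big_mkcond; apply: eq_bigr => j _; rewrite inE; case: eqP.
elim: m => [|m IH]; first by rewrite big_ord0 /balanced div0n mod0n.
by rewrite big_ord_recr /= IH balancedS // eq_sym.
Qed.

Section BalancedSum.
Local Open Scope ring_scope.
Variables (R : realFieldType) (p m : nat) (g : nat -> R) (a b : R).
Hypothesis p_gt0 : (0 < p)%N.
Let k := (m %/ p)%N.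
Hypothesis g_le : forall j, g j <= a + b * j%:R.
Hypothesis gk : g k = a + b * k%:R.
Hypothesis gk1 : g k.+1 = a + b * k.+1%:R.

(* A concave function lies below the line through its values at k and k + 1, and balanced sizes are
   those for which only k and k + 1 occur. *)
Lemma balanced_sum_line :
  \sum_(i < p) g (balanced p m i) = a *+ p + b * m%:R.
Proof.
have -> : \sum_(i < p) g (balanced p m i) =
    \sum_(i < p) (a + b * (balanced p m i)%:R).
  apply: eq_bigr => i _; rewrite /balanced -/k.
  by case: (_ < _)%N; rewrite ?addn0 ?addn1 ?gk ?gk1.
rewrite big_split /= sumr_const card_ord -mulr_sumr -natr_sum.
by rewrite sum_balanced.
Qed.

Lemma sum_le_balanced (n : 'I_p -> nat) : (\sum_i n i = m)%N ->
  \sum_i g (n i) <= \sum_(i < p) g (balanced p m i).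
Proof.
move=> nm; rewrite balanced_sum_line.
apply: le_trans (ler_sum _ (fun i _ => g_le (n i))) _.
by rewrite big_split /= sumr_const card_ord -mulr_sumr -natr_sum nm.
Qed.

Lemma sum_eq_balanced (n : 'I_p -> nat) : (\sum_i n i = m)%N ->
  \sum_(i < p) g (balanced p m i) <= \sum_i g (n i) ->
  forall i, g (n i) = a + b * (n i)%:R.
Proof.
move=> nm; rewrite balanced_sum_line => le i; apply/eqP.
rewrite eq_le g_le /= leNgt; apply/negP => lt.
move: le; rewrite leNgt => /negP; apply.
have -> : a *+ p + b * m%:R = \sum_i (a + b * (n i)%:R).
  by rewrite big_split /= sumr_const card_ord -mulr_sumr -natr_sum nm.
rewrite (bigD1 i) //= [in ltRHS](bigD1 i) //= ltr_leD //.
by apply: ler_sum => j _.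
Qed.
End BalancedSum.

Section HStar.
Variables (p s m : nat) (p_gt0 : 0 < p).

Definition H_core : {set 'I_s + 'I_m} :=
  [set w | if w is inl _ then true else false].
(* The colour of the vertices of the core is irrelevant. *)
Definition H_color (w : 'I_s + 'I_m) : 'I_p :=
  Ordinal (ltn_pmod (if w is inr j then j : nat else 0) p_gt0).
Definition H_star : graph := star_graph H_core H_color.

Lemma H_star_adj (u v : 'I_s + 'I_m) :
  @adj H_star u v = @adj (join (complete s) (turan p m)) u v.
Proof.
rewrite /= /star_adj /= !inE.
case: u v => [u|u] [v|v] //=; rewrite ?andbT //.
rewrite /turan_adj -val_eqE /=; case: eqP => //= -[->].
by rewrite eqxx.
Qed.

Lemma H_star_iso : iso (join (complete s) (turan p m)) H_star.
Proof. by exists id; [exists id|move=> x y; rewrite H_star_adj]. Qed.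

Lemma card_H_core : #|H_core| = s.
Proof.
have -> : H_core = [set inl x | x in [set: 'I_s]].
  apply/setP=> -[x|x]; rewrite inE; first by rewrite imset_f.
  by apply/esym/negP => /imsetP[].
by rewrite card_imset ?cardsT ?card_ord // => x y [].
Qed.

Lemma card_H_part i : #|part H_core H_color i| = balanced p m i.
Proof.
rewrite -card_residue //.
have -> : part H_core H_color i = [set inr x | x in [set j : 'I_m | j %% p == i]].
  apply/setP=> -[x|x]; rewrite !inE /=.
    by apply/esym/negP => /imsetP[].
  by rewrite (mem_imset _ _ inr_inj) inE -val_eqE.
by rewrite card_imset //; apply: inr_inj.
Qed.
End HStar.

Lemma perm_eq_two (T : eqType) (a b : T) (r : seq T) :
  a != b -> all (pred2 a b) r ->
  perm_eq r (nseq (count_mem a r) a ++ nseq (count_mem b r) b).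
Proof.
move=> ab; elim: r => [//|x r IH] /= /andP[xab /IH{}IH].
case/pred2P: xab => ->; rewrite ?eqxx ?(negPf ab) ?[b == a]eq_sym ?(negPf ab) /=.
  by rewrite perm_cons.
by rewrite perm_sym (perm_catCA _ [:: b]) /= perm_cons perm_sym.
Qed.

Lemma count_two (T : eqType) (a b : T) (r : seq T) :
  a != b -> all (pred2 a b) r -> count_mem a r + count_mem b r = size r.
Proof.
by move=> ab /(perm_eq_two ab)/perm_size ->; rewrite size_cat !size_nseq.
Qed.

(** The sum m determines how many sizes equal k + 1, namely m modulo p, so the two families of sizes
    are equal as multisets. *)
Lemma balanced_perm p m (n : 'I_p -> nat) : 0 < p -> \sum_i n i = m ->
  (forall i, n i = m %/ p \/ n i = (m %/ p).+1) ->
  exists t : 'S_p, forall i, n i = balanced p m (t i).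
Proof.
move=> p0 nm nk; set k := m %/ p in nk *.
have kk : k != k.+1 by lia.
have two (f : 'I_p -> nat) : (forall i, f i = k \/ f i = k.+1) ->
    all (pred2 k k.+1) (mktuple f).
  by move=> fk; apply/allP => x /mapP[i _ ->]; apply/pred2P.
have bk i : balanced p m i = k \/ balanced p m i = k.+1.
  by rewrite /balanced; case: (_ < _); [right|left]; rewrite ?addn1 ?addn0.
have cnt (f : 'I_p -> nat) : \sum_i f i = m -> (forall i, f i = k \/ f i = k.+1) ->
    count_mem k.+1 (mktuple f) = m %% p.
  move=> fm fk; have sz : k * p + count_mem k.+1 (mktuple f) = \sum_i f i.
    rewrite /= count_map -sum1_count big_mkcond /= big_enum /=.
    rewrite -[X in k * X]card_ord -sum1_card big_distrr /= -big_split /=.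
    by apply: eq_bigr => i _; case: (fk i) => ->; case: eqP; lia.
  by have := divn_eq m p; lia.
have : perm_eq (mktuple n) (mktuple (fun i : 'I_p => balanced p m i)).
  have pn := perm_eq_two kk (two _ nk); have pb := perm_eq_two kk (two _ bk).
  apply: seq.perm_trans pn _; rewrite perm_sym; apply: seq.perm_trans pb _.
  have := count_two kk (two _ nk); have := count_two kk (two _ bk).
  rewrite !cnt ?sum_balanced // !size_tuple => e1 e2.
  by have -> : count_mem k (mktuple n) =
      count_mem k (mktuple (fun i : 'I_p => balanced p m i)) by lia.
case/tuple_permP => t et; exists t => i.
have /(congr1 (fun r => nth 0 r i)) := et.
by rewrite -tnth_nth tnth_mktuple -tnth_nth !tnth_mktuple.
Qed.

Lemma card_parts (V I : finType) (A : {set V}) (c : V -> I) :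
  #|V| = #|A| + \sum_i #|part A c i|.
Proof.
rewrite -cardsT -!sum1_card (bigID (mem A)) /=; congr (_ + _).
  by apply: eq_bigl => v; rewrite inE.
rewrite (partition_big c predT) //=; apply: eq_bigr => i _.
by rewrite -sum1_card; apply: eq_bigl => v; rewrite !inE.
Qed.

(** A vertex outside [A] goes to rank * p + t(colour), where rank is its position in its part; the
    residue modulo p then recovers the part. The permutation t sends the larger parts to the small
    residues, which keeps the image below m. *)
Lemma star_iso_H (V : finType) p s m (p_gt0 : 0 < p) (A : {set V}) (c : V -> 'I_p) :
  #|A| = s -> #|V| = s + m ->
  (forall i, #|part A c i| = m %/ p \/ #|part A c i| = (m %/ p).+1) ->
  iso (star_graph A c) (join (complete s) (turan p m)).
Proof.
move=> As Vn pk.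
have sm : \sum_i #|part A c i| = m.
  by apply: (@addnI s); rewrite -Vn (card_parts A c) As.
have [t tE] := balanced_perm p_gt0 sm pk.
pose rk v := index v (enum (part A c (c v))).
have vP v : v \notin A -> v \in part A c (c v) by rewrite inE eqxx andbT.
pose P v (w : 'I_s + 'I_m) := match w with
    | inl i => v \in A /\ i = index v (enum A) :> nat
    | inr j => v \notin A /\ j = rk v * p + t (c v) :> nat
    end.
have [f fE] : exists f : V -> 'I_s + 'I_m, forall v, P v (f v).
  apply: (@fin_all_exists _ (fun=> ('I_s + 'I_m)%type) P) => v; have [vA|vA] := boolP (v \in A).
    have h : index v (enum A) < s by rewrite -As cardE index_mem mem_enum.
    by exists (inl (Ordinal h)).
  have h : rk v < balanced p m (t (c v)).
    by rewrite -tE cardE index_mem mem_enum vP.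
  have h2 : rk v * p + t (c v) < m.
    have tp := ltn_ord (t (c v)); have em := divn_eq m p.
    have [h3|h3] := ltnP (rk v) (m %/ p); first by nia.
    by move: h; rewrite /balanced; case: ltnP => h4 h5; nia.
  by exists (inr (Ordinal h2)).
have fi : injective f.
  move=> u v fuv; have := fE u; have := fE v; rewrite -fuv /P.
  case: (f u) => i [vA ev] [uA]; rewrite ev => /esym e.
    by apply: (index_inj u _ _ e); rewrite mem_enum.
  have : t (c u) = t (c v).
    apply: val_inj; have := congr1 (modn^~ p) e.
    by rewrite !modnMDl !modn_small.
  move/perm_inj => ec.
  have er : rk u = rk v.
    by move: e; rewrite ec => /addIn /eqP; rewrite eqn_pmul2r // => /eqP.
  by move: er; rewrite /rk ec; apply: (index_inj u); rewrite mem_enum ?vP // -ec vP.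
exists f; first by apply: inj_card_bij; rewrite // card_sum !card_ord Vn.
move=> u v; rewrite /= /star_adj; have := fE u; have := fE v; rewrite /P.
have fuv : (f u == f v) = (u == v) by rewrite (inj_eq fi).
case: (f u) (f v) fuv => [i|i] [j|j] /= fuv [vA ej] [uA ei];
  rewrite ?uA ?vA ?(negPf uA) ?(negPf vA) ?orbT /= ?andbT.
- by rewrite /complete_adj -fuv.
- by apply/esym/eqP => uv; rewrite uv (negPf vA) in uA.
- by apply/esym/eqP => uv; rewrite uv vA in uA.
rewrite /turan_adj ei ej !modnMDl !modn_small //.
rewrite val_eqE (inj_eq perm_inj).
by case: (eqVneq u v) => [->|//]; rewrite eqxx.
Qed.

(** * Counting arcs *)

Section Arcs.

(** Twice the number of edges. It is the quadratic form at the constant vector 1, which lets edges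
    be counted by the same comparison as the spectral radius. *)
Definition arcs (G : graph) : nat := \sum_(u : G) degree u.

Lemma degreeE (G : graph) (u : G) : degree u = \sum_(v | adj u v) 1.
Proof. by rewrite /degree -sum1_card; apply: eq_bigl => v; rewrite inE. Qed.

Lemma edge_ends (G : graph) (e : {set G}) : e \in edges G ->
  exists x y, [/\ adj x y, x != y & e = [set x; y]].
Proof.
case/imset2P => x y _; rewrite inE => xy ->; exists x, y; split=> //.
by apply: contraTneq xy => ->; rewrite adj_irr.
Qed.

Lemma mem_edges (G : graph) (x y : G) : ([set x; y] \in edges G) = adj x y.
Proof.
apply/idP/idP => [/edge_ends[a [b [ab nab e]]]|xy]; last first.
  by apply/imset2P; exists x y; rewrite ?inE.
have : #|[set x; y]| == #|[set a; b]| by rewrite e.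
rewrite !cards2 nab; case: (eqVneq x y) => //= nxy _.
have : y \in [set a; b] by rewrite -e set22.
have : x \in [set a; b] by rewrite -e set21.
rewrite !inE => /orP[]/eqP ex /orP[]/eqP ey; move: nxy; rewrite ex ey ?eqxx //.
by rewrite adj_sym.
Qed.

Lemma arcs_edges (G : graph) : arcs G = #|edges G| * 2.
Proof.
rewrite -sum_nat_const.
have -> : \sum_(e in edges G) 2 = \sum_(e in edges G) #|e|.
  apply: eq_bigr => e /edge_ends[x [y [_ nxy ->]]]; by rewrite cards2 nxy.
have -> : \sum_(e in edges G) #|e| = \sum_(e in edges G) \sum_(u | u \in e) 1.
  by apply: eq_bigr => e _; rewrite sum1_card.
rewrite (exchange_big_dep predT) //=; apply: eq_bigr => u _.
have inj : {in [set v | adj u v] &, injective (fun v => [set u; v])}.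
  move=> v w; rewrite !inE => uv uw e.
  have : v \in [set u; w] by rewrite -e set22.
  rewrite !inE => /orP[/eqP vu|/eqP//].
  by rewrite vu adj_irr in uv.
rewrite /degree -(card_in_imset inj) sum1_card.
apply: eq_card => e; apply/imsetP/andP.
  by case=> v; rewrite inE => uv ->; rewrite mem_edges uv set21.
case=> /edge_ends[x [y [xy _ ->]]]; rewrite !inE => /orP[]/eqP->.
  by exists y; rewrite ?inE.
by exists x; rewrite ?inE 1?adj_sym // setUC.
Qed.

Lemma iso_arcs (G H : graph) : iso G H -> arcs G = arcs H.
Proof.
case=> f fb fa; rewrite /arcs [RHS](reindex f) /=; last exact: onW_bij.
apply: eq_bigr => u _; rewrite !degreeE [RHS](reindex f) /=; last exact: onW_bij.
by apply: eq_bigl => v; rewrite fa.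
Qed.

Lemma degree_star_in (V I : finType) (A : {set V}) (c : V -> I) u : u \in A ->
  @degree (star_graph A c) u = #|V| - 1.
Proof.
move=> uA; rewrite /degree -cardsT (cardsD1 u) inE add1n subn1 /=.
by apply: eq_card => v; rewrite !inE /= /star_adj uA eq_sym andbT.
Qed.

Lemma degree_star_out (V I : finType) (A : {set V}) (c : V -> I) u : u \notin A ->
  @degree (star_graph A c) u = #|V| - #|part A c (c u)|.
Proof.
move=> uA; rewrite -[part A c (c u)]setCK -cardsCs.
apply: eq_card => v; rewrite !inE /= /star_adj (negPf uA) negb_and negbK /=.
rewrite [c u == _]eq_sym; case: (eqVneq u v) => [<-|_] //.
by rewrite (negPf uA) eqxx.
Qed.

(** The ordered pairs that are not arcs are the diagonal of [A] and the pairs inside a part; the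
    additive form avoids truncated subtraction. *)
Lemma arcs_star (V I : finType) (A : {set V}) (c : V -> I) :
  arcs (star_graph A c) + #|A| + \sum_i #|part A c i| ^ 2 = #|V| ^ 2.
Proof.
have e1 : \sum_(u in A) @degree (star_graph A c) u + #|A| = #|A| * #|V|.
  rewrite (eq_bigr _ (fun u h => degree_star_in c h)) sum_nat_const.
  have [->|[v _]] := set_0Vmem A; first by rewrite cards0.
  have : 0 < #|V| by apply/card_gt0P; exists v.
  by case: #|V| => // k _; rewrite subn1 /= mulnS addnC.
have e2 i : \sum_(u in part A c i) @degree (star_graph A c) u +
    #|part A c i| ^ 2 = #|part A c i| * #|V|.
  rewrite (eq_bigr (fun=> #|V| - #|part A c i|)); last first.
    by move=> u; rewrite inE => /andP[uA /eqP <-]; rewrite degree_star_out.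
  rewrite sum_nat_const; have := max_card (mem (part A c i)).
  by move: #|V| #|part A c i| => a b; nia.
have e3 : \sum_(i : I) (\sum_(u in part A c i) @degree (star_graph A c) u +
    #|part A c i| ^ 2) = (\sum_i #|part A c i|) * #|V|.
  by rewrite big_distrl /=; apply: eq_bigr => i _; exact: e2.
have e4 : arcs (star_graph A c) = \sum_(u in A) @degree (star_graph A c) u +
    \sum_i \sum_(u in part A c i) @degree (star_graph A c) u.
  rewrite /arcs (bigID (mem A)) /=; congr (_ + _).
  rewrite (partition_big c predT) //=; apply: eq_bigr => i _.
  by apply: eq_bigl => v; rewrite inE.
rewrite e4 expnS expn1 {1}(card_parts A c) mulnDl -e1 -e3 big_split /=.
by rewrite -!addnA; congr addn; lia.
Qed.
End Arcs.

Notation H_join p s m := (join (complete s) (turan p m)).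

(** * Extremality of H(n,p,q) among star graphs *)

Section StarExtremal.
Local Open Scope ring_scope.

(** The gap between the concave function i / (l + i) and its chord through k and k + 1. The factor
    (j - k)(j - k - 1) is nonnegative at integers and vanishes only at the two sizes of a balanced
    partition, which gives both the inequality and its equality case. *)
Lemma frac_line (R : realFieldType) (l : R) (k j : nat) : 0 < l ->
  let g i := i%:R / (l + i%:R) in
  let b := l / ((l + k%:R) * (l + k.+1%:R)) in
  g k - b * k%:R + b * j%:R - g j =
  l * ((j%:R - k%:R) * (j%:R - k%:R - 1)) /
    ((l + k%:R) * (l + k.+1%:R) * (l + j%:R)).
Proof.
move=> l0 /=; have k0 : 0 <= k%:R :> R by rewrite ler0n.
have j0 : 0 <= j%:R :> R by rewrite ler0n.
by rewrite -natr1; field; rewrite !lt0r_neq0 //; lra.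
Qed.

Lemma consec_prod_ge0 (R : realFieldType) (k j : nat) :
  0 <= (j%:R - k%:R) * (j%:R - k%:R - 1) :> R.
Proof.
have [jk|kj] := leqP j k.
  have : j%:R <= k%:R :> R by rewrite ler_nat.
  by move=> h; apply: mulr_le0; lra.
have : k%:R + 1 <= j%:R :> R by rewrite natr1 ler_nat.
by move=> h; apply: mulr_ge0; lra.
Qed.

Lemma consec_prod_eq0 (R : realFieldType) (k j : nat) :
  (j%:R - k%:R) * (j%:R - k%:R - 1) = 0 :> R -> j = k \/ j = k.+1.
Proof.
move=> /eqP; rewrite mulf_eq0 -addrA -opprD natr1 !subr_eq0 !eqr_nat.
by case/orP => /eqP; [left|right].
Qed.

Variables (V : finType) (p s m : nat) (A : {set V}) (c : V -> 'I_p).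
Hypotheses (p_gt0 : (0 < p)%N) (As : #|A| = s) (Vn : #|V| = (s + m)%N).
Let l := rho (star_graph A c).
Let n i := #|part A c i|.

Let n_sum : (\sum_i n i)%N = m.
Proof. by apply: (@addnI s); rewrite -Vn (card_parts A c) As. Qed.

Let starf_H : starf (H_core s m) (@H_color p s m p_gt0) l =
  \sum_(i < p) (balanced p m i)%:R / (l + (balanced p m i)%:R) + s%:R / (l + 1).
Proof.
rewrite /starf card_H_core; congr (_ + _).
by apply: eq_bigr => i _; rewrite card_H_part.
Qed.

Let g i : algR := i%:R / (l + i%:R).
Let k := (m %/ p)%N.
Let b : algR := l / ((l + k%:R) * (l + k.+1%:R)).

Let g_le : 0 < l -> forall j, g j <= g k - b * k%:R + b * j%:R.
Proof.
move=> l0 j; rewrite -subr_ge0 /g /b frac_line //.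
apply: divr_ge0; first by rewrite mulr_ge0 ?consec_prod_ge0 ?ltW.
have i0 i : 0 <= l + i%:R by rewrite addr_ge0 ?ler0n ?ltW.
by rewrite !mulr_ge0.
Qed.

Let gk1 : 0 < l -> g k.+1 = g k - b * k%:R + b * k.+1%:R.
Proof.
move=> l0; apply/eqP; rewrite eq_sym -subr_eq0 /g /b frac_line //.
by rewrite -natr1 (_ : _ + 1 - _ - 1 = 0) ?mulr0 ?mul0r //; ring.
Qed.

(** At the spectral radius [l] of the given star graph [starf] equals 1; balancing the parts can
    only increase it, so [star_rho_ge] applies to the balanced graph at the same [l]. *)
Lemma star_rho_le : l <= rho (H_join p s m).
Proof.
have := rho_ge0 (star_graph A c); rewrite -/l le0r => /predU1P[->|l0].
  exact: rho_ge0.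
rewrite (iso_rho (H_star_iso s m p_gt0)); apply: star_rho_ge => //.
rewrite starf_H; have := starf_rho l0; rewrite /starf As -/l => f1.
rewrite -[leLHS]f1 lerD2r.
apply: (sum_le_balanced (g := g) p_gt0 (g_le l0) _ (gk1 l0) n_sum).
by rewrite -/k; ring.
Qed.

(** If [starf] of the balanced graph exceeded 1 at [l], its spectral radius would exceed [l]. So
    balancing gains nothing, every part size lies on the chord, and the parts were balanced
    already. *)
Lemma star_rho_eq : 0 < l -> rho (H_join p s m) <= l ->
  iso (star_graph A c) (H_join p s m).
Proof.
move=> l0; rewrite (iso_rho (H_star_iso s m p_gt0)) => Hl.
apply: star_iso_H => // i.
have gk : g k = g k - b * k%:R + b * k%:R by ring.
have : g (n i) = g k - b * k%:R + b * (n i)%:R.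
  apply: (sum_eq_balanced p_gt0 (g_le l0) gk (gk1 l0) n_sum).
  rewrite -(lerD2r (s%:R / (l + 1))) -starf_H.
  have := starf_rho l0; rewrite /starf As -/l => ->.
  rewrite leNgt; apply/negP => /(star_rho_gt l0).
  by rewrite ltNge Hl.
move/esym/eqP; rewrite -subr_eq0 /g /b frac_line // mulf_eq0 invr_eq0 => /orP[|].
  rewrite mulf_eq0 => /orP[/eqP l00|/eqP]; first by rewrite l00 ltxx in l0.
  by move/consec_prod_eq0.
have i0 j : l + j%:R != 0 by rewrite lt0r_neq0 // ltr_wpDr ?ler0n.
by rewrite !mulf_eq0 !(negPf (i0 _)).
Qed.

Lemma star_arcs_le : (arcs (star_graph A c) <= arcs (H_join p s m))%N.
Proof.
rewrite (iso_arcs (H_star_iso s m p_gt0)).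
have := arcs_star (H_core s m) (@H_color p s m p_gt0).
have := arcs_star A c; rewrite card_sum !card_ord Vn As card_H_core => e1.
have e3 : (\sum_(i < p) #|part (H_core s m) (@H_color p s m p_gt0) i| ^ 2 =
    \sum_(i < p) balanced p m i ^ 2)%N.
  by apply: eq_bigr => i _; rewrite card_H_part.
rewrite {}e3 => e2.
suff : (\sum_(i < p) balanced p m i ^ 2 <= \sum_i n i ^ 2)%N.
  rewrite /n; rewrite -/(H_star s m p_gt0) in e2.
  move: (arcs _) (arcs _) e1 e2 => a1 a2; move: (\sum_(i < p) _)%N (\sum_(i : _) _)%N => b1 b2; lia.
(* The chord of the concave function -j^2 through k and k + 1. *)
have g2 j : - (j ^ 2)%:R <= k%:R ^+ 2 + k%:R + - (2 * k%:R + 1) * j%:R :> rat.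
  have := consec_prod_ge0 rat k j; rewrite natrX; lra.
have := @sum_le_balanced rat p m (fun j => - (j ^ 2)%:R) _ _ p_gt0 g2 _ _ n n_sum.
rewrite !sumrN lerN2 -!natr_sum ler_nat; apply.
  by rewrite natrX -/k; ring.
by rewrite natrX -/k -natr1; ring.
Qed.
End StarExtremal.

Section HBounds.
Local Open Scope ring_scope.
Variables (p s m : nat) (p_gt0 : (0 < p)%N).

Lemma balanced_bounds i : (m %/ p <= balanced p m i <= (m %/ p).+1)%N.
Proof. by rewrite /balanced; case: (_ < _)%N; lia. Qed.

Lemma H_degree_ge u : (s + m - (m %/ p).+1 <= @degree (H_star s m p_gt0) u)%N.
Proof.
have [uA|uA] := boolP (u \in H_core s m).
  by rewrite degree_star_in // card_sum !card_ord leq_sub2l.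
rewrite degree_star_out // card_sum !card_ord card_H_part.
by rewrite leq_sub2l //; case/andP: (balanced_bounds (H_color p_gt0 u)).
Qed.

Lemma rho_arcs (G : graph) : (arcs G)%:R <= rho G * #|G|%:R.
Proof.
have := @rayleigh G (fun=> 1); rewrite /qform.
have -> : \sum_(u : G) (1 : algR) ^+ 2 = #|G|%:R.
  by rewrite (eq_bigr (fun=> 1)) ?sumr_const // => i _; rewrite expr1n.
suff -> : \sum_(u : G) \sum_(v | adj u v) (1 : algR) * 1 = (arcs G)%:R by [].
rewrite natr_sum; apply: eq_bigr => u _; rewrite degreeE natr_sum.
by apply: eq_bigr => v _; rewrite mulr1.
Qed.

Lemma rho_H_ge : (0 < s + m)%N ->
  (s + m)%:R - (m %/ p)%:R - 1 <= rho (H_join p s m).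
Proof.
move=> n0; rewrite (iso_rho (H_star_iso s m p_gt0)).
have := rho_arcs (H_star s m p_gt0).
have : ((s + m - (m %/ p).+1) * (s + m) <= arcs (H_star s m p_gt0))%N.
  rewrite mulnC -[X in (X * _)%N](_ : #|{: 'I_s + 'I_m}| = _); last first.
    by rewrite card_sum !card_ord.
  rewrite -sum_nat_const; apply: leq_sum => u _; exact: H_degree_ge.
rewrite -(ler_nat algR) => h1 h2; have := le_trans h1 h2.
rewrite card_sum !card_ord natrM ler_pM2r ?ltr0n //; apply: le_trans.
rewrite -addrA -opprD natr1.
have [h|h] := leqP (m %/ p).+1 (s + m); first by rewrite natrB.
by apply: (@le_trans _ _ 0); rewrite ?ler0n // subr_le0 ler_nat ltnW.
Qed.

(** The value l + b is tested in [starf] for m + 1. Raising l by b keeps at least the fraction 1 - b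
    / N of each relevant part term, where N = l + k; the part receiving the new vertex has size k
    and gains about l / N^2; the core loses O(s / N^2). So b may be almost l / (l + k), which is
    about 1 - 1/p. *)
Lemma rho_H_step (b : algR) (l := rho (H_join p s m)) (k := (m %/ p)%N) :
  0 < l -> 0 <= b <= 1 -> k%:R <= l + 1 ->
  b * (l + k%:R) + 8 + 36 * s%:R <= l -> l + b <= rho (H_join p s m.+1).
Proof.
move=> l0 /andP[b0 b1] kl bl.
rewrite (iso_rho (H_star_iso s m.+1 p_gt0)); apply: star_rho_ge; first by lra.
have f1 : starf (H_core s m) (@H_color p s m p_gt0) l = 1.
  have l1 : l = rho (H_star s m p_gt0) by apply: iso_rho; apply: H_star_iso.
  by rewrite l1; apply: starf_rho; rewrite l1 in l0.
move: f1; rewrite /starf !card_H_core.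
under eq_bigr => i _ do rewrite card_H_part.
under [in X in _ -> X]eq_bigr => i _ do rewrite card_H_part.
set i0 : 'I_p := Ordinal (ltn_pmod m p_gt0).
have k0 : 0 <= k%:R :> algR by rewrite ler0n.
have s0 : 0 <= s%:R :> algR by rewrite ler0n.
set N := l + k%:R in bl *.
have N0 : 0 < N by rewrite /N; lra.
have dec (x : algR) : k%:R <= x -> x / (l + x) * (1 - b / N) <= x / (l + b + x).
  move=> kx; have x0 : 0 <= x by lra.
  have -> : x / (l + b + x) = x / (l + x) * ((l + x) / (l + b + x)).
    by field; rewrite !lt0r_neq0 //; lra.
  apply: ler_wpM2l; first by apply: divr_ge0; lra.
  have y0 : 0 < l + x by lra.
  have -> : (l + x) / (l + b + x) = 1 - b / (l + b + x).
    by field; rewrite lt0r_neq0 //; lra.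
  rewrite lerD2l lerN2 ler_wpM2l // lef_pV2 ?posrE //; rewrite /N; lra.
move=> f1.
set S := \sum_(i < p) _ in f1; set S' := \sum_(i < p) _.
have S'E : S * (1 - b / N) + (l + b) / ((N + b) * (N + b + 1)) <= S'.
  rewrite /S' (bigD1 i0) //= /S (bigD1 i0) //= mulrDl mulr_suml.
  have -> : balanced p m.+1 i0 = k.+1.
    by rewrite balancedS // eqxx /balanced /= ltnn addn0 addn1.
  have -> : balanced p m i0 = k by rewrite /balanced /= ltnn addn0.
  rewrite addrAC; apply: lerD.
    have := dec _ (lexx k%:R).
    have -> : k.+1%:R / (l + b + k.+1%:R) =
        k%:R / (l + b + k%:R) + (l + b) / ((N + b) * (N + b + 1)) :> algR.
      by rewrite /N -natr1; field; rewrite !lt0r_neq0 //; lra.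
    by rewrite lerD2r.
  apply: ler_sum => i ii.
  have -> : balanced p m.+1 i = balanced p m i.
    by rewrite balancedS // -[(i == _ :> nat)]/(i == i0) (negPf ii) addn0.
  by apply: dec; rewrite ler_nat; case/andP: (balanced_bounds i).
apply: le_trans (lerD S'E (lexx _)).
have sE : s%:R / (l + 1) - 4 * s%:R / N ^+ 2 * b <= s%:R / (l + b + 1).
  have -> : s%:R / (l + b + 1) = s%:R / (l + 1) - s%:R / ((l + 1) * (l + b + 1)) * b.
    by field; rewrite !lt0r_neq0 //; lra.
  rewrite lerD2l lerN2 ler_wpM2r //.
  have -> : 4 * s%:R / N ^+ 2 = s%:R * (4 / N ^+ 2) by ring.
  rewrite ler_wpM2l //.
  rewrite -[4]invrK -invfM lef_pV2 ?posrE; last 2 first.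
  - by rewrite mulr_gt0; lra.
  - by rewrite mulr_gt0 ?invr_gt0 ?exprn_gt0; lra.
  have h : N / 2 <= l + 1 by rewrite /N; lra.
  have -> : 4^-1 * N ^+ 2 = (N / 2) * (N / 2) by field.
  by apply: ler_pM; lra.
have gain : b / N + 4 * s%:R / N ^+ 2 <= (l + b) / ((N + b) * (N + b + 1)).
  have -> : b / N + 4 * s%:R / N ^+ 2 = (b * N + 4 * s%:R) / N ^+ 2.
    by field; rewrite lt0r_neq0.
  rewrite ler_pdivrMr ?exprn_gt0 // mulrAC ler_pdivlMr; last by rewrite mulr_gt0; lra.
  have lN : l <= N by rewrite /N; lra.
  have N1 : 1 <= N.
    have : 0 <= b * N by rewrite mulr_ge0 // ltW.
    by lra.
  have bN : 0 <= b * N by rewrite mulr_ge0 // ltW.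
  apply: (@le_trans _ _ ((b * N + 4 * s%:R) * ((N + 1) * (N + 2)))).
    apply: ler_wpM2l; first by lra.
    by apply: ler_pM; lra.
  (* The constants 8 and 36 pay for the lower-order terms of (N + 1)(N + 2), by b N <= N <= N^2. *)
  apply: (@le_trans _ _ ((b * N + 8 + 36 * s%:R) * N ^+ 2)); last first.
    by apply: ler_wpM2r; [rewrite exprn_ge0 //; lra|lra].
  have bNN : b * N <= N by rewrite ler_piMl //; lra.
  have NN : N <= N ^+ 2 by rewrite expr2 ler_peMl //; lra.
  have e3 : b * N * N <= N ^+ 2 by rewrite expr2 ler_wpM2r //; lra.
  have sN : s%:R <= s%:R * N by rewrite ler_peMr.
  have sNN : s%:R * N <= s%:R * N ^+ 2 by rewrite ler_wpM2l.
  rewrite -subr_ge0.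
  have -> : (b * N + 8 + 36 * s%:R) * N ^+ 2 - (b * N + 4 * s%:R) * ((N + 1) * (N + 2))
     = 8 * N ^+ 2 - 3 * (b * N * N) - 2 * (b * N) +
       32 * (s%:R * N ^+ 2) - 12 * (s%:R * N) - 8 * s%:R by ring.
  by lra.
have SE : S = 1 - s%:R / (l + 1) by lra.
apply: le_trans (lerD (lexx _) sE).
have bs : 4 * s%:R / N ^+ 2 * b <= 4 * s%:R / N ^+ 2.
  by rewrite ler_piMr // divr_ge0 ?exprn_ge0 //; lra.
have bS : S * (b / N) <= b / N.
  rewrite ler_piMl ?divr_ge0 //; first lra.
  rewrite SE gerBl divr_ge0; lra.
by rewrite mulrBr mulr1; lra.
Qed.
End HBounds.

(** * Deleting a vertex of least weight *)

Section Deletion.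
Local Open Scope ring_scope.
Variable G : graph.

Definition del (w : G) : graph := induced (~: [set w]).

Lemma card_del w : #|del w| = #|G|.-1.
Proof.
rewrite card_sig -cardsT (cardsD1 w [set: G]) inE add1n /=.
by apply: eq_card => v; rewrite !inE andbT.
Qed.

Lemma subgraph_del w : subgraph (del w) G.
Proof. by exists val => //; apply: val_inj. Qed.

Lemma sum_del (M : nmodType) w (f : G -> M) :
  \sum_v f v = f w + \sum_(v : del w) f (val v).
Proof.
rewrite (bigD1 w) //=; congr (_ + _); rewrite -big_sub.
by apply: eq_bigl => v; rewrite !inE.
Qed.

Lemma sum_del_adj (M : nmodType) w (u : del w) (f : G -> M) :
  \sum_(v | adj (val u) v) f v =
  (if adj w (val u) then f w else 0) + \sum_(v : del w | adj u v) f (val v).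
Proof.
rewrite (bigID (pred1 w)) /= -big_sub_cond; congr (_ + _); last first.
  by apply: eq_bigl => v; rewrite !inE andbC.
rewrite adj_sym; case: ifP => h; last first.
  by rewrite big1 // => v /andP[a /eqP e]; rewrite e h in a.
by rewrite (big_pred1 w) // => v /=; case: eqP => [->|]; rewrite ?andbT ?andbF.
Qed.

Lemma arcs_del w : (arcs G = arcs (del w) + 2 * degree w)%N.
Proof.
have e : (arcs G = degree w + \sum_(u : del w) degree (val u))%N.
  exact: (@sum_del nat).
have -> : arcs (del w) = (\sum_(u : del w) \sum_(v : del w | adj u v) 1)%N.
  by apply: eq_bigr => u _; rewrite degreeE.
rewrite e; have -> : (\sum_(u : del w) degree (val u) =
   \sum_(u : del w) ((adj w (val u)) + \sum_(v : del w | adj u v) 1))%N.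
  apply: eq_bigr => u _; rewrite degreeE.
  by rewrite (@sum_del_adj nat w u (fun=> 1%N)).
rewrite big_split /=.
suff -> : (\sum_(u : del w) adj w (val u) = degree w)%N by lia.
have : (\sum_v adj w v = adj w w + \sum_(u : del w) adj w (val u))%N.
  exact: (@sum_del nat w (fun v => adj w v : nat)).
rewrite adj_irr add0n => <-; rewrite degreeE [RHS]big_mkcond.
by apply: eq_bigr => v _; case: (adj w v).
Qed.

(** Cauchy-Schwarz against the constant vector. *)
Lemma sum_sqr_le (S : {set G}) (x : G -> algR) :
  (\sum_(v in S) x v) ^+ 2 <= #|S|%:R * \sum_(v in S) x v ^+ 2.
Proof.
set s := \sum_(v in S) x v; set t := \sum_(v in S) _.
have [S0|S0] := posnP #|S|.
  have -> : s = 0 by rewrite /s (cards0_eq S0) big_set0.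
  by rewrite S0 expr0n mul0r.
have n0 : (0 : algR) < #|S|%:R by rewrite ltr0n.
have : 0 <= \sum_(v in S) (#|S|%:R * x v - s) ^+ 2.
  by apply: sumr_ge0 => v _; rewrite exprn_even_ge0.
have -> : \sum_(v in S) (#|S|%:R * x v - s) ^+ 2 = #|S|%:R * (#|S|%:R * t - s ^+ 2).
  have -> : \sum_(v in S) (#|S|%:R * x v - s) ^+ 2 =
    \sum_(v in S) (#|S|%:R ^+ 2 * x v ^+ 2 + (- 2 * #|S|%:R * s * x v + s ^+ 2)).
    by apply: eq_bigr => v _; ring.
  by rewrite !big_split /= sumr_const -!mulr_sumr -/s -/t -[_ *+ _]mulr_natl; ring.
by rewrite pmulr_rge0 // subr_ge0.
Qed.

(* [w] has the least weight for the normalised Perron vector, and [X] is the square of that weight. *)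
Lemma perron_del (u : G) (n := #|G|) (d := degree u) (r := rho G) :
  exists w, exists X : algR,
  [/\ 0 <= X, n%:R * X <= 1, r ^+ 2 * X <= d%:R * (1 - (n - d)%:R * X) &
      r * (1 - 2 * X) <= rho (del w) * (1 - X)].
Proof.
have G0 : (0 < #|G|)%N by apply/card_gt0P; exists u.
have [x [x0 [v0 xv0] xE]] := perron G0.
pose w := [arg min_(v < u) x v]%O.
have wmin v : x w <= x v by rewrite /w; case: arg_minP => //= i _ /(_ v); apply.
set N := \sum_v x v ^+ 2.
have N0 : 0 < N.
  rewrite /N (bigD1 v0) //= ltr_wpDr ?sumr_ge0 // => [v _|].
    by rewrite exprn_even_ge0.
  by rewrite exprn_even_gt0.
exists w; exists (x w ^+ 2 / N).
have xx v : x w ^+ 2 <= x v ^+ 2 by rewrite ler_sqr ?nnegrE.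
have card_le (S : {set G}) : #|S|%:R * x w ^+ 2 <= \sum_(v in S) x v ^+ 2.
  by rewrite mulr_natl -sumr_const; apply: ler_sum.
split.
- by rewrite divr_ge0 ?exprn_even_ge0 // ltW.
- rewrite mulrA ler_pdivrMr // mul1r.
  have := card_le [set: G]; rewrite cardsT => /le_trans; apply.
  by rewrite (eq_bigl xpredT) // => v; rewrite inE.
- have -> : r ^+ 2 * (x w ^+ 2 / N) = (r * x w) ^+ 2 / N by ring.
  have -> : d%:R * (1 - (n - d)%:R * (x w ^+ 2 / N)) =
      d%:R * (N - (n - d)%:R * x w ^+ 2) / N.
    by field; rewrite lt0r_neq0.
  rewrite ler_pM2r ?invr_gt0 //.
  (* The least weight is at most that of [u]. Cauchy-Schwarz bounds the eigenvalue equation at [u]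
     by the square weight of its d neighbours, and the other n - d vertices each keep at least the
     least square weight. *)
  apply: (@le_trans _ _ ((r * x u) ^+ 2)).
    rewrite ler_sqr ?nnegrE ?mulr_ge0 ?rho_ge0 //.
    by apply: ler_wpM2l; rewrite ?rho_ge0.
  rewrite -xE; have -> : \sum_(v | adj u v) x v = \sum_(v in [set v | adj u v]) x v.
    by apply: eq_bigl => v; rewrite inE.
  apply: le_trans (sum_sqr_le _ _) _; rewrite -/(degree u) -/d.
  apply: ler_wpM2l; first by rewrite ler0n.
  have := card_le (~: [set v | adj u v]).
  have -> : #|~: [set v | adj u v]| = (n - d)%N.
    by rewrite [LHS]cardsCs setCK.
  have -> : \sum_(v in ~: [set v | adj u v]) x v ^+ 2 =
      N - \sum_(v in [set v | adj u v]) x v ^+ 2.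
    rewrite /N [in RHS](bigID (mem [set v | adj u v])) /= addrAC subrr add0r.
    by apply: eq_bigl => v; rewrite !inE.
  by lra.
have := @rayleigh (del w) (fun v => x (val v)).
have -> : \sum_(v : del w) x (val v) ^+ 2 = N - x w ^+ 2.
  by rewrite /N (sum_del w) addrAC subrr add0r.
have -> : @qform _ (del w) (fun v => x (val v)) = r * N - 2 * r * x w ^+ 2.
  have -> : r * N = qform x.
    rewrite /qform /N mulr_sumr; apply: eq_bigr => v _.
    by rewrite -mulr_sumr xE -/r; ring.
  rewrite /qform (sum_del w).
  have -> : \sum_(v | adj w v) x w * x v = r * x w ^+ 2.
    by rewrite -mulr_sumr xE /r; ring.
  have -> : \sum_(u0 : del w) \sum_(v | adj (val u0) v) x (val u0) * x v =
     \sum_(u0 : del w) (if adj w (val u0) then x (val u0) * x w else 0) +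
     \sum_(u0 : del w) \sum_(v : del w | adj u0 v) x (val u0) * x (val v).
    rewrite -big_split /=; apply: eq_bigr => v _.
    by rewrite (sum_del_adj v (fun z => x (val v) * x z)).
  have -> : \sum_(u0 : del w) (if adj w (val u0) then x (val u0) * x w else 0) = r * x w ^+ 2.
    rewrite expr2 mulrA -xE mulr_suml [RHS]big_mkcond [RHS](sum_del w) adj_irr add0r.
    by [].
  by rewrite /r; ring.
move=> h; rewrite -(ler_pM2r N0).
have -> : r * (1 - 2 * (x w ^+ 2 / N)) * N = r * N - 2 * r * x w ^+ 2.
  by field; rewrite lt0r_neq0.
by have -> : rho (del w) * (1 - x w ^+ 2 / N) * N = rho (del w) * (N - x w ^+ 2);
  [field; rewrite lt0r_neq0|].
Qed.
End Deletion.

Section LowDegree.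
Local Open Scope ring_scope.

Lemma rho_le_card (G : graph) : rho G <= #|G|%:R.
Proof.
have [G0|/card_gt0P[u _]] := posnP #|G|.
  have := rho_arcs G; rewrite G0 mulr0 => _.
  have e0 : eigenvalues (adjacency_mx G) = [::].
    case: (eigenvalues _) (@eigenvaluesP _ (adjacency_mx G)) => [//|a s] /(_ a).
    rewrite inE eqxx /= => /esym/eigenvalueP[v _ /rV0Pn[i _]].
    by case: i; rewrite G0.
  have -> : rho G = 0 by apply: val_inj; rewrite /= /spectral_radius e0 big_nil.
  by [].
have G0 : (0 < #|G|)%N by apply/card_gt0P; exists u.
have [x [x0 [v0 xv0] xE]] := perron G0.
pose w := [arg max_(v > u) x v]%O.
have wmax v : x v <= x w by rewrite /w; case: arg_maxP => //= i _ /(_ v); apply.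
have xw : 0 < x w by apply: lt_le_trans (wmax v0); rewrite lt_def xv0 x0.
rewrite -(ler_pM2r xw) -xE mulr_natl -sumr_const [leRHS](bigID (adj w)) /=.
rewrite ler_wpDr ?sumr_ge0 //.
by apply: ler_sum.
Qed.

(** The degree y and the spectral radius r are divided by the order. In terms of z = r - y the form
    is a sum of nonnegative terms, of which a z^2 alone gives the bound. *)
Lemma low_degree_form (R : realFieldType) (a dl y r : R) :
  1 / 2 <= a <= 1 -> 0 < dl -> 0 <= y <= a - dl -> a - dl / 2 <= r ->
  dl ^+ 2 / 8 <= a * (r ^+ 2 + y * (1 - y)) - y * r.
Proof.
move=> /andP[a1 a2] d0 /andP[y0 y1] ar; set z := r - y.
have z1 : dl / 2 <= z by rewrite /z; lra.
have -> : a * (r ^+ 2 + y * (1 - y)) - y * r =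
    y * (a - y) + y * z * (2 * a - 1) + a * z ^+ 2 by rewrite /z; ring.
have t1 : 0 <= y * (a - y) by apply: mulr_ge0; lra.
have t2 : 0 <= y * z * (2 * a - 1) by rewrite mulr_ge0 ?mulr_ge0 //; lra.
have t3 : (dl / 2) ^+ 2 <= z ^+ 2 by rewrite ler_sqr ?nnegrE; lra.
have t4 : 1 / 2 * (dl / 2) ^+ 2 <= a * z ^+ 2.
  by apply: ler_pM => //; rewrite ?exprn_even_ge0 //; lra.
by lra.
Qed.

(** In H a vertex accounts for about a = 1 - 1/p of the spectral radius; here the loss stays below
    [a] by a constant. Otherwise the least square weight X would exceed b / (r + 1), while the low
    degree d of [u] caps X at d / (r^2 + d (n - d)). *)
Lemma rho_del_low (G : graph) (u : G) (a dl : algR) (n : algR := #|G|%:R) :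
  1 / 2 <= a <= 1 -> 0 < dl <= 1 -> (degree u)%:R <= (a - dl) * n ->
  a * n - 2 <= rho G -> 16 <= n * dl ^+ 2 ->
  exists w : G, rho G - (a - dl ^+ 2 / 20) <= rho (del w).
Proof.
move=> a12 /andP[d0 d1] degu rG nbig.
have [w [X [X0 nX rX hX]]] := perron_del u.
exists w; set r := rho G in rG rX hX *; set r' := rho (del w) in hX *.
have dn : (degree u <= #|G|)%N by apply: max_card.
rewrite natrB // -/n in rX; rewrite -/n in nX.
set d : algR := (degree u)%:R in degu rX.
rewrite leNgt; apply/negP => lt.
have dl2 : dl ^+ 2 <= 1 by rewrite expr_le1 // ltW.
have dl20 : 0 < dl ^+ 2 by rewrite exprn_gt0.
have n16 : 16 <= n.
  have n0 : 0 <= n by rewrite ler0n.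
  by apply: le_trans nbig _; rewrite ler_piMr.
have n0 : 0 < n by lra.
have r0 : 0 <= r := rho_ge0 G.
(* The slack dl^2 / 8 of [low_degree_form] pays for y / n <= dl^2 / 16 and for dl^2 / 20 times a
   factor of at most 5/4, again dl^2 / 16. *)
set b := a - dl ^+ 2 / 20 in lt.
have /andP[a1 a2] := a12.
have b1 : 0 < b <= 1 by rewrite /b; lra.
have X1 : X <= 1 / 16.
  by rewrite ler_pdivlMr // mulrC; apply: le_trans nX; rewrite ler_wpM2r.
have bX : b < X * (r + 1).
  have h : (r - r') * (1 - X) <= r * X by lra.
  have h2 : b * (1 - X) < (r - r') * (1 - X) by rewrite ltr_pM2r; lra.
  have h3 : b * X <= X by rewrite ler_piMl; lra.
  by lra.
have Q : X * (r ^+ 2 + d * (n - d)) <= d by lra.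
have Q0 : 0 <= r ^+ 2 + d * (n - d).
  rewrite addr_ge0 ?exprn_even_ge0 // mulr_ge0 // subr_ge0.
  by rewrite /d /n ler_nat.
have key : d * (r + 1) <= b * (r ^+ 2 + d * (n - d)).
  set y := d / n; set s := r / n.
  have yn : d = y * n by rewrite /y mulfVK // lt0r_neq0.
  have sn : r = s * n by rewrite /s mulfVK // lt0r_neq0.
  have y0 : 0 <= y by rewrite divr_ge0 // ltW.
  have y1 : y <= a - dl by rewrite ler_pdivrMr.
  have s1 : a - dl / 2 <= s.
    rewrite ler_pdivlMr //; apply: le_trans rG.
    have h : 16 <= n * dl.
      apply: le_trans nbig _; rewrite ler_pM2l // expr2 ler_piMr //; lra.
    by lra.
  have F := low_degree_form a12 d0 (introT andP (conj y0 y1)) s1.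
  have rn : s <= 1 by rewrite ler_pdivrMr // mul1r rho_le_card.
  have -> : d * (r + 1) = (y * s + y / n) * n ^+ 2.
    by rewrite yn sn; field; rewrite lt0r_neq0.
  have -> : b * (r ^+ 2 + d * (n - d)) = b * (s ^+ 2 + y * (1 - y)) * n ^+ 2.
    by rewrite yn sn; ring.
  rewrite ler_pM2r ?exprn_gt0 //.
  have yn1 : y / n <= dl ^+ 2 / 16.
    by rewrite ler_pdivrMr //; lra.
  have s2 : s ^+ 2 <= 1 by rewrite expr_le1 // divr_ge0 // ltW.
  have yy : y * (1 - y) <= 1 / 4.
    have := sqr_ge0 (y - 1 / 2); lra.
  have cc : dl ^+ 2 / 20 * (s ^+ 2 + y * (1 - y)) <= dl ^+ 2 / 20 * (5 / 4).
    by apply: ler_wpM2l; lra.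
  rewrite /b; lra.
set Z := r ^+ 2 + d * (n - d) in Q Q0 key.
have Z0 : 0 < Z.
  have an : 1 / 2 * n <= a * n by apply: ler_wpM2r; lra.
  have r_gt0 : 0 < r by lra.
  by rewrite ltr_wpDr ?exprn_gt0 // mulr_ge0 // subr_ge0 /d /n ler_nat.
have h1 : b * Z < X * (r + 1) * Z by rewrite ltr_pM2r.
have h2 : X * Z * (r + 1) <= d * (r + 1) by rewrite ler_wpM2r //; lra.
by lra.
Qed.
End LowDegree.

(* With denominators cleared: the minimum degree is at least (1 - 1/p - 1/D) n. *)
Definition dense p D (G : graph) : bool :=
  [forall u : G, D * (p - 1) * #|G| <= D * p * degree u + p * #|G|].

(** * Progressive induction *)

Section Progressive.
Local Open Scope ring_scope.

Lemma nat_upper (x : algR) : exists N : nat, x <= N%:R.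
Proof.
exists (Num.bound `|x|); apply: le_trans (ler_norm _) _.
by rewrite ltW // archi_boundP.
Qed.

(** Deletions from a graph that is not good raise the excess [Psi G - h #|G|] by [c] each, but at
    order [N1] the excess is at most [C N1]. So a nonnegative excess cannot survive through too many
    deletions, and a good graph met on the way has no positive excess. *)
Lemma progressive (P : graph -> Prop) (good : graph -> bool)
    (Psi : graph -> algR) (h C : nat -> algR) (c : algR) (N1 : nat) :
  0 < c ->
  (forall G, Psi G - h #|G| <= C #|G|) ->
  (forall G, P G -> (N1 <= #|G|)%N -> good G -> Psi G <= h #|G|) ->
  (forall G, P G -> (N1 <= #|G|)%N -> ~~ good G -> h #|G| <= Psi G ->
    exists G', [/\ P G', #|G'| = #|G|.-1 &
      Psi G - h #|G| + c <= Psi G' - h #|G'|]) ->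
  exists N2, forall G, P G -> (N2 <= #|G|)%N ->
    Psi G <= h #|G| /\ (h #|G| <= Psi G -> good G).
Proof.
move=> c0 bnd gd step.
have excess k G : P G -> #|G| = (N1 + k)%N ->
    Psi G <= h #|G| \/ Psi G - h #|G| <= C N1 - c * k%:R.
  elim: k G => [|k IH] G PG Gk.
    by right; rewrite mulr0 subr0 -[N1]addn0 -Gk.
  have N1G : (N1 <= #|G|)%N by rewrite Gk leq_addr.
  have [le|lt] := leP (Psi G) (h #|G|); [by left|right].
  have ngG : ~~ good G by apply/negP => /(gd _ PG N1G); rewrite leNgt lt.
  have [G' [PG' G'k ex]] := step _ PG N1G ngG (ltW lt).
  have G'E : #|G'| = (N1 + k)%N by rewrite G'k Gk addnS.
  have [] := IH _ PG' G'E; first by lra.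
  by rewrite -natr1; lra.
have [K CK] : exists K, C N1 < c * K%:R.
  have [K KE] := nat_upper (C N1 / c); exists K.+1.
  rewrite [c * _]mulrC -ltr_pdivrMr //; apply: le_lt_trans KE _.
  by rewrite ltr_nat.
have le G : P G -> (N1 + K <= #|G|)%N -> Psi G <= h #|G|.
  move=> PG big; have [||ex] := excess (#|G| - N1)%N G PG; [by lia|by []|].
  suff : c * K%:R <= c * (#|G| - N1)%:R by lra.
  by rewrite ler_pM2l // ler_nat; lia.
(* One more vertex leaves room for a single deletion, which would turn a nonnegative excess into a
   positive one. *)
exists (N1 + K).+1%N => G PG big; split=> [|leG]; first by apply: (le _ PG); lia.
apply: contraT => ngG; exfalso.
have N1G : (N1 <= #|G|)%N by lia.
have [G' [PG' G'k ex]] := step _ PG N1G ngG leG.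
have : Psi G' <= h #|G'| by apply: (le _ PG'); rewrite G'k; lia.
by lra.
Qed.

Lemma div_le_ratio (R : realFieldType) p m : (0 < p)%N ->
  (m %/ p)%:R <= m%:R / p%:R :> R.
Proof.
by move=> p0; rewrite ler_pdivlMr ?ltr0n // -natrM ler_nat leq_divM.
Qed.

Lemma rho_H_ge_lin p s m : (0 < p)%N -> (0 < s + m)%N ->
  (1 - p%:R^-1) * (s + m)%:R - 1 <= rho (H_join p s m).
Proof.
move=> p0 n0; apply: le_trans (rho_H_ge p0 n0).
have := div_le_ratio algR m p0; rewrite natrD.
have : 0 <= s%:R / p%:R :> algR by rewrite divr_ge0 ?ler0n.
by lra.
Qed.

Lemma rho_H_incr p s (c : algR) : (2 <= p)%N -> 0 < c <= 1 / 2 ->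
  exists N, forall m, (N <= m)%N ->
    rho (H_join p s m) + (1 - p%:R^-1 - c) <= rho (H_join p s m.+1).
Proof.
move=> p2 /andP[c0 c1]; have p0 : (0 < p)%N by lia.
have [N NE] := nat_upper ((10 + 36 * s%:R) / c); exists N.+4 => m Nm.
have cm : 10 + 36 * s%:R <= c * m%:R.
  rewrite [c * _]mulrC -ler_pdivrMr //; apply: le_trans NE _.
  by rewrite ler_nat; lia.
have ip : (p%:R^-1 : algR) <= 1 / 2.
  by rewrite mul1r lef_pV2 ?posrE ?ltr0n // ler_nat.
have ip0 : 0 < (p%:R^-1 : algR) by rewrite invr_gt0 ltr0n.
have s0 : (0 : algR) <= s%:R by rewrite ler0n.
have k1 : ((m %/ p)%:R : algR) <= p%:R^-1 * m%:R by rewrite mulrC div_le_ratio.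
have rH : s%:R + m%:R - (m %/ p)%:R - 1 <= rho (H_join p s m).
  by rewrite -natrD; apply: rho_H_ge => //; lia.
have m4 : (4 : algR) <= m%:R by rewrite ler_nat; lia.
have k0 : 0 <= ((m %/ p)%:R : algR) by rewrite ler0n.
have k2 : p%:R^-1 * m%:R <= 1 / 2 * m%:R :> algR by rewrite ler_wpM2r; lra.
move: rH k1 k0; set l := rho _; set k := (_ %/ _)%:R => rH k1 k0.
apply: rho_H_step => //; rewrite -/l -/k; try lra.
have e : (p%:R^-1 + c) * (m%:R - k - 1) <= (p%:R^-1 + c) * l.
  by apply: ler_wpM2l; lra.
have : (p%:R^-1 + c) * 1 <= 1 by lra.
by lra.
Qed.

Lemma not_dense_degree p D (G : graph) : (0 < p)%N -> (0 < D)%N -> ~~ dense p D G ->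
  exists u : G, (degree u)%:R <= (1 - p%:R^-1 - D%:R^-1) * #|G|%:R :> algR.
Proof.
move=> p0 D0 /forallPn[u]; rewrite -ltnNge => h; exists u.
have {}h : (D * p * degree u + p * #|G| + D * #|G| <= D * p * #|G|)%N by nia.
have pD : 0 < D%:R * p%:R :> algR by rewrite mulr_gt0 ?ltr0n.
rewrite -(ler_pM2l pD); move: h; rewrite -(ler_nat algR) !natrD !natrM => h.
have -> : D%:R * p%:R * ((1 - p%:R^-1 - D%:R^-1) * #|G|%:R) =
  D%:R * p%:R * #|G|%:R - p%:R * #|G|%:R - D%:R * #|G|%:R :> algR.
  by field; rewrite !pnatr_eq0 -!lt0n p0 D0.
by lra.
Qed.

Variables (P : graph -> Prop) (p s : nat).
Hypotheses (p_ge2 : (2 <= p)%N) (P_del : forall G w, P G -> P (@del G w)).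

Lemma spectral_reduction D N : (2 <= D)%N ->
  (forall G, P G -> (N <= #|G|)%N -> dense p D G ->
    rho (H_join p s (#|G| - s)) <= rho G -> iso G (H_join p s (#|G| - s))) ->
  exists N2, forall G, P G -> (N2 <= #|G|)%N ->
    rho (H_join p s (#|G| - s)) <= rho G -> iso G (H_join p s (#|G| - s)).
Proof.
move=> D2 hD; pose dl : algR := D%:R^-1.
have D0 : (0 < D)%N by lia.
have p0 : (0 < p)%N by lia.
have dl0 : 0 < dl by rewrite invr_gt0 ltr0n.
have dl1 : dl <= 1 by rewrite invf_le1 ?ltr0n // ler1n.
have dl2 : 0 < dl ^+ 2 by rewrite exprn_gt0.
have dl3 : dl ^+ 2 <= 1 by rewrite expr_le1 // ltW.
have ip : (p%:R^-1 : algR) <= 1 / 2.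
  by rewrite mul1r lef_pV2 ?posrE ?ltr0n // ler_nat.
have ip0 : 0 < (p%:R^-1 : algR) by rewrite invr_gt0 ltr0n.
(* Half of the saving dl^2 / 20 of [rho_del_low] covers the error in the growth of H; the other half
   is the gain per deletion. *)
have c12 : 0 < dl ^+ 2 / 40 <= 1 / 2 by apply/andP; split; lra.
have [M ME] := rho_H_incr s p_ge2 c12.
have [K KE] := nat_upper (16 / dl ^+ 2).
pose h n := rho (H_join p s (n - s)).
have [||||N2 N2E] := @progressive P (dense p D) rho h (fun n => n%:R)
  (dl ^+ 2 / 40) (N + M + K + s).+2.
- by lra.
- move=> G; have := rho_le_card G; have := rho_ge0 (H_join p s (#|G| - s)).
  by rewrite /h; lra.
- move=> G PG NG dG; rewrite leNgt; apply/negP => lt.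
  have := hD _ PG _ dG (ltW lt); move=> /(_ _)/iso_rho => e.
  by move: lt; rewrite /h e ?ltxx //; clear -NG; lia.
- move=> G PG NG nd hG.
  have [u du] := not_dense_degree p0 D0 nd.
  have n0 : (0 < s + (#|G| - s))%N by clear -NG; lia.
  have Es : (s + (#|G| - s) = #|G|)%N by clear -NG; lia.
  have NK : (K <= #|G|)%N by clear -NG; lia.
  have NM : (M <= #|G|.-1 - s)%N by clear -NG; lia.
  have Es1 : (#|G|.-1 - s).+1 = (#|G| - s)%N by clear -NG; lia.
  have rG : (1 - p%:R^-1) * #|G|%:R - 2 <= rho G.
    apply: le_trans hG; apply: le_trans (rho_H_ge_lin p0 n0).
    by rewrite Es; lra.
  have nb : 16 <= #|G|%:R * dl ^+ 2.
    by rewrite -ler_pdivrMr //; apply: le_trans KE _; rewrite ler_nat.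
  have a12 : 1 / 2 <= (1 - p%:R^-1 : algR) <= 1 by apply/andP; split; lra.
  have [w wE] := rho_del_low (a := 1 - p%:R^-1) (dl := dl)
    a12 (introT andP (conj dl0 dl1)) du rG nb.
  exists (del w); split; [exact: P_del|exact: card_del|].
  rewrite card_del /h; have := ME _ NM; rewrite Es1.
  by clear -wE dl2; lra.
exists (N + N2)%N => G PG NG hG.
have [_ /(_ hG) dG] := N2E _ PG (leq_trans (leq_addl _ _) NG).
by apply: hD => //; apply: leq_trans NG; apply: leq_addr.
Qed.

Lemma arcs_H_incr m : (0 < s + m)%N ->
  (arcs (H_join p s m) + 2 * (s + m - m %/ p) = arcs (H_join p s m.+1))%N.
Proof.
move=> n0; have p0 : (0 < p)%N by lia.
rewrite !(iso_arcs (H_star_iso _ _ p0)).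
have := arcs_star (H_core s m) (@H_color p s m p0).
have := arcs_star (H_core s m.+1) (@H_color p s m.+1 p0).
rewrite !card_sum !card_ord !card_H_core.
under eq_bigr => i _ do rewrite card_H_part.
move=> e1; under eq_bigr => i _ do rewrite card_H_part.
move: e1; pose i0 : 'I_p := Ordinal (ltn_pmod m p0).
rewrite (bigD1 i0) //= [X in _ -> (_ + X = _)%N -> _](bigD1 i0) //=.
have -> : (\sum_(i < p | i != i0) balanced p m.+1 i ^ 2 =
   \sum_(i < p | i != i0) balanced p m i ^ 2)%N.
  apply: eq_bigr => i ii.
  by rewrite balancedS // -[(i == _ :> nat)]/(i == i0) (negPf ii) addn0.
have b0 : balanced p m (m %% p) = (m %/ p)%N by rewrite /balanced ltnn addn0.
rewrite balancedS ?ltn_pmod // eqxx b0 addn1.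
have km : (m %/ p <= m)%N by apply: leq_div.
rewrite -!/(H_star _ _ p0); move: (arcs _) (arcs _) => a1 a2.
move: (\sum_(i < p | _) _)%N (m %/ p)%N km => S k km; rewrite !expnS !expn0 !muln1.
by nia.
Qed.

Lemma natr_sub_le (a b c d : nat) : (a + 1 + d <= c + b)%N ->
  a%:R - b%:R + 1 <= c%:R - d%:R :> algR.
Proof.
by rewrite -(ler_nat algR) (natrD _ _ d) (natrD _ a) (natrD _ c); lra.
Qed.

(** Deleting a low-degree vertex loses d edges, at least one fewer than the n - 1 - k edges that H
    loses with a vertex. As these are integers, the gain per deletion can be taken to be 1. *)
Lemma low_degree_nat D r n d k t : (0 < D)%N -> (0 < r)%N -> (D * 2 <= n)%N ->
  (2 < n)%N -> (D * r * d + r * n < D * (r - 1) * n)%N -> (k * r <= n.-1 - t)%N ->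
  (d.+1 <= n.-1 - k)%N.
Proof.
move=> D0 r0 Dn n2 du kn.
suff : (D * r * (d + k).+2 < D * r * n)%N by rewrite ltn_mul2l; lia.
have e1 : (D * (k * r) <= D * (n.-1 - t))%N by rewrite leq_mul2l kn orbT.
have e2 : (r * (D * 2) <= r * n)%N by rewrite leq_mul2l; lia.
have e4 : (D * (r - 1) * n + D * n = D * r * n)%N.
  by rewrite -mulnDl -mulnSr subn1 prednK.
by lia.
Qed.

Lemma arcs_reduction D N : (2 <= D)%N ->
  (forall G, P G -> (N <= #|G|)%N -> dense p D G ->
    (arcs G <= arcs (H_join p s (#|G| - s)))%N) ->
  exists N2, forall G, P G -> (N2 <= #|G|)%N ->
    (arcs G <= arcs (H_join p s (#|G| - s)))%N.
Proof.
move=> D2 hD; pose h n : algR := (arcs (H_join p s (n - s)))%:R.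
have [||||N2 N2E] := @progressive P (dense p D) (fun G => (arcs G)%:R) h
  (fun n => (n * n)%:R) 1 (N + s + D * 4).+2.
- exact: ltr01.
- move=> G; rewrite /h lerBlDr -natrD ler_nat.
  apply: leq_trans (leq_addr _ _); rewrite /arcs -sum_nat_const.
  by apply: leq_sum => u _; apply: max_card.
- by move=> G PG NG dG; rewrite ler_nat; apply: hD => //; clear -NG; lia.
- move=> G PG NG /forallPn[u]; rewrite -ltnNge => du hG.
  exists (del u); split; [exact: P_del|exact: card_del|].
  rewrite card_del /h (arcs_del u).
  have Es1 : (#|G|.-1 - s).+1 = (#|G| - s)%N by clear -NG; lia.
  have Es : (s + (#|G|.-1 - s) = #|G|.-1)%N by clear -NG; lia.
  have n0 : (0 < #|G|.-1)%N by clear -NG; lia.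
  have := @arcs_H_incr (#|G|.-1 - s)%N; rewrite Es Es1 => <- //.
  suff hk : ((degree u).+1 <= #|G|.-1 - (#|G|.-1 - s) %/ p)%N.
    by apply: natr_sub_le; clear -hk; lia.
  apply: (low_degree_nat _ _ _ _ du (leq_divM _ _)); clear -NG D2 p_ge2; lia.
exists N2 => G PG NG; have [+ _] := N2E _ PG NG.
by rewrite ler_nat.
Qed.
End Progressive.

(** * Dense graphs without large configurations *)

Section Configurations.
Variable G : graph.
Implicit Types (X Y : {set G}) (xs : seq G) (M : seq (G * G)).

Definition ends M : seq G := unzip1 M ++ unzip2 M.

Definition matching M : bool := uniq (ends M) && all (fun e => adj e.1 e.2) M.

Definition complete_to (S : nat -> {set G}) p :=
  forall i j, i < p -> j < p -> i != j ->
  forall x y, x \in S i -> y \in S j -> adj x y.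

(* The edges of M play the role of edges inside the part j0. *)
Definition config p q h := exists M j0 (S : nat -> {set G}),
  [/\ size M = q, matching M, j0 < p, forall j, j < p -> h <= #|S j| &
    [/\ complete_to S p,
        forall j x y, j < p -> j != j0 -> x \in ends M -> y \in S j -> adj x y &
        forall x, x \in ends M -> x \notin S j0]].

Lemma size_ends M : size (ends M) = 2 * size M.
Proof. by rewrite size_cat !size_map mul2n addnn. Qed.

Lemma perm_ends_cons u v M : perm_eq (ends ((u, v) :: M)) [:: u, v & ends M].
Proof. by rewrite /ends /= perm_cons (perm_catCA _ [:: v]). Qed.

Lemma exists_subset X k : k <= #|X| -> exists2 Y : {set G}, Y \subset X & #|Y| = k.
Proof.
move=> kX; exists [set x in take k (enum X)].
  by apply/subsetP => x; rewrite inE => /mem_take; rewrite mem_enum.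
by rewrite cardsE (card_uniqP _) ?take_uniq ?enum_uniq // size_takel -?cardE.
Qed.

(** Edges inside [X] are removed greedily together with their ends; if this stops early, the ends
    removed so far cover all edges inside [X]. *)
Lemma matching_or_cover q X :
  (exists M, [/\ size M = q, matching M & {subset ends M <= X}]) \/
  (exists C : {set G}, [/\ #|C| <= 2 * q &
     {in X :\: C &, forall u v, ~~ adj u v}]).
Proof.
elim: q X => [|q IH] X; first by left; exists [::].
have [/existsP[u /existsP[v /and3P[uX vX uv]]]|none] :=
  boolP [exists u, exists v, [&& u \in X, v \in X & adj u v]]; last first.
  right; exists set0; split=> [|u v]; first by rewrite cards0.
  rewrite !inE /= => uX vX; apply: contra none => uv.
  by apply/existsP; exists u; apply/existsP; exists v; rewrite uX vX.
case: (IH (X :\: [set u; v])) => [[M [sM mM subM]]|[C [cC iC]]].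
  left; exists ((u, v) :: M); split; first by rewrite /= sM.
    have nu x : x \in ends M -> (x != u) && (x != v).
      by move/subM; rewrite !inE negb_or => /andP[].
    have uv' : u != v by apply: contraTneq uv => ->; rewrite adj_irr.
    move: mM; rewrite /matching (perm_uniq (perm_ends_cons _ _ _)) /= uv.
    rewrite inE negb_or uv' /= => /andP[-> ->]; rewrite !andbT.
    by apply/andP; split; apply/negP => /nu; rewrite eqxx // andbF.
  move=> x; rewrite (perm_mem (perm_ends_cons _ _ _)) !inE.
  case/or3P => [/eqP->//|/eqP->//|/subM].
  by rewrite inE => /andP[].
right; exists (C :|: [set u; v]); split.
  apply: leq_trans (leq_card_setU _ _) _; rewrite cards2 mulnS addnC leq_add //.
  by case: (_ != _).
by move: iC; rewrite setDDl setUC.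
Qed.

Definition nbr (v : G) : {set G} := [set w | adj v w].

Definition common xs Y : {set G} := [set y in Y | all (fun x => adj x y) xs].

Lemma common_card xs Y e : (forall x, x \in xs -> #|Y :\: nbr x| <= e) ->
  #|Y| <= #|common xs Y| + size xs * e.
Proof.
elim: xs => [|x xs IH] miss.
  rewrite addn0 subset_leq_card //; apply/subsetP => y yY.
  by rewrite inE yY.
apply: leq_trans (IH _) _ => [z zxs|]; first by rewrite miss // inE zxs orbT.
rewrite /= mulSn addnA leq_add2r.
rewrite -(leq_add2r #|Y :\: nbr x|); have := miss x (mem_head _ _) => mx.
apply: (@leq_trans (#|common (x :: xs) Y :|: (Y :\: nbr x)| + #|Y :\: nbr x|)).
  rewrite leq_add2r subset_leq_card //; apply/subsetP => y; rewrite !inE /=.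
  by case: (adj x y) => /andP[-> ->].
apply: leq_trans (leq_add (leq_card_setU _ _) (leqnn _)) _.
by rewrite -!addnA leq_add2l [e + _]addnC leq_add2l.
Qed.

(** The parts are chosen one after the other: at most p h vertices have been chosen before, and each
    of them excludes at most e candidates. *)
Lemma greedy_blowup p h e (V U : nat -> {set G}) :
  (forall i j x, i < p -> j < p -> i != j -> x \in V i -> #|V j :\: nbr x| <= e) ->
  (forall j, j < p -> U j \subset V j /\ h + p * h * e <= #|U j|) ->
  exists S : nat -> {set G},
    [/\ forall j, j < p -> S j \subset U j, forall j, j < p -> #|S j| = h &
        complete_to S p].
Proof.
move=> miss UV.
suff: forall r, r <= p -> exists S : nat -> {set G},
    [/\ forall j, j < r -> S j \subset U j, forall j, j < r -> #|S j| = h &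
        complete_to S r] by move/(_ p (leqnn p)).
elim=> [_|r IH rp]; first by exists (fun=> set0).
have [S [SU Sh Sc]] := IH (ltnW rp).
pose xs := flatten [seq enum (S j) | j <- iota 0 r].
have mem_xs x : x \in xs -> exists2 j, j < r & x \in S j.
  case/flattenP => s /mapP[j]; rewrite mem_iota add0n /= => jr ->.
  by rewrite mem_enum => xS; exists j.
have sxs : size xs = r * h.
  rewrite size_flatten /shape -map_comp sumnE big_map.
  rewrite (eq_big_seq (fun=> h)) => [|j]; last first.
    by rewrite mem_iota add0n /= => jr; rewrite -cardE Sh.
  by rewrite big_const_seq count_predT size_iota iter_addn_0 mulnC.
have [UVr hU] := UV r rp.
have cc : #|U r| <= #|common xs (U r)| + size xs * e.
  apply: common_card => x /mem_xs[j jr xS].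
  have jp := ltn_trans jr rp; have [UVj _] := UV j jp.
  apply: leq_trans (subset_leq_card (setSD _ UVr)) _; apply: (miss j) => //.
    by rewrite neq_ltn jr.
  exact: (subsetP UVj _ (subsetP (SU j jr) _ xS)).
have [|T Tsub Th] := @exists_subset (common xs (U r)) h.
  rewrite sxs in cc; rewrite -(leq_add2r (r * h * e)); apply: leq_trans cc.
  by apply: leq_trans hU; rewrite leq_add2l !leq_mul // ltnW.
exists (fun j => if j == r then T else S j); split.
- move=> j; rewrite ltnS leq_eqVlt; case: eqP => [-> _|_ /= jr]; last exact: SU.
  by apply: subset_trans Tsub _; apply/subsetP => y; rewrite inE => /andP[].
- by move=> j; rewrite ltnS leq_eqVlt; case: eqP => [//|_ /= jr]; exact: Sh.
have TS j x y : j < r -> x \in S j -> y \in T -> adj x y.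
  move=> jr xS /(subsetP Tsub); rewrite inE => /andP[_ /allP]; apply.
  apply/flattenP; exists (enum (S j)); last by rewrite mem_enum.
  by apply/mapP; exists j; rewrite // mem_iota.
move=> i j; rewrite ltnS (leq_eqVlt i) ltnS (leq_eqVlt j).
case: (i =P r) => [->|_] /=; case: (j =P r) => [->|_] /= ir jr ij x y.
- by rewrite eqxx in ij.
- by move=> xT yS; rewrite adj_sym; apply: TS yS xT.
- by move=> xS yT; apply: TS xS yT.
- exact: Sc.
Qed.

(** The term 2 q is room for discarding from the part [j0] those ends of the matching that lie in
    it. *)
Lemma config_of_matching p q h e (V U : nat -> {set G}) M j0 :
  (forall i j x, i < p -> j < p -> i != j -> x \in V i -> #|V j :\: nbr x| <= e) ->
  size M = q -> matching M -> j0 < p ->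
  (forall j, j < p -> j != j0 -> [/\ U j \subset V j, h + p * h * e <= #|U j| &
     forall x y, x \in ends M -> y \in U j -> adj x y]) ->
  h + p * h * e + 2 * q <= #|V j0| ->
  config p q h.
Proof.
move=> miss sM mM j0p UV hV.
pose U' j := if j == j0 then V j0 :\: [set x in ends M] else U j.
have [j jp|S [SU Sh Sc]] := @greedy_blowup p h e V U' miss.
  rewrite /U'; case: (j =P j0) => [->|/eqP jj]; last by case: (UV j jp jj).
  rewrite subsetDl; split=> //.
  have := cardsID [set x in ends M] (V j0).
  have : #|V j0 :&: [set x in ends M]| <= 2 * q.
    apply: leq_trans (subset_leq_card (subsetIr _ _)) _.
    by rewrite cardsE -sM -size_ends card_size.
  by lia.
exists M, j0, S; split=> // [j jp|]; first by rewrite Sh.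
split=> // [j x y jp jj xM yS|x xM].
  have [_ _] := UV j jp jj; apply => //.
  by have := subsetP (SU j jp) _ yS; rewrite /U' (negPf jj).
by apply/negP => /(subsetP (SU j0 j0p)); rewrite /U' eqxx !inE xM.
Qed.

Lemma pigeonhole (T : finType) (f : G -> {set T}) X (W : {set T}) t :
  (forall v, v \in X -> f v \subset W) -> t * 2 ^ #|W| < #|X| ->
  exists Z, t < #|[set v in X | f v == Z]|.
Proof.
move=> fW; rewrite ltnNge => /negP h; apply/existsP.
rewrite -[X in is_true X]negbK; apply/negP => /existsPn none; apply: h.
rewrite -sum1_card (partition_big f (mem (powerset W))) /=; last first.
  by move=> v /fW; rewrite inE.
rewrite -card_powerset mulnC -sum_nat_const; apply: leq_sum => Z _.
rewrite sum1_card; have := none Z; rewrite -leqNgt; apply: leq_trans.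
by apply: subset_leq_card; apply/subsetP => v; rewrite !inE.
Qed.
End Configurations.

(** * Erdős-Stone argument and near p-partiteness *)

Section Structure.
Implicit Types G : graph.

Definition blowup G r T (K : nat -> {set G}) :=
  (forall i, i < r -> #|K i| = T) /\ complete_to K r.

Definition hits G (K : nat -> {set G}) i (v : G) := #|K i :&: nbr v|.

Lemma hits_le G (K : nat -> {set G}) i v : hits K i v <= #|K i|.
Proof. by apply: subset_leq_card; apply: subsetIl. Qed.

Lemma double_count G (X : {set G}) : \sum_(w in X) degree w = \sum_v #|X :&: nbr v|.
Proof.
under eq_bigr => w _ do rewrite degreeE big_mkcond.
rewrite exchange_big /=; apply: eq_bigr => v _.
rewrite -big_mkcondr /= -sum1_card; apply: eq_bigl => w.
by rewrite !inE adj_sym.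
Qed.

Lemma blowup_count G p D r T (K : nat -> {set G}) : dense p D G -> blowup r T K ->
  r * T * (D * (p - 1) * #|G|) <=
  D * p * (\sum_v \sum_(i < r) hits K i v) + r * T * (p * #|G|).
Proof.
move=> /forallP dG [KT _].
have -> : \sum_v \sum_(i < r) hits K i v = \sum_(i < r) \sum_(w in K i) degree w.
  by rewrite exchange_big; apply: eq_bigr => i _; rewrite double_count.
have h (i : 'I_r) : true -> T * (D * (p - 1) * #|G|) <=
    D * p * (\sum_(w in K i) degree w) + T * (p * #|G|).
  move=> _; rewrite -(KT i) // big_distrr /= -!sum_nat_const -big_split /=.
  exact: leq_sum.
have := leq_sum (index_enum _) h.
rewrite big_split /= -(big_distrr (D * p)) /= !sum_nat_const card_ord -!mulnA.
by rewrite mulnCA.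
Qed.

Lemma complete_disjoint G (K : nat -> {set G}) r i j v : complete_to K r ->
  i < r -> j < r -> i != j -> v \in K i -> v \notin K j.
Proof.
move=> Kc ir jr ij vi; apply/negP => vj.
by have := Kc i j ir jr ij v v vi vj; rewrite adj_irr.
Qed.

Definition parts_union G r (K : nat -> {set G}) : {set G} := \bigcup_(i < r) K i.

Lemma card_parts_union G r T (K : nat -> {set G}) : (forall i, i < r -> #|K i| = T) ->
  #|parts_union r K| <= r * T.
Proof.
move=> KT; rewrite -[r in leqRHS]card_ord -sum_nat_const.
apply: leq_trans (_ : \sum_(i < r) #|K i| <= _); last first.
  by apply: leq_sum => i _; rewrite KT.
rewrite /parts_union; elim/big_rec2: _ => [|i m X _ IH]; first by rewrite cards0.
by apply: leq_trans (leq_card_setU _ _) _; rewrite leq_add2l.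
Qed.

Lemma hits_parts_union G r (K : nat -> {set G}) i v : i < r ->
  hits K i v = #|K i :&: (parts_union r K :&: nbr v)|.
Proof.
move=> ir; rewrite setIA; congr #|pred_of_set (_ :&: _)|.
apply/esym/setIidPl; exact: (bigcup_sup (Ordinal ir)).
Qed.

(** On average a vertex has at least r T' (1 - 1/p - 1/D) hits, and T' = 4 p T, r < p and 2 p^2 <= D
    make this at least (r - 1) T' + 4 T - 2 T. A vertex outside the set of size x has at most (r -
    1) T' + T, so that set is a positive fraction of all vertices. *)
Lemma blowup_numeric p r T D n s x Y (T' := 4 * p * T) :
  1 <= r -> r < p -> 0 < T -> 2 * p ^ 2 <= D ->
  r * T' * (D * (p - 1) * n) <= D * p * s + r * T' * (p * n) ->
  s <= n * ((r - 1) * T' + T) + x * (r * T') -> x <= Y -> n <= 4 * p * r * Y.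
Proof.
rewrite {}/T'; case: p r => [//|p] [//|r] _ rp T0 Dp; rewrite !subn1 /=.
set T' := 4 * p.+1 * T => cnt sx xY.
have e1 : D * p.+1 * s <= D * p.+1 * (n * (r * T' + T) + x * (r.+1 * T')).
  by rewrite leq_mul2l sx orbT.
have e2 : D * p.+1 * r.+1 * T' * x <= D * p.+1 * r.+1 * T' * Y.
  by rewrite leq_mul2l xY orbT.
have A0 : 2 * r.+1 * D + 2 * r.+1 * p.+1 + D <= 2 * D * p.+1 by nia.
have A : n * T' * (2 * r.+1 * D + 2 * r.+1 * p.+1 + D) <= n * T' * (2 * D * p.+1).
  by rewrite leq_mul2l A0 orbT.
have B : D * n * T' <= 2 * (D * p.+1 * n * T) + 2 * (D * p.+1 * r.+1 * T' * Y) by lia.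
have D0 : 0 < 2 * (D * p.+1 * T) by nia.
rewrite -(leq_pmul2l D0); move: B; rewrite /T'; clear.
set a := 4 * p.+1.
have -> : D * n * (a * T) = 4 * (D * p.+1 * n * T) by rewrite /a; ring.
have -> : D * p.+1 * r.+1 * (a * T) * Y = D * p.+1 * T * (a * r.+1 * Y) by ring.
by lia.
Qed.

(** Linearly many vertices have at least T neighbours in every part, and there are boundedly many
    traces on the blow-up. So T of them share a trace; they form the new part, and the old parts
    shrink to subsets of that trace. *)
Lemma blowup_step p r T D : 1 <= r -> r < p -> 0 < T -> 2 * p ^ 2 <= D ->
  exists N, forall G (K : nat -> {set G}), N <= #|G| -> dense p D G ->
    blowup r (4 * p * T) K -> exists K', @blowup G r.+1 T K'.
Proof.
move=> r1 rp T0 Dp; set T' := 4 * p * T.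
exists (4 * p * r * (T * 2 ^ (r * T')).+1).+1 => G K NG dG bK.
have [KT Kc] := bK; have cnt := blowup_count dG bK.
pose X : {set G} := [set v | [forall i : 'I_r, T <= hits K i v]].
have hX v : \sum_(i < r) hits K i v <= (r - 1) * T' + T + (v \in X) * (r * T').
  have hT (i : 'I_r) : hits K i v <= T' by rewrite -(KT i) // hits_le.
  case: (boolP (v \in X)) => [_|].
    rewrite mul1n; apply: (@leq_trans (r * T')); last by rewrite leq_addl.
    have -> : r * T' = \sum_(j < r) T' by rewrite sum_nat_const card_ord.
    by apply: leq_sum => j _; apply: hT.
  rewrite inE => /forallPn[i]; rewrite -ltnNge => hi; rewrite mul0n addn0.
  rewrite (bigD1 i) //= addnC leq_add //; last exact: ltnW.
  apply: (@leq_trans (\sum_(j < r | j != i) T')); first by apply: leq_sum => j _; apply: hT.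
  by rewrite sum_nat_const cardC1 card_ord subn1.
have sX : \sum_v \sum_(i < r) hits K i v <=
    #|G| * ((r - 1) * T' + T) + #|X| * (r * T').
  apply: leq_trans (leq_sum _ (fun v _ => hX v)) _.
  rewrite big_split /= sum_nat_const -big_distrl /= leq_add2l leq_mul2r.
  apply/orP; right; rewrite -sum1_card [X in _ <= X]big_mkcond.
  by apply: leq_sum => v _; case: (v \in X).
have Xbig : T * 2 ^ (r * T') < #|X|.
  rewrite ltnNge; apply/negP => Xle.
  have := blowup_numeric r1 rp T0 Dp cnt sX Xle.
  by rewrite leqNgt (leq_ltn_trans _ NG) // leq_mul2l leqnSn orbT.
have [v _||Z hZ] := @pigeonhole G _ (fun v => parts_union r K :&: nbr v) X (parts_union r K) T.
- exact: subsetIl.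
- apply: leq_ltn_trans Xbig; rewrite leq_mul2l leq_exp2l //.
  by rewrite card_parts_union ?orbT.
have [Y Ysub YT] := exists_subset (ltnW hZ).
have YX v : v \in Y -> v \in X /\ parts_union r K :&: nbr v = Z.
  by move/(subsetP Ysub); rewrite inE => /andP[-> /eqP].
have KZ i : i < r -> T <= #|K i :&: Z|.
  move=> ir; have [v vY] : exists v, v \in Y by apply/set0Pn; rewrite -card_gt0 YT.
  have [vX <-] := YX v vY; rewrite -hits_parts_union //.
  by move: vX; rewrite inE => /forallP/(_ (Ordinal ir)).
have /fin_all_exists2 [K' K'sub K'T] : forall i : 'I_r,
    exists2 A : {set G}, A \subset K i :&: Z & #|A| = T.
  by move=> i; apply: exists_subset; apply: KZ.
pose K2 i := if insub i is Some j then K' j else Y.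
have K2l i (ir : i < r) : K2 i = K' (Ordinal ir) by rewrite /K2 insubT.
have K2r : K2 r = Y by rewrite /K2 insubF ?ltnn.
have K2Z i x : i < r -> x \in K2 i -> x \in K i /\ x \in Z.
  by move=> ir; rewrite K2l => /(subsetP (K'sub _)); rewrite inE => /andP[].
have ZY x y : x \in Z -> y \in Y -> adj y x.
  by move=> xZ /YX[_ eZ]; move: xZ; rewrite -eZ !inE => /andP[].
exists K2; split=> [i|i j].
  by rewrite ltnS leq_eqVlt => /predU1P[->|ir]; rewrite ?K2r // K2l.
rewrite ltnS (leq_eqVlt i) ltnS (leq_eqVlt j).
move=> /predU1P[->|ir] /predU1P[->|jr] ij x y.
- by rewrite eqxx in ij.
- by rewrite K2r => xY /(K2Z _ _ jr)[_ yZ]; apply: ZY.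
- by rewrite K2r adj_sym => /(K2Z _ _ ir)[_ xZ] yY; apply: ZY.
- by move=> /(K2Z _ _ ir)[xK _] /(K2Z _ _ jr)[yK _]; apply: (Kc i j).
Qed.

Lemma erdos_stone p D : 2 * p ^ 2 <= D -> forall r T, 1 <= r -> r <= p -> 0 < T ->
  exists N, forall G, N <= #|G| -> dense p D G ->
    exists K : nat -> {set G}, blowup r T K.
Proof.
move=> Dp; elim=> [//|[|r] IH] T _ rp T0.
  exists T => G TG _; have [|Y _ YT] := @exists_subset G setT T.
    by rewrite cardsT.
  by exists (fun=> Y); split=> // i j; rewrite !ltnS !leqn0 => /eqP-> /eqP->.
have [||N1 N1E] := IH (4 * p * T) _ (ltnW rp); rewrite ?muln_gt0 //; first by lia.
have [//|N2 N2E] := @blowup_step p r.+1 T D _ rp T0 Dp.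
exists (maxn N1 N2) => G; rewrite geq_max => /andP[NG1 NG2] dG.
have [K bK] := N1E G NG1 dG.
exact: N2E NG2 dG bK.
Qed.
End Structure.

Section StructureTheorem.
Implicit Types G : graph.

Lemma matching_zip G (xs ys : seq G) :
  size xs = size ys -> uniq xs -> uniq ys ->
  (forall x y, x \in xs -> y \in ys -> adj x y) ->
  ends (zip xs ys) = xs ++ ys /\ matching (zip xs ys).
Proof.
move=> sxy ux uy xy.
have e : ends (zip xs ys) = xs ++ ys.
  by rewrite /ends unzip1_zip ?unzip2_zip ?sxy.
split=> //; rewrite /matching e cat_uniq ux uy andbT /=; apply/andP; split.
  by apply/hasPn => y yY; apply/negP => /xy/(_ yY); rewrite adj_irr.
apply/allP => -[x y] /= xyz; apply: xy.
  by have := map_f fst xyz; rewrite -/unzip1 unzip1_zip ?sxy.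
by have := map_f snd xyz; rewrite -/unzip2 unzip2_zip ?sxy.
Qed.

Lemma blowup_miss G p T (K : nat -> {set G}) i j x : blowup p T K ->
  i < p -> j < p -> i != j -> x \in K i -> #|K j :\: nbr x| <= 0.
Proof.
move=> [_ Kc] ip jp ij xK; rewrite leqn0 cards_eq0; apply/eqP/setP => y.
rewrite !inE; case: (boolP (y \in K j)) => [yK|]; last by rewrite andbF.
by rewrite (Kc i j).
Qed.

Definition rich G p t (K : nat -> {set G}) : {set G} :=
  [set v | [forall i : 'I_p, t <= hits K i v]].

(** Among more rich vertices, q would share a trace on the blow-up. Matching them with q vertices of
    that trace in the first part gives the edges of a configuration. *)
Lemma rich_few G p q h T (K : nat -> {set G}) : 0 < p -> 0 < q -> blowup p T K ->
  ~ config G p q h -> #|rich p (h + 2 * q) K| <= q * 2 ^ (p * T).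
Proof.
move=> p0 q0 bK nconf; rewrite leqNgt; apply/negP => big; apply: nconf.
have [KT Kc] := bK.
have [v _||Z hZ] := @pigeonhole G _ (fun v => parts_union p K :&: nbr v)
    (rich p (h + 2 * q) K) (parts_union p K) q.
- exact: subsetIl.
- apply: leq_ltn_trans big; rewrite leq_mul2l leq_exp2l //.
  by rewrite card_parts_union ?orbT.
have [Y Ysub Yq] := exists_subset (ltnW hZ).
have YX v : v \in Y -> v \in rich p (h + 2 * q) K /\ parts_union p K :&: nbr v = Z.
  by move/(subsetP Ysub); rewrite inE => /andP[-> /eqP].
have ZY x y : x \in Z -> y \in Y -> adj y x.
  by move=> xZ /YX[_ eZ]; move: xZ; rewrite -eZ !inE => /andP[].
have /set0Pn[v0 v0Y] : Y != set0 by rewrite -card_gt0 Yq.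
have KZ i : i < p -> h + 2 * q <= #|K i :&: Z|.
  move=> ip; have [vX <-] := YX v0 v0Y; rewrite -hits_parts_union //.
  by move: vX; rewrite inE => /forallP/(_ (Ordinal ip)).
have [|W Wsub Wq] := @exists_subset G (K 0 :&: Z) q.
  by apply: leq_trans (KZ 0 p0); lia.
have W0 y : y \in W -> y \in K 0 /\ y \in Z.
  by move/(subsetP Wsub); rewrite inE => /andP[].
have [||||eM mM] := @matching_zip G (enum Y) (enum W).
- by rewrite -!cardE Yq Wq.
- exact: enum_uniq.
- exact: enum_uniq.
- by move=> x y; rewrite !mem_enum => xY /W0[_ yZ]; apply: ZY.
apply: (@config_of_matching G p q h 0 K (fun j => K j :&: Z) _ 0 _ _ mM p0).
- by move=> i j x ip jp ij; apply: (blowup_miss bK).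
- by rewrite size_zip -!cardE Yq Wq minnn.
- move=> j jp j0; split; first exact: subsetIl.
    by rewrite muln0 addn0; apply: leq_trans (KZ j jp); rewrite leq_addr.
  move=> x y; rewrite eM mem_cat !mem_enum inE => /orP[xY|/W0[xK _]] /andP[yK yZ].
    exact: ZY.
  by apply: (Kc 0 j) => //; rewrite eq_sym.
rewrite muln0 addn0; apply: leq_trans (KZ 0 p0) _.
exact: subset_leq_card (subsetIl _ _).
Qed.

Lemma typed_matching G p q h T eta (K : nat -> {set G}) M i : blowup p T K ->
  size M = q -> matching M -> i < p -> h + 2 * q * eta <= T -> h + 2 * q <= T ->
  (forall x j, x \in ends M -> j < p -> j != i -> #|K j :\: nbr x| <= eta) ->
  config G p q h.
Proof.
move=> bK sM mM ip hT1 hT2 miss; have [KT Kc] := bK.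
apply: (@config_of_matching G p q h 0 K (fun j => common (ends M) (K j)) M i) => //.
- by move=> j k x jp kp jk; apply: (blowup_miss bK).
- move=> j jp ji; split.
  + by apply/subsetP => y; rewrite inE => /andP[].
  + rewrite muln0 addn0 -(leq_add2r (2 * q * eta)); apply: leq_trans hT1 _.
    rewrite -(KT j jp) -sM -size_ends; apply: common_card => x xM.
    exact: miss.
  + by move=> x y xM; rewrite inE => /andP[_ /allP/(_ x xM)].
by rewrite muln0 addn0 KT.
Qed.

(** An atypical vertex falls short by T1 = 4 k h0 hits. The slack h0 per vertex allows n / (4 k)
    such vertices and the degree error 1/D another n / (4 k); the last term comes from the boundedly
    many rich vertices. *)
Lemma structure_numeric p k M4 h0 D n s R Nn (T1 := 4 * k * h0) (T := M4 * T1) :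
  0 < p -> 0 < h0 -> 4 * k * p * M4 <= D -> 0 < D ->
  p * T * (D * (p - 1) * n) <= D * p * s + p * T * (p * n) ->
  s + Nn * T1 <= n * ((p - 1) * T + h0) + R * (p * T) ->
  4 * k * Nn <= 2 * n + 4 * k * (R * p * M4).
Proof.
move=> p0 h00 hD D0 cnt sN.
have Dp0 : 0 < D * p by rewrite muln_gt0 D0.
have e1 : D * p * (s + Nn * T1) <= D * p * (n * ((p - 1) * T + h0) + R * (p * T)).
  by rewrite leq_mul2l sN orbT.
have e2 : D * p * (Nn * T1) <= D * p * (n * h0) + D * p * (R * (p * T)) + p * T * (p * n).
  have e3 : D * p * (n * ((p - 1) * T + h0) + R * (p * T)) =
    p * T * (D * (p - 1) * n) + D * p * (n * h0) + D * p * (R * (p * T)) by ring.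
  by move: e1 cnt; rewrite e3 mulnDr; move: (D * p * s); lia.
have e4 : (D * p * h0) * (4 * k * Nn) <= (D * p * h0) * (n + 4 * k * (R * p * M4)) +
    (p * h0 * n) * (4 * k * p * M4).
  by move: e2; rewrite /T /T1; lia.
have e5 : (p * h0 * n) * (4 * k * p * M4) <= (p * h0 * n) * D.
  by rewrite leq_mul2l hD orbT.
have X0 : 0 < D * p * h0 by rewrite muln_gt0 Dp0.
by rewrite -(leq_pmul2l X0); lia.
Qed.

Theorem structure p q h k : 2 <= p -> 0 < q -> 0 < k -> exists D N, 2 <= D /\
  forall G, N <= #|G| -> dense p D G -> ~ config G p q h ->
  exists (c : G -> 'I_p) (B : {set G}), k * #|B| <= #|G| /\
    forall u v, u \notin B -> v \notin B -> c u = c v -> ~~ adj u v.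
Proof.
move=> p2 q0 k0; have p0 : 0 < p by lia.
(* [T1] is the deficit of hits that makes a vertex atypical. [M4] leaves room in a part for the 2 q
   ends of a matching to miss T1 + h0 vertices each. In [D] the first summand is for
   [structure_numeric], the second for [erdos_stone]. *)
pose h0 := h + 2 * q; pose M4 := 4 * q + 2; pose T1 := 4 * k * h0.
pose T := M4 * T1; pose D := 4 * k * p * M4 + 2 * p ^ 2.
have T10 : h0 <= T1 by rewrite /T1; nia.
have h00 : 0 < h0 by rewrite /h0; lia.
have T0 : 0 < T by rewrite /T muln_gt0 /M4 (leq_trans h00 T10) addn2.
have Dp : 2 * p ^ 2 <= D by rewrite /D leq_addl.
have D2 : 2 <= D by apply: leq_trans Dp; rewrite expnS expn1; nia.
have [N1 N1E] := erdos_stone Dp p0 (leqnn p) T0.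
pose Rm := q * 2 ^ (p * T).
exists D, (N1 + 2 * k * (Rm * (p * M4 + 1) + p * (2 * q))); split=> // G NG dG nconf.
have [|K bK] := N1E G _ dG; first by apply: leq_trans NG; apply: leq_addr.
have [KT Kc] := bK.
have hT (i : 'I_p) v : hits K i v <= T by rewrite -(KT i) // hits_le.
have i0 : 'I_p := Ordinal p0.
pose R := rich p h0 K.
have Rle : #|R| <= Rm by apply: rich_few.
(* The default colour is reached by rich vertices only, and these go into [B]. *)
pose c v := odflt i0 [pick i : 'I_p | hits K i v < h0].
have cP v : v \notin R -> hits K (c v) v < h0.
  rewrite /c; case: pickP => [i //|none].
  rewrite inE => /forallPn[i]; rewrite -ltnNge; have := none i; by move=> /= ->.
(* The atypical vertices: not rich, yet far from complete to the p - 1 other parts. *)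
pose Nn := [set v | (v \notin R) && (\sum_(i < p) hits K i v + T1 < (p - 1) * T)].
have pT : (p - 1) * T + T = p * T by rewrite -mulSnr subn1 prednK.
have pw v : \sum_(i < p) hits K i v + (v \in Nn) * T1 <=
    ((p - 1) * T + h0) + (v \in R) * (p * T).
  rewrite inE; case: (boolP (v \in R)) => [_|vR] /=.
    rewrite mul0n addn0 mul1n; apply: leq_trans (leq_addl _ _).
    have -> : p * T = \sum_(i < p) T by rewrite sum_nat_const card_ord.
    by apply: leq_sum => i _; apply: hT.
  rewrite mul0n addn0; case: ltnP => [lt|_]; first by rewrite mul1n; lia.
  rewrite mul0n addn0 (bigD1 (c v)) //= addnC; apply: leq_add; last exact/ltnW/cP.
  apply: (@leq_trans (\sum_(i < p | i != c v) T)).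
    by apply: leq_sum => i _; apply: hT.
  by rewrite sum_nat_const cardC1 card_ord subn1.
have sumpw : \sum_v \sum_(i < p) hits K i v + #|Nn| * T1 <=
    #|G| * ((p - 1) * T + h0) + #|R| * (p * T).
  have mem_sum (A : {set G}) t : \sum_v (v \in A) * t = #|A| * t.
    rewrite -big_distrl /= -sum1_card [in RHS]big_mkcond.
    by congr (_ * _); apply: eq_bigr => v _; case: (v \in A).
  have := leq_sum (index_enum G) (fun v (_ : true) => pw v).
  by rewrite big_split [X in _ <= X -> _]big_split /= !mem_sum sum_nat_const.
have NnE := structure_numeric p0 h00 (leq_addr _ _) (ltnW D2)
   (blowup_count dG bK) sumpw.
(* With fewer than h0 hits in its own part and at most T in each of the p - 2 remaining ones, a
   total of at least (p - 1) T - T1 leaves T - T1 - h0 for part j. *)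
have typed v j : v \notin R -> v \notin Nn -> j < p -> j != c v ->
    #|K j :\: nbr v| <= T1 + h0.
  move=> vR vN jp jc; pose j' : 'I_p := Ordinal jp.
  have jc' : j' != c v by [].
  move: vN; rewrite inE vR /= -leqNgt (bigD1 (c v)) //= (bigD1 j') //=.
  have rest : \sum_(i < p | (i != c v) && (i != j')) hits K i v <= (p - 2) * T.
    apply: (@leq_trans (\sum_(i < p | (i != c v) && (i != j')) T)).
      by apply: leq_sum => i _; apply: hT.
    rewrite sum_nat_const leq_mul2r; apply/orP; right.
    have := cardsC [set c v; j']; rewrite cards2 eq_sym jc' card_ord.
    set X := #|~: _|; set Y := #|_|; have -> : Y = X.
      by apply: eq_card => i; rewrite !inE negb_or.
    by move=> /= e; clear -e; lia.
  have hj : hits K j v + #|K j :\: nbr v| = T by rewrite -(KT j jp) -[RHS](cardsID (nbr v)).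
  have := cP v vR; have pT2 : (p - 2) * T + T = (p - 1) * T.
    by rewrite -mulSnr; congr (_ * _); clear -p2; lia.
  move: rest hj pT2; move: (\sum_(i < p | _) _) (hits _ _ _) (hits _ _ _) #|_|.
  by clear; lia.
have hTT : h + 2 * q * (T1 + h0) <= T.
  have : 2 * q * h0 <= 2 * q * T1 by rewrite leq_mul2l T10 orbT.
  by rewrite /T /M4; lia.
have hT2 : h + 2 * q <= T by apply: leq_trans T10 _; rewrite leq_pmull // /M4 addn2.
(* A matching of q typical vertex pairs of one colour would extend to a configuration, so 2 q
   vertices cover the edges inside the class. *)
have cover (i : 'I_p) : exists C : {set G}, #|C| <= 2 * q /\
   {in [set v | [&& v \notin R, v \notin Nn & c v == i]] :\: C &,
     forall u v, ~~ adj u v}.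
  have [[M [sM mM Msub]]|[C [cC iC]]] := @matching_or_cover G q
    [set v | [&& v \notin R, v \notin Nn & c v == i]]; last by exists C.
  case: nconf; apply: (typed_matching bK sM mM (ltn_ord i) hTT hT2).
  move=> x j /Msub; rewrite inE => /and3P[xR xN /eqP xi] jp ji.
  by apply: typed => //; rewrite xi.
have [C CE] := fin_all_exists cover.
exists c, (R :|: Nn :|: \bigcup_i C i); split.
  have CC : #|\bigcup_i C i| <= p * (2 * q).
    have -> : p * (2 * q) = \sum_(i < p) 2 * q by rewrite sum_nat_const card_ord.
    apply: (@leq_trans (\sum_i #|C i|)); last by apply: leq_sum => i _; case: (CE i).
    elim/big_rec2: _ => [|i m X _ IH]; first by rewrite cards0.
    by apply: leq_trans (leq_card_setU _ _) _; rewrite leq_add2l.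
  have : #|R :|: Nn :|: \bigcup_i C i| <= #|R| + #|Nn| + p * (2 * q).
    apply: leq_trans (leq_card_setU _ _) _; apply: leq_add => //.
    exact: leq_card_setU.
  have r1 : k * (#|R| * p * M4) <= k * (Rm * p * M4).
    by rewrite leq_mul2l !leq_mul2r Rle !orbT.
  have r2 : k * #|R| <= k * Rm by rewrite leq_mul2l Rle orbT.
  move: NnE NG r1 r2; move: #|_ :|: _| #|R| #|Nn| #|G| => b r nn n NnE NG r1 r2 bb.
  have : k * b <= k * (r + nn + p * (2 * q)) by rewrite leq_mul2l bb orbT.
  by clear - NnE NG r1 r2; lia.
move=> u v; rewrite !in_setU !negb_or => /andP[/andP[uR uN] uC] /andP[/andP[vR vN] vC] cuv.
have notC i w : w \notin \bigcup_i C i -> w \notin C i.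
  by apply: contra; apply: (subsetP (bigcup_sup i _)).
have [_ ind] := CE (c u).
by apply: ind; rewrite in_setD notC //= in_set ?uR ?vR ?uN ?vN ?cuv eqxx.
Qed.
End StructureTheorem.

(** * The core of a nearly p-partite graph *)

Section Core.
Variables (G : graph) (p q h e t : nat) (c : G -> 'I_p) (B : {set G}).

Definition core (j : nat) : {set G} := [set v | (v \notin B) && (c v == j :> nat)].

(** This many common neighbours suffice to build a configuration: h + p h e for [greedy_blowup], and
    q e for the non-neighbours of up to q core vertices used as ends of edges. *)
Definition popular_size := h + p * h * e + q * e.

(** The scale [e] bounds the exceptional set, the missing edges and the imbalance of the parts; [t]
    is the threshold for heavy vertices. They are separated as e << t << n, and
    [core_structure_exists] takes both as fixed small fractions of n. *)
Record core_structure : Prop := CoreStructure {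
  cs_p : 2 <= p;
  cs_q : 0 < q;
  cs_B : #|B| <= e;
  cs_ind : forall u v, u \notin B -> v \notin B -> c u = c v -> ~~ adj u v;
  cs_miss : forall i j x, i < p -> j < p -> i != j -> x \in core i ->
    #|core j :\: nbr x| <= e;
  cs_big : forall i, i < p -> #|G| <= p * #|core i| + p * e;
  cs_small : forall i, i < p -> p * #|core i| <= #|G| + p * e;
  cs_deg : forall v : G, p * #|G| <= p * degree v + #|G| + p * e;
  cs_config : ~ config G p q h;
  cs_e : h + 2 * q + 1 <= e;
  cs_et : 2 ^ (p * q) * popular_size + 10 * p * q * e <= t;
  cs_t : 1000 * p ^ 3 * q * t <= #|G| }.

Hypothesis CS : core_structure.
Let p2 := cs_p CS.
Let q0 := cs_q CS.

Let et : 10 * p * q * e <= t.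
Proof. by apply: leq_trans (cs_et CS); apply: leq_addl. Qed.

Let e0 : 0 < e.
Proof. by have := cs_e CS; lia. Qed.

Lemma popular_size_le : popular_size <= t.
Proof.
have := cs_et CS; have : popular_size <= 2 ^ (p * q) * popular_size.
  by rewrite leq_pmull // expn_gt0.
by lia.
Qed.

Let pet : p * e <= t.
Proof.
apply: leq_trans et; rewrite -{1}[p * e]mul1n.
have : 1 * (p * e) <= (10 * q) * (p * e) by rewrite leq_mul2r; lia.
by lia.
Qed.

Let qt : 20 * q <= t.
Proof. by apply: leq_trans et; have := e0; nia. Qed.

Let tn : 1000 * (p * q * t) <= #|G|.
Proof.
apply: leq_trans (cs_t CS).
have : p * (q * t) <= p ^ 3 * (q * t).
  by rewrite leq_mul2r -{1}[p]expn1 leq_pexp2l ?orbT //; lia.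
have -> : 1000 * p ^ 3 * q * t = 1000 * (p ^ 3 * (q * t)) by ring.
by rewrite leq_mul2l /= -mulnA.
Qed.

Lemma core_ge i : i < p -> 999 * (q * t) <= #|core i|.
Proof.
move=> ip; have p0 : 0 < p by lia.
rewrite -(leq_pmul2l p0); have := cs_big CS ip; have := tn; have := pet.
have : t <= p * (q * t) by rewrite mulnA leq_pmull // muln_gt0 p0.
by lia.
Qed.

Definition heavy : {set G} := [set v | [forall i : 'I_p, t <= #|core i :&: nbr v|]].

Lemma heavy_in v (i : nat) : v \in heavy -> i < p -> t <= #|core i :&: nbr v|.
Proof. by rewrite inE => /forallP + ip => /(_ (Ordinal ip)). Qed.

Lemma core_nbr0 v : v \notin B -> #|core (c v) :&: nbr v| = 0.
Proof.
move=> vB; apply/eqP; rewrite cards_eq0; apply/eqP/setP => w; rewrite !inE.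
apply/negP => /andP[/andP[wB /eqP wv] vw].
by have := cs_ind CS vB wB; rewrite vw => /(_ (esym (val_inj wv))).
Qed.

Lemma heavy_sub : heavy \subset B.
Proof.
apply/subsetP => v vL; apply: contraT => vB.
have := heavy_in vL (ltn_ord (c v)); rewrite core_nbr0 // leqn0 => /eqP t0.
by have := qt; lia.
Qed.

(** For a heavy vertex of [B] no part qualifies and the value is a mere default; [star_color]
    overrides it. *)
Definition recolor (v : G) : 'I_p :=
  if v \notin B then c v else odflt (c v) [pick i : 'I_p | #|core i :&: nbr v| < t].

Lemma recolor_core v : v \notin B -> recolor v = c v.
Proof. by rewrite /recolor => ->. Qed.

Lemma recolor_lt v : v \notin heavy -> #|core (recolor v) :&: nbr v| < t.
Proof.
rewrite /recolor; have [vB|vB] := boolP (v \in B); last first.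
  by move=> _; rewrite core_nbr0 //; have := qt; lia.
move=> /=; case: pickP => [i //|none]; rewrite inE => /forallPn[i].
by rewrite -ltnNge; have /= -> := none i.
Qed.

Lemma sum_core_card (f : G -> bool) :
  \sum_(i < p) #|[set v in core i | f v]| = #|[set v in ~: B | f v]|.
Proof.
rewrite -[RHS]sum1_card (partition_big c predT) //=; apply: eq_bigr => i _.
rewrite -sum1_card; apply: eq_bigl => v; rewrite !inE.
by rewrite val_eqE -!andbA [f v && _]andbC.
Qed.

Lemma sum_core_nbr v : degree v <= e + \sum_(i < p) #|core i :&: nbr v|.
Proof.
have -> : \sum_(i < p) #|core i :&: nbr v| = #|[set w in ~: B | adj v w]|.
  rewrite -sum_core_card; apply: eq_bigr => i _; apply: eq_card => w.
  by rewrite !inE.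
apply: leq_trans (leq_add (cs_B CS) (leqnn _)).
apply: leq_trans (leq_card_setU B _); apply: subset_leq_card.
by apply/subsetP => w; rewrite !inE; case: (w \in B).
Qed.

Lemma sum_core : \sum_(i < p) #|core i| <= #|G|.
Proof.
have -> : \sum_(i < p) #|core i| = #|[set w in ~: B | predT w]|.
  rewrite -sum_core_card; apply: eq_bigr => i _; apply: eq_card => w.
  by rewrite !inE andbT.
exact: max_card.
Qed.

Lemma miss_total v : p * \sum_(i < p) #|core i :\: nbr v| <= #|G| + 2 * p * e.
Proof.
have s : \sum_(i < p) #|core i :\: nbr v| + \sum_(i < p) #|core i :&: nbr v| <= #|G|.
  apply: leq_trans sum_core; rewrite -big_split /=; apply: leq_sum => i _.
  by rewrite addnC cardsID.
have := sum_core_nbr v; have := cs_deg CS v.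
move: s; set a := \sum_(i < p) _; set b := \sum_(i < p) _ => s1 s2 s3.
have : p * (a + b) <= p * #|G| by rewrite leq_mul2l s1 orbT.
have : p * degree v <= p * (e + b) by rewrite leq_mul2l s3 orbT.
by lia.
Qed.

(** By minimum degree, v misses about n/p core vertices at most, and almost all of them are used up
    in its own part, where it has fewer than t neighbours. *)
Lemma recolor_miss v j : v \notin heavy -> j < p -> j != recolor v :> nat ->
  #|core j :\: nbr v| <= 2 * t.
Proof.
move=> vL jp jv; have lt := recolor_lt vL; set i := recolor v in jv lt.
have p0 : 0 < p by lia.
have := miss_total v; rewrite (bigD1 i) //= (bigD1 (Ordinal jp)) //=.
set a := #|core i :\: nbr v|; set b := #|core j :\: nbr v|.
set r := \sum_(k < p | _) _ => h1.
have h2 : #|core i :&: nbr v| + a = #|core i| by rewrite cardsID.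
have h3 := cs_big CS (ltn_ord i).
rewrite -(leq_pmul2l p0); have := pet => h4.
have h5 : p * (#|core i :&: nbr v| + a) = p * #|core i| by rewrite h2.
have h6 : p * #|core i :&: nbr v| <= p * t by rewrite leq_mul2l ltnW ?orbT.
have h7 : p * e <= p * t by rewrite leq_mul2l; apply/orP; right; have := et; nia.
have h8 : p * (3 * e) <= p * t.
  by rewrite leq_mul2l; apply/orP; right; have := et; nia.
move: h1 h3 h5 h6 h7 h8; rewrite /i; move: #|G| #|core _| #|_ :&: _| => n ci ni.
by clear; lia.
Qed.

Lemma inner_degree v : v \notin heavy ->
  #|[set w | [&& w \notin heavy, recolor w == recolor v & adj v w]]| <= 2 * t.
Proof.
move=> vL; have lt := recolor_lt vL.
apply: (@leq_trans (#|B :|: (core (recolor v) :&: nbr v)|)).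
  apply: subset_leq_card; apply/subsetP => w; rewrite !inE.
  move=> /and3P[_ wv ->]; have [//|wB] := boolP (w \in B).
  by rewrite -(recolor_core wB) (eqP wv) eqxx.
apply: leq_trans (leq_card_setU _ _) _; have := cs_B CS; have := et; nia.
Qed.

(** A greedy choice suffices: each set is larger than all earlier choices and forbidden elements
    together. *)
Lemma distinct_representatives (xs : seq G) (W : G -> {set G}) (Fb : {set G}) :
  (forall x, x \in xs -> size xs + #|Fb| <= #|W x|) ->
  exists ys : seq G, [/\ size ys = size xs, uniq ys,
    forall y, y \in ys -> y \notin Fb &
    all (fun z => z.2 \in W z.1) (zip xs ys)].
Proof.
elim: xs => [|x xs IH] hW; first by exists [::].
have [y yxs|ys [sy uy yF yW]] := IH.
  by apply: leq_trans (hW y _); rewrite /= ?inE ?yxs ?orbT // leq_add2r.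
have /subsetPn[y yWx yn] : ~~ (W x \subset Fb :|: [set z in ys]).
  apply/negP => /subset_leq_card; rewrite leqNgt => /negP; apply.
  apply: leq_trans (hW x (mem_head _ _)); rewrite /= addSn ltnS addnC.
  apply: leq_trans (leq_card_setU _ _) _; rewrite leq_add2l -sy.
  by rewrite cardsE card_size.
move: yn; rewrite !inE negb_or => /andP[yFb yys].
exists (y :: ys); split=> /=; rewrite ?sy ?yys ?uy ?yWx //.
by move=> z; rewrite inE => /predU1P[->//|/yF].
Qed.

(** Giving each heavy vertex of [X] a private neighbour in the part j0 completes [M0] to a matching
    of q edges, so without a configuration some other part has too few common neighbours of [X]. It
    is used with a full matching and no heavy vertex, with one edge and q - 1 heavy vertices, and
    with q heavy vertices alone. *)
Lemma extend_config M0 (X : {set G}) j0 : j0 < p -> matching M0 ->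
  (forall u, u \in ends M0 -> u \notin heavy /\ recolor u = j0 :> nat) ->
  X \subset heavy -> #|X| + size M0 = q ->
  exists j, [/\ j < p, j != j0 &
    #|common (enum X) (core j)| < popular_size + size M0 * (4 * t)].
Proof.
move=> j0p mM0 M0V XL Xq.
have [/existsP[j /andP[jj lt]]|none] := boolP [exists j : 'I_p,
   (j != j0 :> nat) && (#|common (enum X) (core j)| < popular_size + size M0 * (4 * t))].
  by exists j.
case: (cs_config CS).
pose Fb := [set x in ends M0].
have [x|ys [sy uy yF yW]] := @distinct_representatives (enum X)
    (fun x => core j0 :&: nbr x) Fb.
  rewrite mem_enum => xX.
  apply: leq_trans (heavy_in (subsetP XL _ xX) j0p).
  have : #|Fb| <= 2 * size M0 by rewrite -size_ends cardsE card_size.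
  by rewrite -cardE; have := qt; lia.
have yP y : y \in ys -> exists2 x, x \in X & (y \in core j0) /\ adj x y.
  move=> yys; pose i := index y ys; pose x := nth y (enum X) i.
  have iy : i < size ys by rewrite index_mem.
  have xX : x \in X by rewrite -mem_enum mem_nth // -sy.
  have := allP yW (x, y); rewrite -[y in (x, y)](nth_index y yys) -/i -nth_zip ?sy //.
  rewrite mem_nth ?size_zip ?sy ?minnn -?sy // nth_zip ?sy //= nth_index //.
  by move=> /(_ isT); rewrite !inE -/x => /andP[-> ?]; exists x.
pose M := M0 ++ zip (enum X) ys.
have eM : perm_eq (ends M) (ends M0 ++ (enum X ++ ys)).
  rewrite /ends /M /unzip1 /unzip2 !map_cat -/unzip1 -/unzip2.
  rewrite -/(unzip1 (zip _ _)) -/(unzip2 (zip _ _)) unzip1_zip ?unzip2_zip ?sy //.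
  rewrite -!catA perm_cat2l.
  by rewrite perm_catCA.
have yB y : y \in ys -> y \notin B by case/yP => x _ [+ _]; rewrite inE => /andP[].
have mM : matching M.
  have /andP[uM0 aM0] := mM0.
  rewrite /matching (perm_uniq eM) all_cat aM0 (cat_uniq (ends M0)) uM0.
  rewrite (cat_uniq (enum X)) enum_uniq uy !andbT /=.
  apply/andP; split; last first.
    by apply/allP => z /(allP yW); rewrite !inE => /andP[].
  apply/andP; split; apply/hasPn => z.
    rewrite mem_cat mem_enum => /orP[zX|/yF]; last by rewrite inE.
    by apply/negP => /M0V[]; rewrite (subsetP XL).
  by move=> /yB zB; rewrite /= mem_enum; apply: contra zB => /(subsetP XL)/(subsetP heavy_sub).
have sY : size ys <= q by rewrite sy -cardE -Xq leq_addr.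
apply: (@config_of_matching G p q h e core
  (fun j => common (ends M0) (common ys (common (enum X) (core j)))) M j0) => //.
- exact: cs_miss.
- by rewrite /M size_cat size_zip sy minnn -cardE addnC.
- move=> j jp jj; split.
  + by apply/subsetP => y; rewrite !inE => /andP[/andP[/andP[]]].
  + have big : popular_size + size M0 * (4 * t) <= #|common (enum X) (core j)|.
      move: none; rewrite negb_exists => /forallP/(_ (Ordinal jp)) /=.
      by rewrite jj /= -leqNgt.
    have sub (xs : seq G) (Y : {set G}) (y : G) : #|common xs Y :\: nbr y| <= #|Y :\: nbr y|.
      apply: subset_leq_card; apply: setSD.
      by apply/subsetP => z; rewrite inE => /andP[].
    have c1 := @common_card _ ys (common (enum X) (core j)) e.
    have c2 := @common_card _ (ends M0) (common ys (common (enum X) (core j))) (2 * t).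
    have l1 : #|common (enum X) (core j)| <= #|common ys (common (enum X) (core j))| + size ys * e.
      apply: c1 => y /yP[x _ [yc _]]; apply: leq_trans (sub _ _ _) _.
      by apply: (cs_miss CS j0p jp _ yc); rewrite eq_sym.
    have l2 : #|common ys (common (enum X) (core j))| <=
      #|common (ends M0) (common ys (common (enum X) (core j)))| + size (ends M0) * (2 * t).
      apply: c2 => u /M0V[uL uc]; apply: leq_trans (sub _ _ _) _.
      by apply: leq_trans (sub _ _ _) _; apply: recolor_miss; rewrite // uc.
    rewrite size_ends in l2.
    have l3 : size ys * e <= q * e by rewrite leq_mul2r sY orbT.
    by move: big l1 l2 l3; rewrite /popular_size; clear; lia.
  + move=> x y; rewrite (perm_mem eM) mem_cat => xM.
    rewrite !inE -!andbA => /and5P[_ _ a1 a2 a3].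
    case/orP: xM => [xM|]; first exact: (allP a3) xM.
    by rewrite mem_cat => /orP[xM|xM]; [exact: (allP a1) xM|exact: (allP a2) xM].
have := core_ge j0p; have := popular_size_le; rewrite /popular_size; have := qt.
by clear -q0; nia.
Qed.
End Core.

(** * Heavy vertices *)

Section Heavy.
Variables (G : graph) (p q h e t : nat) (c : G -> 'I_p) (B : {set G}).
Hypothesis CS : core_structure q h e t c B.
Let p2 := cs_p CS.
Let q0 := cs_q CS.
Local Notation core := (core c B).
Local Notation heavy := (heavy t c B).
Local Notation recolor := (recolor t c B).
Local Notation P := (popular_size p q h e).

Definition inner (u v : G) : bool :=
  [&& u \notin heavy, v \notin heavy, recolor u == recolor v & adj u v].

Lemma inner_sym : symmetric inner.
Proof. by move=> u v; rewrite /inner adj_sym eq_sym andbCA. Qed.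

(** With q disjoint inner edges and X empty, [extend_config] would call a whole part of the core
    small. *)
Lemma inner_cover (i : 'I_p) : exists C : {set G}, #|C| <= 2 * q /\
  forall u v, recolor u = i -> inner u v -> (u \in C) || (v \in C).
Proof.
have [[M [sM mM Msub]]|[C [cC iC]]] := @matching_or_cover G q
  [set v | (v \notin heavy) && (recolor v == i)].
  have [|||j [jp ji]] := @extend_config _ _ _ _ _ _ _ _ CS M set0 i (ltn_ord i) mM.
  - by move=> u /Msub; rewrite inE => /andP[-> /eqP ->].
  - exact: sub0set.
  - by rewrite cards0 sM.
  rewrite enum_set0 sM; have -> : common [::] (core j) = core j.
    by apply/setP => v; rewrite inE andbT.
  have := core_ge CS jp; have := popular_size_le CS; clear -q0.
  move: #|_| P => a b h1 h2 h3; exfalso.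
  have : t <= q * t by rewrite leq_pmull.
  by lia.
exists C; split=> // u v ui; rewrite /inner ui => /and4P[uL vL /eqP vi uv].
apply: contraLR uv; rewrite negb_or => /andP[uC vC].
apply: iC.
  by rewrite in_setD uC /= in_set uL ui eqxx.
by rewrite in_setD vC /= in_set vL -vi eqxx.
Qed.

(** A cover of 2 p q vertices, inner degree at most 2 t, and two orientations of each edge. *)
Lemma inner_count : \sum_u #|[set v | inner u v]| <= 8 * (p * q * t).
Proof.
have [C CE] := fin_all_exists inner_cover.
pose U := \bigcup_i C i.
have cU : #|U| <= p * (2 * q).
  have -> : p * (2 * q) = \sum_(i < p) 2 * q by rewrite sum_nat_const card_ord.
  apply: (@leq_trans (\sum_i #|C i|)); last by apply: leq_sum => i _; case: (CE i).
  rewrite /U; elim/big_rec2: _ => [|i m X _ IH]; first by rewrite cards0.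
  by apply: leq_trans (leq_card_setU _ _) _; rewrite leq_add2l.
have cov u v : inner u v -> (u \in U) || (v \in U).
  move=> uv; have [_ /(_ u v erefl uv)] := CE (recolor u).
  by case/orP => hC; apply/orP; [left|right]; apply/bigcupP; exists (recolor u).
have e1 u : #|[set v | inner u v]| = \sum_v inner u v.
  by rewrite -sum1_card big_mkcond; apply: eq_bigr => v _; rewrite inE; case: (inner u v).
have half : \sum_u \sum_v (u \in U) * inner u v <= p * (2 * q) * (2 * t).
  apply: (@leq_trans (#|U| * (2 * t))); last by rewrite leq_mul2r cU orbT.
  rewrite -sum_nat_const [leqRHS]big_mkcond /=; apply: leq_sum => u _.
  case: (u \in U); last by rewrite big1.
  have [uL|uL] := boolP (u \in heavy).
    by rewrite big1 // => v _; rewrite /inner uL.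
  apply: leq_trans (inner_degree CS uL).
  rewrite -sum1_card [leqRHS]big_mkcond /=; apply: leq_sum => v _.
  by rewrite mul1n in_set /inner uL /= [recolor u == _]eq_sym; case: [&& _, _ & _].
apply: (@leq_trans (\sum_u \sum_v ((u \in U) * inner u v + (v \in U) * inner u v))).
  apply: leq_sum => u _; rewrite e1; apply: leq_sum => v _.
  have [uv|] := boolP (inner u v); last by rewrite !muln0.
  by have := cov _ _ uv; case: (u \in U); case: (v \in U).
under eq_bigr => u _ do rewrite big_split.
rewrite big_split /= [X in _ + X]exchange_big /=.
have -> : \sum_v \sum_u (v \in U) * inner u v = \sum_u \sum_v (u \in U) * inner u v.
  by apply: eq_bigr => v _; apply: eq_bigr => u _; rewrite inner_sym.
by move: half; clear; lia.
Qed.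

Lemma miss_exchange (L0 : {set G}) i :
  \sum_(v in L0) #|core i :\: nbr v| = \sum_(u in core i) #|L0 :\: nbr u|.
Proof.
have e1 (X Y : {set G}) : \sum_(v in X) #|Y :\: nbr v| =
    \sum_(v in X) \sum_(u in Y) ~~ adj v u.
  apply: eq_bigr => v _; rewrite -sum1_card big_mkcond [RHS]big_mkcond.
  by apply: eq_bigr => u _; rewrite !inE; case: (u \in Y); case: (adj v u).
rewrite !e1 exchange_big; apply: eq_bigr => u _; apply: eq_bigr => v _.
by rewrite adj_sym.
Qed.

(** Classify the vertices of part i by their trace on [L0], and let d i be the number of elements of
    [L0] missed by a largest trace that occurs at least [P] times. All but boundedly many times [P]
    vertices of the part have popular traces, so they miss at least d i elements each. If the
    largest popular traces of all parts but j had q common elements, these would contradict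
    [extend_config]; summing over j gives the last bound. *)
Lemma popular (L0 : {set G}) : L0 \subset heavy -> #|L0| <= p * q ->
  exists d : 'I_p -> nat,
    [/\ forall i, d i * (#|core i| - 2 ^ #|L0| * P) <= \sum_(v in L0) #|core i :\: nbr v|,
        forall i, d i <= #|L0| &
        p * #|L0| <= p * (q - 1) + (p - 1) * \sum_i d i].
Proof.
move=> L0L L0q.
have P2 : 2 ^ #|L0| * P <= t.
  apply: leq_trans (cs_et CS); apply: leq_trans (leq_addr _ _).
  by rewrite leq_mul2r leq_exp2l // L0q orbT.
have tq : t <= q * t by rewrite leq_pmull.
have e0 : 0 < e by have := cs_e CS; lia.
have t0 : 0 < t by have := cs_et CS; nia.
pose cls (i : 'I_p) (X : {set G}) := [set u in core i | L0 :&: nbr u == X].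
pose pop (i : 'I_p) (X : {set G}) := (X \subset L0) && (P <= #|cls i X|).
have /fin_all_exists[X0 X0E] : forall i, exists X, pop i X.
  move=> i; have [u _||Z hZ] := @pigeonhole G _ (fun u => L0 :&: nbr u) (core i) L0 P.
  - exact: subsetIl.
  - rewrite mulnC; apply: leq_ltn_trans P2 _; apply: leq_trans (core_ge CS (ltn_ord i)).
    by clear -tq t0; lia.
  exists Z; rewrite /pop (ltnW hZ) andbT.
  have /card_gt0P[u] : 0 < #|[set v in core i | L0 :&: nbr v == Z]| by apply: leq_trans hZ.
  by rewrite inE => /andP[_ /eqP <-]; apply: subsetIl.
pose Xm i := [arg max_(X > X0 i | pop i X) #|X|].
have XmE i : pop i (Xm i) /\ forall X, pop i X -> #|X| <= #|Xm i|.
  by rewrite /Xm; case: arg_maxnP => // X pX mX; split.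
pose d i := #|L0 :\: Xm i|.
have dE i : d i = #|L0| - #|Xm i|.
  by rewrite /d cardsD (setIidPr _) //; have [/andP[]] := XmE i.
exists d; split=> [i|i|].
- rewrite miss_exchange.
  pose un := [set u in core i | ~~ pop i (L0 :&: nbr u)].
  have unle : #|un| <= 2 ^ #|L0| * P.
    rewrite -sum1_card (partition_big (fun u => L0 :&: nbr u) (mem (powerset L0))) /=.
      rewrite -card_powerset -sum_nat_const; apply: leq_sum => Z; rewrite inE => ZL.
      have [pZ|npZ] := boolP (pop i Z).
        rewrite big1 // => u /andP[]; rewrite inE => /andP[_ np] /eqP eZ.
        by rewrite eZ pZ in np.
      move: npZ; rewrite /pop ZL /= -ltnNge => /ltnW; apply: leq_trans.
      rewrite sum1_card subset_leq_card //; apply/subsetP => u.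
      by rewrite unfold_in /= !inE => /andP[/andP[-> _]].
    by move=> u _; rewrite inE subsetIl.
  apply: (@leq_trans (\sum_(u in core i :\: un) d i)).
    rewrite sum_nat_const mulnC leq_mul2r; apply/orP; right.
    have := cardsID un (core i).
    have : #|core i :&: un| <= #|un| by apply: subset_leq_card; apply: subsetIr.
    by move: unle; clear; lia.
  rewrite [leqRHS](bigID (mem un)) /= addnC.
  apply: leq_trans (leq_addr _ _).
  rewrite [leqRHS](eq_bigl (fun u => u \in core i :\: un)); last first.
    by move=> u; rewrite in_setD andbC.
  apply: leq_sum => u; rewrite in_setD => /andP[uun uc].
  have pu : pop i (L0 :&: nbr u) by move: uun; rewrite inE uc negbK.
  rewrite dE; have [_ /(_ _ pu)] := XmE i.
  by have := cardsID (nbr u) L0; clear; lia.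
- by rewrite /d subset_leq_card // subsetDl.
(* Every element of [L0] but at most q - 1 is missed by the popular trace of some part other than
   j. *)
have each j : #|L0| <= (q - 1) + \sum_(i | i != j) d i.
  rewrite leqNgt; apply/negP => lt.
  pose bad := \bigcup_(i | i != j) (L0 :\: Xm i).
  have cb : #|bad| <= \sum_(i | i != j) d i.
    rewrite /bad; elim/big_rec2: _ => [|i m X _ IH]; first by rewrite cards0.
    by apply: leq_trans (leq_card_setU _ _) _; rewrite leq_add2l.
  have qX : q <= #|L0 :\: bad|.
    have := cardsID bad L0.
    have : #|L0 :&: bad| <= #|bad| by apply: subset_leq_card; apply: subsetIr.
    by move: lt cb q0; clear; lia.
  have [X Xsub Xq] := exists_subset qX.
  have XL0 x : x \in X -> x \in L0 /\ x \notin bad.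
    by move/(subsetP Xsub); rewrite inE => /andP[].
  have [|||j' [jp' jj]] := @extend_config _ _ _ _ _ _ _ _ CS [::] X j (ltn_ord j) isT.
  - by [].
  - by apply/subsetP => x /XL0[xL _]; apply: (subsetP L0L).
  - by rewrite addn0.
  rewrite mul0n addn0 ltnNge => /negP; apply.
  have [/andP[_ cl] _] := XmE (Ordinal jp'); apply: leq_trans cl _.
  apply: subset_leq_card; apply/subsetP => u.
  rewrite in_set => /andP[uc /eqP eX]; rewrite in_set uc /=.
  apply/allP => x; rewrite mem_enum => /XL0[xL xb].
  have : x \in Xm (Ordinal jp').
    apply: contraR xb => xX; apply/bigcupP; exists (Ordinal jp') => //.
    by rewrite inE xX.
  by rewrite -eX !inE adj_sym => /andP[].
have := leq_sum (index_enum _) (fun j (_ : true) => each j).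
rewrite big_split /= !sum_nat_const card_ord => le; apply: leq_trans le _.
rewrite leq_add2l (exchange_big_dep predT) //= big_distrr /=.
apply: leq_sum => i _; rewrite sum_nat_const leq_mul2r; apply/orP; right.
rewrite (eq_card (B := predC1 i)); first by rewrite cardC1 card_ord subn1.
by move=> j; rewrite !inE eq_sym.
Qed.

(** For p (q - 1) + 1 heavy vertices, [popular] makes the sum of the d i at least p (q - 1) + 2.
    They then miss about (p (q - 1) + 2) n/p core vertices in total, whereas the minimum degree
    allows each of them only about n/p. *)
Lemma heavy_bound : #|heavy| <= p * (q - 1).
Proof.
rewrite leqNgt; apply/negP => lt.
have [L0 L0L L0c] := exists_subset lt.
have p0 : 0 < p by lia.
have [|d [d1 _ d3]] := popular L0L.
  rewrite L0c -[in leqRHS](subnK q0) mulnDr muln1; lia.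
move: d3; rewrite L0c => d3.
have sd : (p * (q - 1)).+2 <= \sum_i d i.
  rewrite ltnNge; apply/negP => sd.
  have : (p - 1) * \sum_i d i <= (p - 1) * (p * (q - 1)).+1 by rewrite leq_mul2l sd orbT.
  move: d3; set a := p * (q - 1) => d3.
  have e1 : (p - 1) * a.+1 + a.+1 = p * a.+1.
    by rewrite -mulSnr subn1 prednK.
  rewrite -/a; move: d3 e1; move: ((p - 1) * \sum_i d i) ((p - 1) * a.+1) => x y.
  by rewrite mulnS; move: (p * a) p0 => z; clear; lia.
set W := 2 ^ #|L0| * P in d1.
have Wt : W <= t.
  apply: leq_trans (cs_et CS); apply: leq_trans (leq_addr _ _).
  rewrite leq_mul2r leq_exp2l // L0c; apply/orP; right.
  by rewrite -[in leqRHS](subnK q0) mulnDr muln1; lia.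
have up : p * \sum_(v in L0) \sum_(i < p) #|core i :\: nbr v| <= #|L0| * (#|G| + 2 * p * e).
  rewrite big_distrr /= -sum_nat_const; apply: leq_sum => v _.
  exact: (miss_total CS).
have lo : (\sum_i d i) * (#|G| - p * e - p * W) <=
    p * \sum_(v in L0) \sum_(i < p) #|core i :\: nbr v|.
  rewrite exchange_big /= big_distrr big_distrl /=; apply: leq_sum => i _.
  apply: leq_trans (_ : p * (d i * (#|core i| - W)) <= _); last first.
    by rewrite leq_mul2l d1 orbT.
  rewrite mulnCA leq_mul2l mulnBr; apply/orP; right; apply: leq_sub2r.
  by rewrite leq_subLR addnC; apply: (cs_big CS).
have := leq_trans lo up; apply/negP; rewrite -ltnNge L0c.
apply: (@leq_trans ((p * (q - 1)).+2 * (#|G| - p * e - p * W))); last first.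
  by rewrite leq_mul2r sd orbT.
have pe : e <= t.
  apply: leq_trans (cs_et CS); apply: leq_trans (leq_addl _ _).
  by rewrite leq_pmull // !muln_gt0 p0 q0.
have t0 : 0 < t by have := cs_e CS; move: pe; clear; lia.
set a := p * (q - 1).
have ale : a.+1 <= p * q by rewrite /a; move: lt q0 p0; clear; nia.
have e1 : p * q * (p * t) <= p ^ 3 * q * t.
  rewrite (_ : p * q * (p * t) = p ^ 2 * q * t); last by ring.
  by rewrite !leq_mul2r leq_pexp2l ?orbT.
have e2 : 0 < p ^ 3 * q * t by rewrite !muln_gt0 ?expn_gt0 p0 q0 t0.
have e3 : a.+1 * (p * t) <= p * q * (p * t) by rewrite leq_mul2r ale orbT.
have e4 : p * e + p * W <= 2 * (p * t).
  by rewrite -mulnDr mulnCA leq_mul2l; move: pe Wt; clear; lia.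
have e5 : a.+2 * (p * e + p * W) <= a.+2 * (2 * (p * t)) by rewrite leq_mul2l e4 orbT.
have e6 : a.+1 * (2 * p * e) <= a.+1 * (2 * (p * t)).
  by rewrite leq_mul2l -mulnA !leq_mul2l pe !orbT.
have e7 : 1000 * (p ^ 3 * q * t) <= #|G| by have := cs_t CS; rewrite !mulnA.
rewrite -subnDA mulnBr ltn_subRL.
have e8 : 0 < p * t by rewrite muln_gt0 p0.
have e9 : a.+2 * (2 * (p * t)) = a.+1 * (2 * (p * t)) + 2 * (p * t) by ring.
have e10 : 1 * (p * t) <= a.+1 * (p * t) by rewrite leq_mul2r orbT.
rewrite (mulnDr a.+1) [a.+2 * #|G|]mulSn.
move: e1 e2 e3 e5 e6 e7 e8 e9 e10.
move: (p ^ 3 * q * t) (p * q * (p * t)) (a.+1 * (2 * p * e)) (a.+1 * #|G|).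
by move: (a.+2 * (p * e + p * W)) (p * t) #|G|; clear; lia.
Qed.
End Heavy.

(** * Weighted comparison with a star graph *)

Section Weights.
Local Open Scope ring_scope.
Variables (R : realFieldType) (G : graph) (p q h e t : nat).
Variables (c : G -> 'I_p) (B : {set G}) (x : G -> R).
Hypothesis CS : core_structure q h e t c B.
Let tau : R := (20 * p%:R)^-1.
Hypothesis x_bounds : forall v, 1 / 3 <= x v <= 3.
Hypothesis x_core : forall v, v \notin B -> 1 - tau <= x v <= 1 + tau.
Let p2 := cs_p CS.
Let q0 := cs_q CS.
Local Notation core := (core c B).
Local Notation heavy := (heavy t c B).
Local Notation recolor := (recolor t c B).
Local Notation P := (popular_size p q h e).
Local Notation inner := (inner t c B).
Implicit Types A : {set G}.

Definition star_color (i0 : 'I_p) (v : G) : 'I_p := if v \in heavy then i0 else recolor v.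

Local Notation star A i0 := (star_graph A (star_color i0)).

Definition miss_weight u : R := \sum_(v | (v \notin B) && ~~ adj u v) x v.
Definition core_weight i : R := \sum_(v in core i) x v.

Let x0 v : 0 < x v.
Proof. by have /andP[h1 _] := x_bounds v; lra. Qed.

Let xx9 u v : 1 / 9 <= x u * x v <= 9.
Proof.
have /andP[h1 h2] := x_bounds u; have /andP[h3 h4] := x_bounds v.
have e1 : 1 / 9 = 1 / 3 * (1 / 3) :> R by field.
have e2 : 9 = 3 * 3 :> R by ring.
by rewrite e1 e2 !ler_pM //; lra.
Qed.

Lemma qformE (H : graph) (y : H -> R) :
  qform y = \sum_u \sum_v (adj u v)%:R * (y u * y v).
Proof.
apply: eq_bigr => u _; rewrite big_mkcond; apply: eq_bigr => v _.
by case: (adj u v); rewrite ?mul1r ?mul0r.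
Qed.

(** The exact change at a pair of a heavy u and a core vertex v: in the star graph the two are
    non-adjacent only if u is outside [A] and v is in the part i0. *)
Let main A (i0 : 'I_p) u v : R :=
  (u \in heavy)%:R * (v \notin B)%:R *
    ((~~ adj u v)%:R - (u \notin A)%:R * (v \in core i0)%:R) * (x u * x v).

(** Two vertices that are not heavy lose at most an inner edge, and heavy vertices against core
    vertices are accounted for exactly by [main]. The remaining pairs join a heavy vertex to [B];
    any pair loses at most 9, the largest product of two weights. *)
Lemma star_pointwise A (i0 : 'I_p) u v : A \subset heavy ->
  main A i0 u v + main A i0 v u
    - 9 * ((inner u v)%:R + (u \in heavy)%:R * (v \in B)%:R + (v \in heavy)%:R * (u \in B)%:R)
  <= ((@adj (star A i0) u v)%:R - (adj u v)%:R) * (x u * x v).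
Proof.
move=> AL; have LB := heavy_sub CS.
have /andP[lo hi] := xx9 u v.
have hA w : w \notin heavy -> w \notin A by apply: contra; apply: (subsetP AL).
have hB w : w \in heavy -> w \in B by apply: (subsetP LB).
have xvu : x v * x u = x u * x v by rewrite mulrC.
have dm (a b : bool) : - 9 <= (a%:R - b%:R) * (x u * x v).
  by case: a; case: b; rewrite ?subrr ?subr0 ?sub0r ?mul0r ?mul1r ?mulN1r; lra.
have wB w : w \notin B -> (w \in core i0) = (star_color i0 w == i0).
  move=> wB; rewrite /star_color (negPf (contra (hB w) wB)) (recolor_core _ _ wB).
  by rewrite inE wB.
have half a b : a \in heavy -> b \notin B -> x a * x b = x u * x v ->
    main A i0 a b = ((@adj (star A i0) a b)%:R - (adj a b)%:R) * (x u * x v).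
  move=> aL bB ab; rewrite /main aL bB ab !mul1r; congr (_ * _).
  have bL : b \notin heavy by apply: contra bB; apply: hB.
  have anb : a != b by apply: contraNneq bL => <-.
  rewrite wB //= /star_adj anb (negPf (hA b bL)) /=.
  have -> : star_color i0 a = i0 by rewrite /star_color aL.
  rewrite [i0 == _]eq_sym.
  by case: (a \in A); case: (_ == i0); case: (adj a b); rewrite /= ?mulr1 ?mulr0; ring.
rewrite /main in half *.
have [uL|uL] := boolP (u \in heavy); have [vL|vL] := boolP (v \in heavy).
- rewrite (hB u uL) (hB v vL) /inner uL /= !mulr0 !mul0r !mulr1 !add0r.
  by have := dm (star_adj A (star_color i0) u v) (adj u v); lra.
- have [vB|vB] := boolP (v \in B).
    rewrite (hB u uL) /inner uL /= !mulr0 !mul0r ?mulr1 !add0r ?addr0.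
    by have := dm (star_adj A (star_color i0) u v) (adj u v); lra.
  have := half u v uL vB erefl; rewrite uL vB /inner uL /= => ->.
  by rewrite !mul0r !mulr0; lra.
- have [uB|uB] := boolP (u \in B).
    rewrite (hB v vL) /inner uL vL /= !mulr0 !mul0r ?mulr1 !add0r ?addr0.
    by have := dm (star_adj A (star_color i0) u v) (adj u v); lra.
  have := half v u vL uB xvu; rewrite vL uB /inner uL vL /= xvu => ->.
  rewrite [in X in _ <= X]star_sym [in X in _ <= X]adj_sym.
  by rewrite !mul0r; lra.
rewrite !mul0r !add0r !addr0 /inner uL vL /=.
rewrite /star_adj (negPf (hA u uL)) (negPf (hA v vL)) /= /star_color (negPf uL) (negPf vL).
have [uv|uv] /= := boolP (adj u v); last first.
  rewrite andbF subr0 mulr0 oppr0 mulr_ge0 ?ler0n //; lra.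
have -> /= : u != v by apply: contraTneq uv => ->; rewrite adj_irr.
by case: (recolor u == recolor v); rewrite /= ?subrr ?mul0r; lra.
Qed.

Lemma sum_symmetrize (T : finType) (a i b : T -> T -> R) :
  \sum_u \sum_v (a u v + a v u - 9 * (i u v + b u v + b v u)) =
  2 * \sum_u \sum_v a u v - 9 * (\sum_u \sum_v i u v + 2 * \sum_u \sum_v b u v).
Proof.
have sw (f : T -> T -> R) : \sum_u \sum_v f v u = \sum_u \sum_v f u v.
  by rewrite exchange_big.
have -> : \sum_u \sum_v (a u v + a v u - 9 * (i u v + b u v + b v u)) =
    \sum_u \sum_v a u v + \sum_u \sum_v a v u
    - 9 * (\sum_u \sum_v i u v + \sum_u \sum_v b u v + \sum_u \sum_v b v u).
  rewrite -!big_split /= mulr_sumr -sumrB; apply: eq_bigr => u _.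
  by rewrite -!big_split /= mulr_sumr -sumrB.
by rewrite (sw a) (sw b); ring.
Qed.

Lemma sum_pred_nat (T : finType) (S : pred T) : \sum_v (S v)%:R = #|S|%:R :> R.
Proof.
rewrite -sum1_card natr_sum [RHS]big_mkcond; apply: eq_bigr => v _.
by rewrite unfold_in; case: (S v).
Qed.

(** The constant is 90 = 9 (8 + 2): 8 from [inner_count], and 2 from both orders of the pairs
    between [heavy] and [B]. *)
Lemma star_compare A (i0 : 'I_p) : A \subset heavy ->
  2 * \sum_(u in heavy) x u * (miss_weight u - (u \notin A)%:R * core_weight i0)
    - 90 * (p * q * t)%:R <= @qform R (star A i0) x - qform x.
Proof.
move=> AL.
have -> : @qform R (star A i0) x - qform x =
    \sum_(u : G) \sum_(v : G)
      ((@adj (star A i0) u v)%:R - (@adj G u v)%:R) * (x u * x v).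
  rewrite !qformE -sumrB; apply: eq_bigr => u _; rewrite -sumrB.
  by apply: eq_bigr => v _; rewrite mulrBl.
apply: (@le_trans _ _ (\sum_(u : G) \sum_(v : G) (main A i0 u v + main A i0 v u
    - 9 * ((inner u v)%:R + (u \in heavy)%:R * (v \in B)%:R + (v \in heavy)%:R * (u \in B)%:R))));
  last by apply: ler_sum => u _; apply: ler_sum => v _; apply: star_pointwise.
pose N1 : R := \sum_u \sum_v (inner u v)%:R.
pose N2 : R := \sum_(u : G) \sum_(v : G) (u \in heavy)%:R * (v \in B)%:R.
have -> : \sum_u \sum_v (main A i0 u v + main A i0 v u
    - 9 * ((inner u v)%:R + (u \in heavy)%:R * (v \in B)%:R + (v \in heavy)%:R * (u \in B)%:R))
   = 2 * \sum_u \sum_v main A i0 u v - 9 * (N1 + 2 * N2).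
  exact: (sum_symmetrize (main A i0) (fun u v => (inner u v)%:R)
    (fun u v => (u \in heavy)%:R * (v \in B)%:R)).
have -> : \sum_u \sum_v main A i0 u v =
    \sum_(u in heavy) x u * (miss_weight u - (u \notin A)%:R * core_weight i0).
  rewrite [RHS]big_mkcond; apply: eq_bigr => u _; rewrite /main.
  case: (u \in heavy); last by rewrite big1 // => v _; rewrite !mul0r.
  rewrite /miss_weight /core_weight [X in _ * (X - _)]big_mkcond [X in _ - _ * X]big_mkcond.
  rewrite [X in _ - X]mulr_sumr -sumrB mulr_sumr; apply: eq_bigr => v _; rewrite inE.
  case: (v \in B); rewrite /= ?mulr0 ?mul0r ?subrr ?mulr0 //.
  by case: (adj u v); case: (c v == i0 :> nat); rewrite /= ?mulr0 ?mulr1; ring.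
have N1E : N1 <= 8 * (p * q * t)%:R.
  have := inner_count CS; rewrite -(ler_nat R) natrM; apply: le_trans.
  rewrite natr_sum; apply: ler_sum => u _.
  by rewrite sum_pred_nat (eq_card (B := [set v | inner u v])) // => v; rewrite !inE.
have N2E : N2 <= (p * q * e)%:R.
  rewrite /N2; under eq_bigr => u _ do rewrite -mulr_sumr.
  rewrite -mulr_suml !sum_pred_nat -natrM ler_nat.
  apply: leq_mul; last exact: cs_B CS.
  by apply: leq_trans (heavy_bound CS) _; rewrite leq_mul2l leq_subr orbT.
have N2F : (p * q * e)%:R <= (p * q * t)%:R :> R.
  rewrite ler_nat leq_mul2l; apply/orP; right.
  apply: leq_trans (cs_et CS); apply: leq_trans (leq_addl _ _).
  by rewrite leq_pmull // !muln_gt0 q0 /=; lia.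
by lra.
Qed.
End Weights.

(** * A star graph of larger weight *)

Section Dominate.
Local Open Scope ring_scope.
Variables (R : realFieldType) (G : graph) (p q h e t : nat).
Variables (c : G -> 'I_p) (B : {set G}) (x : G -> R).
Hypothesis CS : core_structure q h e t c B.
Let tau : R := (20 * p%:R)^-1.
Hypothesis x_bounds : forall v, 1 / 3 <= x v <= 3.
Hypothesis x_core : forall v, v \notin B -> 1 - tau <= x v <= 1 + tau.
Let p2 := cs_p CS.
Let q0 := cs_q CS.
Local Notation core := (core c B).
Local Notation heavy := (heavy t c B).
Local Notation recolor := (recolor t c B).
Local Notation P := (popular_size p q h e).
Local Notation inner := (inner t c B).
Local Notation star_color := (star_color t c B).
Local Notation star A i0 := (star_graph A (star_color i0)).
Local Notation miss_weight := (miss_weight B x).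
Local Notation core_weight := (core_weight c B x).

Let x0 v : 0 < x v.
Proof. by have /andP[h1 _] := x_bounds v; lra. Qed.

Let p0 : (0 < p)%N. Proof. by clear -p2; lia. Qed.

Let n0 : 0 < p%:R :> R. Proof. by rewrite ltr0n. Qed.

Let tau0 : 0 < tau. Proof. by rewrite invr_gt0 mulr_gt0. Qed.

Let tau_p : tau * p%:R = 1 / 20.
Proof. by rewrite /tau; field; rewrite lt0r_neq0. Qed.

Let tau1 : tau <= 1 / 40.
Proof.
have : 2 <= p%:R :> R by rewrite ler_nat.
move=> h1; have h2 : tau * 2 <= tau * p%:R by rewrite ler_pM2l.
by move: h2 tau_p; lra.
Qed.

Lemma top_subset (L : {set G}) k : (k <= #|L|)%N -> exists A : {set G},
  [/\ A \subset L, #|A| = k & forall a b, a \in A -> b \in L :\: A -> x b <= x a].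
Proof.
elim: k => [_|k IH kL].
  exists set0; split; [exact: sub0set|exact: cards0|].
  by move=> a b; rewrite in_set0.
have [A [AL Ak Atop]] := IH (ltnW kL).
have /set0Pn[w0 w0L] : L :\: A != set0.
  rewrite -card_gt0 cardsD (setIidPr AL) Ak subn_gt0 //.
pose w := [arg max_(v > w0 in L :\: A) x v]%O.
have [wLA wmax] : w \in L :\: A /\ forall v, v \in L :\: A -> x v <= x w.
  by rewrite /w; case: arg_maxP.
move: (wLA); rewrite inE => /andP[wA wL].
exists (w |: A); split.
- by rewrite subUset sub1set wL.
- by rewrite cardsU1 wA Ak.
move=> a b; rewrite !inE negb_or => /orP[/eqP->|aA] /andP[/andP[bw bA] bL].
  by apply: wmax; rewrite inE bA.
by apply: Atop; rewrite // inE bA.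
Qed.

Let nu : R := #|G|%:R / p%:R.

Let nuE : nu * p%:R = #|G|%:R.
Proof. by rewrite /nu mulfVK // lt0r_neq0. Qed.

Let e0 : (0 < e)%N.
Proof. by have := cs_e CS; clear; lia. Qed.

Let et : (10 * p * q * e <= t)%N.
Proof. by apply: leq_trans (cs_et CS); apply: leq_addl. Qed.

Let et20 : 20 * e%:R <= t%:R :> R.
Proof.
rewrite -natrM ler_nat; apply: leq_trans et; rewrite leq_mul2r; apply/orP; right.
by move: p2 q0; clear; nia.
Qed.

Let t1 : 1 <= t%:R :> R.
Proof.
have h1 : 1 <= e%:R :> R by rewrite ler1n.
by have := et20; lra.
Qed.

Let T := (p ^ 2 * q * t)%N.

Let nu_big : 1000 * T%:R <= nu.
Proof.
rewrite ler_pdivlMr // -!natrM ler_nat.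
have -> : (1000 * T * p = 1000 * p ^ 3 * q * t)%N by rewrite /T; ring.
exact: cs_t CS.
Qed.

Let T_pqt : 2 * (p * q * t)%:R <= T%:R :> R.
Proof.
rewrite -natrM ler_nat /T expnS expn1 -!mulnA leq_mul2r; apply/orP; right.
exact: p2.
Qed.

Let T_pt : 2 * (p%:R * t%:R) <= T%:R :> R.
Proof.
apply: le_trans T_pqt; rewrite ler_pM2l // -natrM ler_nat -mulnA leq_mul2l.
by rewrite leq_pmull ?orbT.
Qed.

Let T_t : 4 * t%:R <= T%:R :> R.
Proof.
have h1 : 2 <= p%:R :> R by rewrite ler_nat.
have : 2 * t%:R <= p%:R * t%:R :> R by rewrite ler_wpM2r //; have := t1; lra.
by have := T_pt; lra.
Qed.

Lemma card_core_ge (i : 'I_p) : nu - e%:R <= #|core i|%:R :> R.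
Proof.
rewrite -(ler_pM2r n0) mulrBl nuE lerBlDr -!natrM -natrD ler_nat.
by rewrite ![(_ * p)%N]mulnC; apply: (cs_big CS).
Qed.

Lemma card_core_le (i : 'I_p) : #|core i|%:R <= nu + e%:R :> R.
Proof.
rewrite -(ler_pM2r n0) mulrDl nuE -!natrM -natrD ler_nat.
by rewrite ![(_ * p)%N]mulnC; apply: (cs_small CS).
Qed.

Definition miss_card u : nat := #|[set v | (v \notin B) && ~~ adj u v]|.

Lemma miss_card_cores u : miss_card u = (\sum_(i < p) #|core i :\: nbr u|)%N.
Proof.
transitivity #|[set w in ~: B | ~~ adj u w]|.
  by apply: eq_card => w; rewrite !inE.
rewrite -(sum_core_card c); apply: eq_bigr => i _; apply: eq_card => w.
by rewrite !inE andbC.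
Qed.

Lemma miss_weight_ge u : (1 - tau) * (miss_card u)%:R <= miss_weight u.
Proof.
rewrite /miss_card mulr_natr -sumr_const.
rewrite [leLHS](eq_bigl (fun v => (v \notin B) && ~~ adj u v)); last first.
  by move=> v; rewrite inE.
by apply: ler_sum => v /andP[/x_core/andP[]].
Qed.

Lemma miss_weight_le u : miss_weight u <= (1 + tau) * (nu + 2 * e%:R).
Proof.
apply: (@le_trans _ _ ((1 + tau) * (miss_card u)%:R)).
  rewrite /miss_card mulr_natr -sumr_const.
  rewrite [leRHS](eq_bigl (fun v => (v \notin B) && ~~ adj u v)); last first.
    by move=> v; rewrite inE.
  by apply: ler_sum => v /andP[/x_core/andP[]].
rewrite ler_pM2l; last by have := tau0; lra.
rewrite miss_card_cores -(ler_pM2r n0) mulrDl nuE.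
apply: (@le_trans _ _ (#|G| + 2 * p * e)%:R).
  by rewrite -natrM ler_nat mulnC; apply: miss_total CS u.
by rewrite natrD !natrM; lra.
Qed.

Lemma core_weight_bounds (i : 'I_p) :
  (1 - tau) * (nu - e%:R) <= core_weight i <= (1 + tau) * (nu + e%:R).
Proof.
have h1 := card_core_ge i; have h2 := card_core_le i; have := tau0; have := tau1.
move=> h3 h4; apply/andP; split.
  apply: (@le_trans _ _ ((1 - tau) * #|core i|%:R)); first by rewrite ler_pM2l; lra.
  rewrite mulr_natr -sumr_const; apply: ler_sum => v.
  by rewrite inE => /andP[/x_core/andP[]].
apply: (@le_trans _ _ ((1 + tau) * #|core i|%:R)); last by rewrite ler_pM2l; lra.
rewrite mulr_natr -sumr_const; apply: ler_sum => v.
by rewrite inE => /andP[/x_core/andP[]].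
Qed.

Lemma miss_weight_ge0 u : 0 <= miss_weight u.
Proof. by apply: sumr_ge0 => v _; apply: ltW. Qed.

Let compare := star_compare CS x_bounds.

Lemma qform_sub (H K : graph) (y : H -> R) (f : H -> K) (g : K -> H) :
  cancel f g -> cancel g f -> (forall v, 0 < y v) ->
  (forall u v, adj u v -> adj (f u) (f v)) ->
  qform y < qform (y \o g) \/ (forall u v, adj (f u) (f v) = adj u v).
Proof.
move=> fK gK y0 sub.
have [/forallP ex|] := boolP [forall u, forall v, adj (f u) (f v) ==> adj u v].
  right=> u v; apply/idP/idP; last exact: sub.
  by have /forallP/(_ v)/implyP := ex u.
rewrite negb_forall => /existsP[u]; rewrite negb_forall => /existsP[v].
rewrite negb_imply => /andP[fuv uv]; left.
have fb : bijective f by exists g.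
rewrite !qformE [ltRHS](reindex f) /=; last exact: onW_bij.
have le a b : (adj a b)%:R * (y a * y b) <= (adj (f a) (f b))%:R * (y (g (f a)) * y (g (f b))).
  rewrite !fK; apply: ler_wpM2r; first by rewrite mulr_ge0 // ltW.
  rewrite ler_nat.
  by case: (boolP (adj a b)) => // /sub ->.
rewrite (bigD1 u) //= [ltRHS](bigD1 u) //= ltr_leD //; last first.
  apply: ler_sum => a _; rewrite [leRHS](reindex f) /=; last exact: onW_bij.
  by apply: ler_sum.
rewrite [ltRHS](reindex f) /=; last exact: onW_bij.
rewrite (bigD1 v) //= [ltRHS](bigD1 v) //= ltr_leD //; last first.
  by apply: ler_sum => b _.
by rewrite fuv (negPf uv) !fK mul0r mul1r mulr_gt0.
Qed.

Let i0 : 'I_p := Ordinal p0.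

(** Filling up with core vertices is profitable: a single one becoming adjacent to its own part
    gains about n / (9 p), far more than the error of [star_compare]. *)
Lemma dominate_few : (#|heavy| < q - 1)%N -> exists A : {set G},
  #|A| = (q - 1)%N /\ qform x < @qform R (star A i0) x.
Proof.
move=> hq; have LB := heavy_sub CS.
have [|A2 A2sub A2c] := @exists_subset G (core i0) (q - 1 - #|heavy|).
  apply: leq_trans (core_ge CS p0); apply: leq_trans (leq_subr _ _) _.
  apply: leq_trans (leq_subr _ _) _.
  have : (0 < t)%N by rewrite -(ltr_nat R); have := t1; lra.
  by move: q0; clear; nia.
have dis : [disjoint heavy & A2].
  rewrite disjoints_subset; apply/subsetP => v /(subsetP LB) vB; rewrite inE.
  by apply/negP => /(subsetP A2sub); rewrite inE vB.
exists (heavy :|: A2); split.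
  rewrite cardsU (disjoint_setI0 dis) cards0 subn0 A2c.
  by rewrite subnKC // ltnW.
have := compare i0 (subxx heavy).
have S0 : 0 <= \sum_(u in heavy) x u * (miss_weight u - (u \notin heavy)%:R * core_weight i0).
  apply: sumr_ge0 => u uL; rewrite uL mul0r subr0.
  by rewrite mulr_ge0 ?miss_weight_ge0 // ltW.
have /set0Pn[a aA2] : A2 != set0 by rewrite -card_gt0 A2c subn_gt0.
have aC : a \in core i0 := subsetP A2sub _ aA2.
have notL v : v \in core i0 -> v \notin heavy.
  by rewrite inE => /andP[vB _]; apply: contra vB; apply: (subsetP LB).
have col v : v \in core i0 -> star_color i0 v = i0.
  move=> vC; rewrite /star_color (negPf (notL v vC)).
  move: vC; rewrite inE => /andP[vB /eqP vi]; rewrite recolor_core //.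
  exact: val_inj.
have gain : @qform R (star heavy i0) x + 1 / 9 * (#|core i0|%:R - 1) <=
    @qform R (star (heavy :|: A2) i0) x.
  rewrite !qformE.
  have le u v : (@adj (star heavy i0) u v)%:R * (x u * x v) <=
      (@adj (star (heavy :|: A2) i0) u v)%:R * (x u * x v).
    apply: ler_wpM2r; first by rewrite mulr_ge0 // ltW.
    rewrite ler_nat /= /star_adj !in_setU.
    by case: (u != v); case: (u \in heavy); case: (v \in heavy);
       case: (u \in A2); case: (v \in A2); case: (_ != _).
  rewrite (bigD1 a) //= [leRHS](bigD1 a) //= addrAC lerD //; last first.
    by apply: ler_sum => u _; apply: ler_sum => v _; apply: le.
  have -> : #|core i0|%:R - 1 = \sum_(v in core i0 | v != a) (1 : R).
    rewrite -[#|core i0|%:R]sumr_const (bigD1 a) //=.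
    by rewrite addrAC subrr add0r.
  rewrite mulr_sumr [X in _ + X]big_mkcond -big_split /=; apply: ler_sum => v _.
  case: ifP => [/andP[vC va]|_]; last by rewrite addr0; apply: le.
  have aL := notL a aC; have vL := notL v vC.
  rewrite /star_adj !in_setU (negPf aL) (negPf vL) aA2 /= !col // eqxx [a == v]eq_sym va /=.
  rewrite mul0r add0r mulr1 [leRHS]mul1r.
  have /andP[h1 _] := x_bounds a; have /andP[h2 _] := x_bounds v.
  have -> : 1 / 9 = 1 / 3 * (1 / 3) :> R by field.
  by apply: ler_pM; lra.
have h1 := card_core_ge i0; have h2 := nu_big; have h3 := T_pqt; have h4 := et20.
have h5 := T_t; have h6 := t1; move: S0 gain.
by lra.
Qed.

(** One inner edge together with the q - 1 heavy vertices leaves, by [extend_config], a part with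
    few common neighbours of [heavy]; making these dominating then gains about n / (9 p). Without
    inner edges, the graph is a subgraph of the star graph. *)
Lemma dominate_exact : #|heavy| = (q - 1)%N ->
  qform x < @qform R (star heavy i0) x \/
  (forall u v : G, @adj (star heavy i0) u v = adj u v).
Proof.
move=> hq.
have [/existsP[u /existsP[v uv]]|none] := boolP [exists u, exists v, inner u v].
  left; have := compare i0 (subxx heavy).
  have /and4P[uL vL /eqP euv auv] := uv.
  have nuv : u != v by apply: contraTneq auv => ->; rewrite adj_irr.
  have [|w|||j [jp jj lt]] :=
    @extend_config _ _ _ _ _ _ _ _ CS [:: (u, v)] heavy (recolor u) (ltn_ord _).
  - by rewrite /matching /ends /= inE nuv auv.
  - move=> wM; have : (w == u) || (w == v) by move: wM; rewrite /ends /= !inE.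
    by case/orP => /eqP ->; split=> //; rewrite euv.
  - exact: subxx.
  - by rewrite hq /= subnK.
  have S : 1 / 9 * (#|core j|%:R - #|common (enum heavy) (core j)|%:R) <=
      \sum_(w in heavy) x w * (miss_weight w - (w \notin heavy)%:R * core_weight i0).
    rewrite -natrB; last by apply: subset_leq_card; apply/subsetP => w; rewrite inE => /andP[].
    have -> : (#|core j| - #|common (enum heavy) (core j)| =
        #|core j :\: common (enum heavy) (core j)|)%N.
      rewrite cardsD (setIidPr _) //; apply/subsetP => w; by rewrite inE => /andP[].
    rewrite mulr_natr -sumr_const.
    have -> : \sum_(w in heavy) x w * (miss_weight w - (w \notin heavy)%:R * core_weight i0) =
      \sum_w \sum_(z | (z \notin B) && ~~ adj w z) (w \in heavy)%:R * (x w * x z).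
      rewrite big_mkcond; apply: eq_bigr => w _; case: (w \in heavy).
        by rewrite mul0r subr0 mulr_sumr; apply: eq_bigr => z _; rewrite mul1r.
      by rewrite big1 // => z _; rewrite mul0r.
    rewrite (exchange_big_dep (fun z => z \notin B)) /= => [|w z _ /andP[] //].
    rewrite [leRHS](bigID (mem (core j :\: common (enum heavy) (core j)))) /=.
    apply: ler_wpDr.
      apply: sumr_ge0 => z _; apply: sumr_ge0 => w _.
      by rewrite mulr_ge0 ?ler0n // mulr_ge0 // ltW.
    rewrite [leRHS](eq_bigl (fun z => z \in core j :\: common (enum heavy) (core j))); last first.
      move=> z; rewrite andb_idl // !inE => /andP[_ /andP[]] //.
    apply: ler_sum => z; rewrite !inE => /andP[+ /andP[zB zj]].
    rewrite zB zj /= => /allPn[w]; rewrite mem_enum => wL wz.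
    rewrite (bigD1 w) ?zB //= wL [true%:R * _]mul1r ler_wpDr //.
      by apply: sumr_ge0 => y _; rewrite mulr_ge0 ?ler0n // mulr_ge0 // ltW.
    have /andP[h1 _] := x_bounds w; have /andP[h2 _] := x_bounds z.
    have -> : 1 / 9 = 1 / 3 * (1 / 3) :> R by field.
    by apply: ler_pM; lra.
  have h0 : #|common (enum heavy) (core j)|%:R <= 5 * t%:R :> R.
    rewrite -natrM ler_nat; apply: leq_trans (ltnW lt) _.
    by have := popular_size_le CS; rewrite /=; clear; lia.
  have h1 := card_core_ge (Ordinal jp); have h2 := nu_big; have h3 := T_pqt; have h4 := et20.
  have h5 := T_t; have h6 := t1; move: S; rewrite /= in h1.
  by lra.
apply: (@qform_sub G (star heavy i0) x id id) => // u v auv.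
rewrite /= /star_adj.
have -> /= : u != v by apply: contraTneq auv => ->; rewrite adj_irr.
apply: contraR none; rewrite !negb_or negbK => /and3P[uL vL].
rewrite /star_color (negPf uL) (negPf vL) => uv.
by apply/existsP; exists u; apply/existsP; exists v; rewrite /inner uL vL uv.
Qed.

Let core_gap (L0 : {set G}) (i : 'I_p) : (#|L0| <= p * q)%N ->
  nu - t%:R <= (#|core i| - 2 ^ #|L0| * P)%:R :> R.
Proof.
move=> L0q; have h1 := card_core_ge i.
have h2 : (2 ^ #|L0| * P + e <= t)%N.
  apply: leq_trans (cs_et CS); apply: leq_add.
    by rewrite leq_mul2r leq_exp2l // L0q orbT.
  by rewrite leq_pmull // !muln_gt0 p0 q0.
have h3 : (2 ^ #|L0| * P <= #|core i|)%N.
  apply: leq_trans (core_ge CS (ltn_ord i)); apply: leq_trans (leq_trans (leq_addr _ _) h2) _.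
  by move: q0; clear; nia.
rewrite natrB //; move: h2; rewrite -(ler_nat R) natrD.
by lra.
Qed.

(** The p copies of [nu] gained and the p - 1 copies lost leave one. The choice tau = 1 / (20 p)
    limits the distortion 4 tau p nu to nu / 5. *)
Let bracket : 3 / 4 * nu <= (1 - tau) * (nu - t%:R) * p%:R -
  (p%:R - 1) * ((1 + 3 * tau) * nu + 6 * e%:R).
Proof.
have h1 := nu_big; have h2 := T_pt; have h3 := et20; have h4 := t1.
have h5 : tau * p%:R * nu = 1 / 20 * nu by rewrite tau_p.
have h6 : 0 <= tau * p%:R * t%:R by rewrite !mulr_ge0 ?ler0n // ltW.
have nu0 : 0 <= nu by rewrite divr_ge0 ?ler0n.
have h7 : 0 <= tau * nu by rewrite mulr_ge0 // ltW.
have h8 : 20 * (e%:R * p%:R) <= t%:R * p%:R :> R by rewrite mulrA ler_pM2r.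
have ee : 0 <= e%:R :> R by [].
have -> : (1 - tau) * (nu - t%:R) * p%:R - (p%:R - 1) * ((1 + 3 * tau) * nu + 6 * e%:R)
  = nu - 4 * (tau * p%:R * nu) - p%:R * t%:R + tau * p%:R * t%:R + 3 * (tau * nu)
    - 6 * (e%:R * p%:R) + 6 * e%:R by ring.
rewrite h5; rewrite [t%:R * _]mulrC in h8.
by lra.
Qed.

(* The heavy vertices of largest weight become dominating, the other ones join the first part. *)
Lemma dominate_many : (q <= #|heavy|)%N -> exists A : {set G},
  #|A| = (q - 1)%N /\ qform x < @qform R (star A i0) x.
Proof.
move=> hq; have [|A [AL Ak Atop]] := @top_subset heavy (q - 1).
  by apply: leq_trans hq; apply: leq_subr.
exists A; split=> //; have := compare i0 AL; set S := \sum_(u in heavy) _.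
have Rc : #|heavy :\: A| = (#|heavy| - (q - 1))%N by rewrite cardsD (setIidPr AL) Ak.
have /set0Pn[w0 w0R] : heavy :\: A != set0.
  by rewrite -card_gt0 Rc; move: hq q0; clear; lia.
pose w := [arg max_(v > w0 in heavy :\: A) x v]%O.
have [wR wmax] : w \in heavy :\: A /\ forall v, v \in heavy :\: A -> x v <= x w.
  by rewrite /w; case: arg_maxP.
have wA a : a \in A -> x w <= x a by move=> aA; apply: Atop.
have /andP[w3 _] := x_bounds w; set m := x w in wmax wA w3.
(* An upper bound for the excess of any [miss_weight u] over the weight of a part. *)
pose sg := 2 * tau * nu + 4 * e%:R.
have nu0 : 0 <= nu by rewrite divr_ge0 ?ler0n.
have tn0 : 0 <= tau * nu by rewrite mulr_ge0 // ltW.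
have te : tau * e%:R <= 1 / 40 * e%:R by rewrite ler_wpM2r // ler0n.
have ee : 0 <= e%:R :> R by [].
have sg0 : 0 <= sg by rewrite /sg; lra.
have /andP[cw1 cw2] := core_weight_bounds i0; set cw := core_weight i0 in cw1 cw2 S *.
(* All heavy weights are replaced by the largest one outside [A]. Inside [A] the weights are at
   least m and the terms nonnegative; outside they are at most m, and subtracting [sg] makes the
   bracket nonpositive. *)
have SE : m * (\sum_(u in heavy) miss_weight u - #|heavy :\: A|%:R * (cw + sg)) <= S.
  have -> : #|heavy :\: A|%:R * (cw + sg) = \sum_(u in heavy) (u \notin A)%:R * (cw + sg).
    rewrite -mulr_suml; congr (_ * _); rewrite -sum1_card natr_sum big_mkcond [RHS]big_mkcond.
    by apply: eq_bigr => v _; rewrite in_setD; case: (v \in A); case: (v \in heavy).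
  rewrite -sumrB mulr_sumr; apply: ler_sum => u uL.
  have mw0 := miss_weight_ge0 u; have mw1 := miss_weight_le u.
  have [uA|uA] := boolP (u \in A).
    by rewrite !mul0r !subr0 ler_wpM2r // wA.
  have ud : miss_weight u - cw <= sg by rewrite /sg; lra.
  have um : x u <= m by apply: wmax; rewrite inE uA.
  have xu := x0 u; rewrite !mul1r -subr_ge0.
  have -> : x u * (miss_weight u - cw) - m * (miss_weight u - (cw + sg)) =
    (m - x u) * (sg - (miss_weight u - cw)) + x u * sg by ring.
  by rewrite addr_ge0 // mulr_ge0 //; lra.
have hL : (#|heavy| <= p * q)%N.
  by apply: leq_trans (heavy_bound CS) _; rewrite leq_mul2l leq_subr orbT.
have [d [d1 _ d3]] := popular CS (subxx heavy) hL.
set r := (#|heavy| - (q - 1))%N in Rc.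
have r1 : 1 <= r%:R :> R by rewrite ler1n /r; move: hq q0; clear; lia.
set D : R := (\sum_i d i)%:R.
have D1 : p%:R * r%:R <= (p%:R - 1) * D.
  have -> : p%:R - 1 = (p - 1)%:R :> R by rewrite natrB.
  rewrite -!natrM ler_nat /r mulnBr leq_subLR; exact: d3.
have nut : 0 <= nu - t%:R by have := nu_big; have := T_t; have := t1; lra.
have W1 : (1 - tau) * (D * (nu - t%:R)) <= \sum_(u in heavy) miss_weight u.
  apply: (@le_trans _ _ (\sum_(u in heavy) (1 - tau) * (miss_card u)%:R)); last first.
    by apply: ler_sum => u _; apply: miss_weight_ge.
  rewrite -mulr_sumr ler_wpM2l //; first by have := tau1; lra.
  rewrite -natr_sum; under eq_bigr => u _ do rewrite miss_card_cores.
  rewrite exchange_big /= natr_sum /D natr_sum mulr_suml; apply: ler_sum => i _.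
  apply: (@le_trans _ _ (d i * (#|core i| - 2 ^ #|heavy| * P))%:R).
    by rewrite natrM ler_wpM2l // core_gap.
  by rewrite ler_nat; apply: d1.
set Y := \sum_(u in heavy) miss_weight u - _ in SE.
have p1 : 1 <= p%:R - 1 :> R.
  by have : 2 <= p%:R :> R; [rewrite ler_nat|lra].
have Y1 : 3 / 4 * nu <= (p%:R - 1) * Y.
  have e1 : (p%:R - 1) * ((1 - tau) * (D * (nu - t%:R))) <=
      (p%:R - 1) * \sum_(u in heavy) miss_weight u by rewrite ler_pM2l //; lra.
  have e2 : (1 - tau) * (nu - t%:R) * (p%:R * r%:R) <=
      (1 - tau) * (nu - t%:R) * ((p%:R - 1) * D).
    by rewrite ler_wpM2l // mulr_ge0 //; have := tau1; lra.
  have e3 : (p%:R - 1) * r%:R * (cw + sg) <=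
      (p%:R - 1) * r%:R * ((1 + 3 * tau) * nu + 6 * e%:R).
    by rewrite ler_wpM2l ?mulr_ge0 //; [lra|rewrite /sg; lra].
  have e4 : r%:R * (3 / 4 * nu) <= r%:R * ((1 - tau) * (nu - t%:R) * p%:R -
    (p%:R - 1) * ((1 + 3 * tau) * nu + 6 * e%:R)) by rewrite ler_wpM2l ?bracket.
  have e5 : 1 * (3 / 4 * nu) <= r%:R * (3 / 4 * nu) by rewrite ler_wpM2r //; lra.
  rewrite /Y Rc; lra.
have Y0 : 0 <= Y.
  by rewrite -(pmulr_rge0 _ (_ : 0 < p%:R - 1)); lra.
have mY : 1 / 3 * Y <= m * Y by rewrite ler_wpM2r.
have pS : p%:R * (1 / 3 * Y) <= p%:R * S by rewrite ler_pM2l //; lra.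
have key : 90 * T%:R < p%:R * (2 * S).
  by have := nu_big; have := T_t; have := t1; lra.
have : 90 * (p * q * t)%:R < 2 * S.
  rewrite -(ltr_pM2l n0); apply: le_lt_trans key.
  have -> : T%:R = p%:R * (p * q * t)%:R :> R.
    by rewrite -natrM /T; congr (_%:R); ring.
  by rewrite mulrCA.
by lra.
Qed.

Theorem star_dominates : exists (A : {set G}) (cs : G -> 'I_p), #|A| = (q - 1)%N /\
  (qform x < @qform R (star_graph A cs) x \/
   forall u v : G, @adj (star_graph A cs) u v = adj u v).
Proof.
have [lt|gt|eq] := ltngtP #|heavy| (q - 1).
- by have [A [Ac lt']] := dominate_few lt; exists A, (star_color i0); split; last left.
- have [|A [Ac lt']] := dominate_many; first by move: gt; clear; lia.
  by exists A, (star_color i0); split; last left.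
by exists heavy, (star_color i0); split; last exact: dominate_exact.
Qed.
End Dominate.

(** * From density to the core structure *)

Lemma dense_mul p D k (G : graph) : 0 < k -> dense p (D * k) G -> dense p D G.
Proof.
move=> k0 /forallP dG; apply/forallP => u.
rewrite -(leq_pmul2l k0) mulnDr; have := dG u.
have : p * #|G| <= k * (p * #|G|) by rewrite leq_pmull.
have -> : k * (D * (p - 1) * #|G|) = D * k * (p - 1) * #|G| by ring.
have -> : k * (D * p * degree u) = D * k * p * degree u by ring.
by lia.
Qed.

Lemma core_structure_exists p q h : 2 <= p -> 0 < q -> exists D N, 2 <= D /\
  forall G : graph, N <= #|G| -> dense p D G -> ~ config G p q h ->
  exists (c : G -> 'I_p) (B : {set G}) (e t : nat), core_structure q h e t c B.
Proof.
move=> p2 q0; have p0 : 0 < p by lia.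
(* With e = n / K and t = E e, the factor [E] gives [cs_et] and [K] gives [cs_t]. The set [B] is
   made smaller than e by the factor m = p + 1, since up to p errors add up in the bounds on part
   sizes and missing edges. *)
pose E := 2 ^ (p * q) * (1 + p * h + q) + 10 * p * q.
pose K := 1000 * p ^ 3 * q * E; pose m := p.+1; pose k := 2 * K * m.
have E0 : 0 < E by rewrite /E addn_gt0 !muln_gt0 p0 q0 orbT.
have K0 : 0 < K by rewrite /K !muln_gt0 ?expn_gt0 p0 q0 E0.
have k0 : 0 < k by rewrite /k muln_gt0 andbT muln_gt0 K0.
have [D0 [N0 [D2 D0E]]] := structure h p2 q0 k0.
exists (D0 * k), (N0 + K * (h + 2 * q + 1)); split.
  by apply: leq_trans D2 _; rewrite leq_pmulr.
move=> G NG dG nconf.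
have [|c [B [kB ind]]] := D0E G _ (dense_mul k0 dG) nconf.
  by apply: leq_trans NG; apply: leq_addr.
pose n := #|G|; pose e := n %/ K; exists c, B, e, (E * e).
have eh : h + 2 * q + 1 <= e.
  by rewrite leq_divRL // mulnC; apply: leq_trans NG; apply: leq_addl.
have Ke : K * e <= n by rewrite mulnC leq_divM.
have nK : n <= 2 * K * e.
  have := ltn_ceil n K0; rewrite -/e mulSn => lt; apply: ltnW (leq_trans lt _).
  have : K <= K * e by rewrite leq_pmulr //; move: eh; clear; lia.
  by rewrite [e * K]mulnC -mulnA; clear; lia.
have mB : m * #|B| <= e.
  have KK0 : 0 < 2 * K by rewrite muln_gt0 K0.
  rewrite -(leq_pmul2l KK0) mulnA; exact: leq_trans kB nK.
have BG : #|B| <= e by apply: leq_trans mB; rewrite leq_pmull.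
have degm (v : G) : m * (p - 1) * n <= m * p * degree v + p * e.
  have Dk0 : 0 < D0 * k by rewrite muln_gt0 k0 (ltnW D2).
  rewrite -(leq_pmul2l Dk0); have /forallP/(_ v) := dG; rewrite -/n => h1.
  have h2 : m * n <= D0 * k * e.
    have -> : D0 * k * e = D0 * (m * (2 * K * e)) by rewrite /k; ring.
    apply: leq_trans (leq_pmull _ (ltnW D2)).
    by rewrite leq_mul2l nK orbT.
  have h5 : m * (D0 * k * (p - 1) * n) <= m * (D0 * k * p * degree v + p * n).
    by rewrite leq_mul2l h1 orbT.
  have h6 : p * (m * n) <= p * (D0 * k * e) by rewrite leq_mul2l h2 orbT.
  have -> : D0 * k * (m * (p - 1) * n) = m * (D0 * k * (p - 1) * n) by ring.
  have -> : D0 * k * (m * p * degree v + p * e) =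
    m * (D0 * k * p * degree v) + p * (D0 * k * e) by ring.
  by move: h5 h6; rewrite mulnDr [m * (p * n)]mulnCA; lia.
pose cr := core c B.
have degc i v : v \in cr i -> degree v + #|cr i| <= n.
  move=> vc; rewrite -cardsUI (_ : _ :&: _ = set0) ?cards0 ?addn0 ?max_card //.
  apply/setP => w; rewrite !inE; apply/negP => /and3P[vw wB /eqP wi].
  move: vc; rewrite inE => /andP[vB /eqP vi].
  have := ind v w vB wB; rewrite vw => /(_ _)/negP; apply=> //.
  by apply: val_inj; rewrite /= vi wi.
have degc2 i j v : i != j -> v \in cr i -> degree v + #|cr i| + #|cr j :\: nbr v| <= n.
  move=> ij vc; rewrite -cardsUI (_ : _ :&: _ = set0); last first.
    apply/setP => w; rewrite !inE; apply/negP => /and3P[vw wB /eqP wi].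
    move: vc; rewrite inE => /andP[vB /eqP vi].
    have := ind v w vB wB; rewrite vw => /(_ _)/negP; apply=> //.
    by apply: val_inj; rewrite /= vi wi.
  rewrite cards0 addn0 -cardsUI (_ : _ :&: _ = set0) ?cards0 ?addn0 ?max_card //.
  apply/setP => w; rewrite !inE; apply/negP.
  move=> /andP[/orP[->//|/andP[_ /eqP wi]] /and3P[_ _ /eqP wj]].
  by rewrite -wi wj eqxx in ij.
have mp : m * (p - 1) + m = m * p by rewrite -mulnSr subn1 prednK.
(* A core vertex has no neighbour in its own part, so the minimum degree bounds that part from
   above. *)
have smallm i : i < p -> m * p * #|cr i| <= m * n + p * e.
  move=> ip; have [->|/set0Pn[v vc]] := eqVneq (cr i) set0.
    by rewrite cards0 muln0.
  have h1 := degm v; have h2 := degc i v vc.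
  have : m * p * (degree v + #|cr i|) <= m * p * n by rewrite leq_mul2l h2 orbT.
  by rewrite -{2}mp mulnDl mulnDr; move: h1; clear; lia.
have total : n = #|B| + \sum_(i < p) #|cr i|.
  rewrite /n -(cardsC B); congr addn.
  transitivity #|[set w in ~: B | predT w]|; first by apply: eq_card => w; rewrite !inE andbT.
  by rewrite -(sum_core_card c); apply: eq_bigr => i _; apply: eq_card => w; rewrite !inE andbT.
(* The other parts are small and [B] is negligible, which bounds each part from below. *)
have bigm i : i < p -> m * n <= m * p * #|cr i| + m * p * #|B| + p * (p - 1) * e.
  move=> ip; move: total; rewrite (bigD1 (Ordinal ip)) //= => tot.
  have h1 : \sum_(j < p | j != Ordinal ip) m * p * #|cr j| <= (p - 1) * (m * n + p * e).
    apply: (@leq_trans (\sum_(j < p | j != Ordinal ip) (m * n + p * e))).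
      by apply: leq_sum => j _; apply: smallm.
    by rewrite sum_nat_const cardC1 card_ord subn1.
  rewrite -big_distrr /= in h1; move: h1 tot; set s := \sum_(_ | _) _ => h1 tot.
  have h2 : m * p * n = m * p * (#|B| + (#|cr i| + s)) by rewrite tot.
  have h3 : (p - 1) * (m * n) + m * n = m * p * n.
    by rewrite -mp mulnDl [m * (p - 1)]mulnC mulnA.
  move: h1 h2 h3; rewrite !mulnDr; move: (m * p * n) (m * p * #|B|) (m * p * #|cr i|).
  move: (m * p * s) (m * n) => a b c1 c2 c3.
  have -> : (p - 1) * (p * e) = p * (p - 1) * e by ring.
  by clear; lia.
have m0 : 0 < m by [].
have pp : p * (p - 1) + p = p * p by rewrite -mulnSr subn1 prednK.
have Pe : popular_size p q h e <= (1 + p * h + q) * e.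
  rewrite /popular_size !mulnDl mul1n leq_add2r leq_add2r.
  by move: eh; clear; lia.
split=> //.
- move=> i j x ip jp ij xi.
  rewrite -(leq_pmul2l m0) -(leq_pmul2l p0) ![p * (m * _)]mulnA ![p * m]mulnC.
  have h1 := degm x; have h2 := bigm i ip; have h3 := degc2 i j x ij xi.
  have h4 : m * p * (degree x + #|cr i| + #|cr j :\: nbr x|) <= m * p * n.
    by rewrite leq_mul2l h3 orbT.
  have h5 : p * (m * #|B|) <= p * e by rewrite leq_mul2l mB orbT.
  have h6 : p * (p - 1) * e + p * e = p * p * e by rewrite -pp mulnDl.
  have h7 : m * (p - 1) * n + m * n = m * p * n by rewrite -mp mulnDl.
  have h8 : m * p * e = p * p * e + p * e by rewrite /m; ring.
  have h9 : m * p * #|B| = p * (m * #|B|) by ring.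
  move: h1 h2 h4 h5 h6 h7; rewrite h8 h9 !mulnDr.
  move: (m * p * degree x) (m * p * #|cr i|) (m * p * #|_ :\: _|) (p * (m * #|B|)).
  move: (m * p * n) (m * n) (m * (p - 1) * n) (p * e) (p * p * e) (p * (p - 1) * e).
  by clear; lia.
- move=> i ip; rewrite -(leq_pmul2l m0).
  have h2 := bigm i ip; have h5 : p * (m * #|B|) <= p * e by rewrite leq_mul2l mB orbT.
  have h6 : p * (p - 1) * e + p * e = p * p * e by rewrite -pp mulnDl.
  have h8 : m * (p * e) = p * p * e + p * e by rewrite /m; ring.
  have h9 : m * p * #|B| = p * (m * #|B|) by ring.
  rewrite mulnDr h8 [m * (p * #|_|)]mulnA -/n -/(cr i).
  move: h2 h5 h6; rewrite h9.
  move: (m * p * #|cr i|) (p * (m * #|B|)) (m * n) (p * e) (p * p * e) (p * (p - 1) * e).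
  by clear; lia.
- move=> i ip; rewrite -(leq_pmul2l m0).
  have := smallm i ip.
  have : p * e <= m * (p * e) by rewrite leq_pmull.
  by rewrite mulnDr !mulnA -/n -/(cr i); clear; lia.
- move=> v; rewrite -(leq_pmul2l m0); have := degm v.
  have : p * e <= m * (p * e) by rewrite leq_pmull.
  have : m * (p - 1) * n + m * n = m * p * n by rewrite -mp mulnDl.
  by rewrite !mulnDr !mulnA -/n; clear; lia.
- rewrite /E mulnDl leq_add2r -mulnA leq_mul2l Pe orbT //.
- by rewrite mulnA.
Qed.

(** * Weights and embeddings *)

Section PerronWeights.
Local Open Scope ring_scope.
Variables (G : graph) (p q h e t : nat) (c : G -> 'I_p) (B : {set G}).
Hypothesis CS : core_structure q h e t c B.
Let p2 := cs_p CS.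
Let q0 := cs_q CS.
Let r := rho G.
Let n : algR := #|G|%:R.
Hypothesis r_ge : n / 2 - 2 <= r.
Local Notation core := (core c B).

Let p0 : (0 < p)%N. Proof. by clear -p2; lia. Qed.
Let n0 : 0 < p%:R :> algR. Proof. by rewrite ltr0n. Qed.
Let nu : algR := n / p%:R.
Let nuE : nu * p%:R = n.
Proof. by rewrite /nu mulfVK // lt0r_neq0. Qed.

Let pe := (p ^ 2 * e)%N.

Let e_ge : 1 <= e%:R :> algR.
Proof. by rewrite ler1n; have := cs_e CS; clear; lia. Qed.

Let e_pe : 2 * (p * e)%:R <= pe%:R :> algR.
Proof.
rewrite -natrM ler_nat /pe expnS expn1 -mulnA leq_mul2r; apply/orP; right.
exact: p2.
Qed.

Let e_pe2 : 2 * e%:R <= (p * e)%:R :> algR.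
Proof. by rewrite -natrM ler_nat leq_mul2r p2 orbT. Qed.

Let n_big : 1000 * pe%:R <= n.
Proof.
rewrite -natrM ler_nat; apply: leq_trans (cs_t CS).
have et : (e <= t)%N.
  apply: leq_trans (cs_et CS); apply: leq_trans (leq_addl _ _).
  by rewrite leq_pmull // !muln_gt0 p0 q0.
have h1 : (p ^ 2 * e <= p ^ 3 * (q * t))%N.
  apply: leq_mul; first by rewrite leq_pexp2l.
  by apply: leq_trans et _; rewrite leq_pmull.
have -> : (1000 * p ^ 3 * q * t = 1000 * (p ^ 3 * (q * t)))%N by ring.
by rewrite leq_mul2l.
Qed.

Let nu_le : nu <= n / 2.
Proof.
have h1 : n * 2 <= n * p%:R by rewrite ler_wpM2l ?ler0n // ler_nat.
by rewrite ler_pdivrMr //; lra.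
Qed.

Let nu0 : 0 <= nu. Proof. by rewrite divr_ge0 // ler0n. Qed.

Let r_le : r <= n. Proof. exact: rho_le_card. Qed.

Let r_big : 300 * pe%:R <= r.
Proof.
have h1 := n_big; have h2 := e_pe; have h3 := e_pe2; have h4 := e_ge.
by have := r_ge; lra.
Qed.

Let cle (i : 'I_p) : #|core i|%:R <= nu + e%:R :> algR.
Proof.
rewrite -(ler_pM2r n0) mulrDl nuE -!natrM -natrD ler_nat.
by rewrite ![(_ * p)%N]mulnC; apply: (cs_small CS).
Qed.

Let cge (i : 'I_p) : nu - e%:R <= #|core i|%:R :> algR.
Proof.
rewrite -(ler_pM2r n0) mulrBl nuE lerBlDr -!natrM -natrD ler_nat.
by rewrite ![(_ * p)%N]mulnC; apply: (cs_big CS).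
Qed.

Section Eigenvector.
Variable y : G -> algR.
Hypothesis y0 : forall v, 0 <= y v.
Hypothesis yE : forall u, \sum_(v | adj u v) y v = r * y u.
Let S := \sum_(v in ~: B) y v.
Let Si i := \sum_(v in core i) y v.
Hypothesis SE : S = r + nu.

Let BB : #|B|%:R <= e%:R :> algR.
Proof. by rewrite ler_nat; apply: (cs_B CS). Qed.

Let sum_le (M : algR) (X : {set G}) :
  (forall v, y v <= M) -> \sum_(v in X) y v <= #|X|%:R * M.
Proof. by move=> yM; rewrite mulr_natl -sumr_const; apply: ler_sum. Qed.

(** At a maximal entry M the eigenvalue equation gives r M <= S + e M, so M is at most (r + nu) / (r
    - e), where nu <= n/2 is at most about r. *)
Lemma weight_le3 v : y v <= 3.
Proof.
pose w := [arg max_(u > v) y u]%O.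
have wmax u : y u <= y w by rewrite /w; case: arg_maxP => //= i _ /(_ u); apply.
apply: le_trans (wmax v) _; set M := y w in wmax *.
have M0 : 0 <= M by apply: y0.
have h1 : r * M <= S + e%:R * M.
  rewrite -yE.
  apply: (@le_trans _ _ (\sum_u y u)).
    by rewrite [leRHS](bigID (adj w)) /= ler_wpDr ?sumr_ge0.
  rewrite (bigID (mem B)) /= addrC lerD //.
    by rewrite /S le_eqVlt; apply/orP; left; apply/eqP; apply: eq_bigl => u; rewrite inE.
  by apply: le_trans (sum_le B wmax) _; rewrite ler_wpM2r.
have h2 := r_big; have h3 := nu_le; have h4 := e_pe; have h5 := e_pe2; have h6 := e_ge.
have h7 := r_ge; have h8 := n_big.
rewrite leNgt; apply/negP => M3.
have h9 : (r - e%:R) * 3 < (r - e%:R) * M by rewrite ltr_pM2l //; lra.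
rewrite SE in h1; lra.
Qed.

Let S_split (f : G -> algR) : \sum_(v in ~: B) f v = \sum_(i < p) \sum_(v in core i) f v.
Proof.
rewrite (partition_big c predT) //=; apply: eq_bigr => i _; apply: eq_bigl => v.
by rewrite !inE val_eqE.
Qed.

Let eta : algR := 3 * (p * e)%:R.

(** The error is made up of at most e vertices of [B] and at most e missing neighbours in each of
    the p - 1 other parts, each of weight at most 3. *)
Lemma weight_core_eq (i : 'I_p) v : v \in core i ->
  S - Si i - eta <= r * y v <= S - Si i + eta.
Proof.
move=> vi; rewrite -yE.
have vB : v \notin B by move: vi; rewrite inE => /andP[].
have nb w : w \in core i -> ~~ adj v w.
  move: vi; rewrite !inE => /andP[_ /eqP vi] /andP[wB /eqP wi].
  by apply: (cs_ind CS) => //; apply: val_inj; rewrite /= vi wi.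
have -> : \sum_(w | adj v w) y w = \sum_(w in B | adj v w) y w +
    \sum_(w in ~: B | adj v w) y w.
  rewrite (bigID (mem B)) /=; congr (_ + _); apply: eq_bigl => w; rewrite ?inE;
  by rewrite andbC.
have Bl : 0 <= \sum_(w in B | adj v w) y w by apply: sumr_ge0.
have Bu : \sum_(w in B | adj v w) y w <= 3 * e%:R.
  apply: (@le_trans _ _ (\sum_(w in B) y w)).
    by rewrite [leRHS](bigID (adj v)) /= ler_wpDr ?sumr_ge0.
  by apply: le_trans (sum_le B weight_le3) _; rewrite mulrC ler_wpM2l.
have SSi : S - Si i = \sum_(j < p | j != i) Si j.
  by rewrite /S S_split (bigD1 i) //= addrAC subrr add0r.
have Nd : \sum_(w in ~: B | adj v w) y w =
    \sum_(j < p | j != i) \sum_(w in core j | adj v w) y w.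
  rewrite big_mkcondr S_split (bigD1 i) //= big1 ?add0r => [|w wi].
    by apply: eq_bigr => j _; rewrite -big_mkcondr.
  by rewrite (negPf (nb w wi)).
have Nu : \sum_(w in ~: B | adj v w) y w <= S - Si i.
  rewrite Nd SSi; apply: ler_sum => j _.
  by rewrite /Si [leRHS](bigID (adj v)) /= ler_wpDr ?sumr_ge0.
have Nl : S - Si i - 3 * ((p - 1) * e)%:R <= \sum_(w in ~: B | adj v w) y w.
  rewrite Nd SSi lerBlDr.
  have -> : 3 * ((p - 1) * e)%:R = \sum_(j < p | j != i) 3 * e%:R :> algR.
    by rewrite sumr_const cardC1 card_ord subn1 natrM -mulr_natl; ring.
  rewrite -big_split /=; apply: ler_sum => j ji.
  rewrite /Si (bigID (adj v)) /= lerD2l.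
  rewrite (eq_bigl (fun w => w \in core j :\: nbr v)); last first.
    by move=> w; rewrite !inE andbC.
  apply: le_trans (sum_le _ weight_le3) _; rewrite mulrC ler_wpM2l // ler_nat.
  by apply: (cs_miss CS (ltn_ord i) (ltn_ord j) _ vi); rewrite eq_sym.
have e1 : (p * e)%:R = ((p - 1) * e)%:R + e%:R :> algR.
  by rewrite -natrD -mulSnr subn1 prednK.
by apply/andP; split; rewrite /eta; lra.
Qed.

(** Summing [weight_core_eq] over the part gives Si close to N S / (r + N), so each entry is close
    to S / (r + N); by the normalisation S = r + nu this is nearly 1, as N differs from nu by at
    most e. *)
Lemma weight_core v : v \notin B ->
  1 - (20 * p%:R)^-1 <= y v <= 1 + (20 * p%:R)^-1.
Proof.
move=> vB; set i := c v.
have vi : v \in core i by rewrite inE vB eqxx.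
have /andP[l1 u1] := weight_core_eq vi.
set N : algR := #|core i|%:R.
have NE : N = \sum_(w in core i) 1 by rewrite sumr_const.
have u2 : r * Si i <= N * (S - Si i + eta).
  rewrite NE mulr_suml mulr_sumr; apply: ler_sum => w /weight_core_eq/andP[_].
  by rewrite mul1r.
have l2 : N * (S - Si i - eta) <= r * Si i.
  rewrite NE mulr_suml mulr_sumr; apply: ler_sum => w /weight_core_eq/andP[+ _].
  by rewrite mul1r.
have N1 := cle i; have N2 := cge i; rewrite -/N in N1 N2.
have Nn : 0 <= N by rewrite ler0n.
have r0 : 0 < r by have := r_big; have := e_pe; have := e_pe2; have := e_ge; lra.
have rN : 0 < r + N by lra.
have h4 := e_pe; have h5 := e_pe2; have h6 := e_ge; have h7 := r_big.
have b1 : 7 * (p * e)%:R <= r * (20 * p%:R)^-1 :> algR.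
  rewrite ler_pdivlMr ?mulr_gt0 //.
  have -> : 7 * (p * e)%:R * (20 * p%:R) = 140 * pe%:R :> algR.
    by rewrite /pe expnS expn1 !natrM; ring.
  by lra.
have b2 : e%:R + 2 * eta <= r * (20 * p%:R)^-1 by rewrite /eta; lra.
have b3 : (e%:R + 2 * eta) * (r + N) <= r * (20 * p%:R)^-1 * (r + N).
  by rewrite ler_pM2r.
have re : 0 <= r * (nu + e%:R - N) by apply: mulr_ge0; lra.
have re2 : 0 <= r * (N - (nu - e%:R)) by apply: mulr_ge0; lra.
have l3 : (S - Si i - eta) * (r + N) <= r * y v * (r + N) by rewrite ler_pM2r.
have u3 : r * y v * (r + N) <= (S - Si i + eta) * (r + N) by rewrite ler_pM2r.
have eN : 0 <= e%:R * N by rewrite mulr_ge0.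
have er : 0 <= eta * r by apply: mulr_ge0; lra.
have rS : r * S = r * (r + nu) by rewrite SE.
have rrN : 0 < r * (r + N) by rewrite mulr_gt0.
apply/andP; split.
  rewrite -(ler_pM2l rrN).
  have -> : r * (r + N) * (1 - (20 * p%:R)^-1) =
    r * (r + N) - r * (20 * p%:R)^-1 * (r + N) by ring.
  by lra.
rewrite -(ler_pM2l rrN).
have -> : r * (r + N) * (1 + (20 * p%:R)^-1) =
  r * (r + N) + r * (20 * p%:R)^-1 * (r + N) by ring.
by lra.
Qed.

(** The vertex has almost n - n/p >= n/2 neighbours off [B], each of weight at least 39/40, while r
    is at most n. *)
Lemma weight_ge v : 1 / 3 <= y v.
Proof.
have h4 := e_pe; have h5 := e_pe2; have h6 := e_ge; have h7 := r_big.
have r0 : 0 < r by lra.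
rewrite -(ler_pM2l r0) -yE.
have tp : (20 * p%:R)^-1 <= 1 / 40 :> algR.
  rewrite mul1r lef_pV2 ?posrE ?mulr_gt0 //.
  have : 2 <= p%:R :> algR by rewrite ler_nat.
  by lra.
apply: (@le_trans _ _ (\sum_(w | adj v w) (w \notin B)%:R * (39 / 40))); last first.
  apply: ler_sum => w _; have [wB|wB] := boolP (w \in B); first by rewrite mul0r.
  by have /andP[w1 _] := weight_core wB; rewrite mul1r; lra.
rewrite -mulr_suml.
have d1 : n - nu - 2 * e%:R <= \sum_(w | adj v w) (w \notin B)%:R.
  have d2 : n - nu - e%:R <= (degree v)%:R :> algR.
    rewrite -(ler_pM2r n0) !mulrBl nuE.
    have := cs_deg CS v; rewrite -(ler_nat algR) !natrD !natrM -/n; lra.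
  have d3 : (degree v)%:R <= \sum_(w | adj v w) (w \notin B)%:R + #|B|%:R :> algR.
    rewrite -[#|B|%:R]sumr_const degreeE natr_sum.
    have -> : \sum_(w in B) (1 : algR) = \sum_w (w \in B)%:R.
      by rewrite big_mkcond; apply: eq_bigr => w _; case: (w \in B).
    rewrite [X in _ + X](bigID (adj v)) /= addrA ler_wpDr ?sumr_ge0 // -big_split /=.
    by apply: ler_sum => w _; case: (w \in B); rewrite /= ?add0r ?addr0.
  by have := BB; lra.
have d4 : (n - nu - 2 * e%:R) * (39 / 40) <= (\sum_(w | adj v w) (w \notin B)%:R) * (39 / 40).
  by rewrite ler_wpM2r //; lra.
apply: le_trans d4.
have h1 := nu_le; have h2 := n_big; have h3 := r_le.
by lra.
Qed.
End Eigenvector.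

Lemma perron_weights : exists y : G -> algR,
  [/\ forall u, \sum_(v | adj u v) y v = r * y u,
      forall v, 1 / 3 <= y v <= 3 &
      forall v, v \notin B -> 1 - (20 * p%:R)^-1 <= y v <= 1 + (20 * p%:R)^-1].
Proof.
have h4 := e_pe; have h5 := e_pe2; have h6 := e_ge; have h7 := r_big; have h8 := n_big.
have G0 : (0 < #|G|)%N by rewrite -(ltr_nat algR) -/n; lra.
have [x [x0 [w xw] xE]] := perron G0.
pose S := \sum_(v in ~: B) x v.
have S0 : 0 <= S by apply: sumr_ge0.
have Spos : 0 < S.
  (* A vector supported on [B] would force r <= e at its maximal entry. *)
  rewrite lt_def S0 andbT; apply/negP => /eqP Sz.
  have xB v : v \notin B -> x v = 0.
    by move=> vB; apply: (psumr_eq0P _ Sz) => //; rewrite inE.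
  pose z := [arg max_(u > w) x u]%O.
  have zmax u : x u <= x z by rewrite /z; case: arg_maxP => //= i _ /(_ u); apply.
  have z0 : 0 < x z by apply: lt_le_trans (zmax w); rewrite lt_def xw x0.
  have : r * x z <= e%:R * x z.
    rewrite /r -xE; apply: (@le_trans _ _ (\sum_(v in B) x v)).
      rewrite big_mkcond [leRHS]big_mkcond; apply: ler_sum => v _.
      have [vB|vB] := boolP (v \in B); first by case: ifP.
      by rewrite xB //; case: ifP.
    apply: (@le_trans _ _ (#|B|%:R * x z)).
      by rewrite mulr_natl -sumr_const; apply: ler_sum.
    by rewrite ler_wpM2r // ler_nat; apply: (cs_B CS).
  by rewrite ler_pM2r //; lra.
(* In a star graph a vertex of a part of size nu has weight S / (r + nu), so this scaling makes
   typical weights 1. *)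
pose k := (r + nu) / S.
have k0 : 0 <= k by rewrite divr_ge0 //; have := nu0; lra.
pose y v := k * x v.
have y0 v : 0 <= y v by rewrite mulr_ge0.
have yE u : \sum_(v | adj u v) y v = r * y u.
  by rewrite -mulr_sumr xE /y /r; ring.
have SE : \sum_(v in ~: B) y v = r + nu.
  by rewrite -mulr_sumr -/S /k mulfVK // lt0r_neq0.
exists y; split=> // v.
  by rewrite (weight_ge y0 yE SE) (weight_le3 y0 yE SE).
exact: (weight_core y0 yE SE).
Qed.
End PerronWeights.

(** * Extremality among dense graphs *)

Section DenseExtremal.
Local Open Scope ring_scope.

Lemma dense_spectral p q h : (2 <= p)%N -> (0 < q)%N ->
  exists D N, (2 <= D)%N /\ forall G, ~ config G p q h -> (N <= #|G|)%N -> dense p D G ->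
    rho (H_join p (q - 1) (#|G| - (q - 1))) <= rho G ->
    iso G (H_join p (q - 1) (#|G| - (q - 1))).
Proof.
move=> p2 q0; have p0 : (0 < p)%N by lia.
have [D [N [D2 DE]]] := core_structure_exists h p2 q0.
exists D, (N + (q + 6))%N; split=> // G nconf NG dG HG.
have [|c [B [e [t CS]]]] := DE G _ dG nconf.
  by apply: leq_trans NG; apply: leq_addr.
have G6 : 6 <= #|G|%:R :> algR.
  by rewrite ler_nat; move: NG; clear; lia.
have qG : (q - 1 <= #|G|)%N by move: NG; clear; lia.
have ip : (p%:R^-1 : algR) * #|G|%:R <= 1 / 2 * #|G|%:R.
  by rewrite ler_wpM2r // mul1r lef_pV2 ?posrE ?ltr0n // ler_nat.
have r_ge : #|G|%:R / 2 - 2 <= rho G.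
  apply: le_trans HG.
  have h1 : 0 < #|G|%:R :> algR by lra.
  have := @rho_H_ge_lin p (q - 1) (#|G| - (q - 1)) p0.
  by rewrite subnKC // -(ltr_nat algR) => /(_ h1); lra.
have [y [yE y3 yB]] := perron_weights CS r_ge.
have y0 v : 0 < y v by have /andP[h1 _] := y3 v; lra.
have [A [cs [Ac dom]]] := star_dominates CS y3 yB.
have Vn : #|G| = (q - 1 + (#|G| - (q - 1)))%N.
  by rewrite subnKC // -Ac max_card.
case: dom => [lt|adjE]; last first.
  have iGs : iso G (star_graph A cs) by exists id => //; exists id.
  apply: (iso_trans iGs); apply: (star_rho_eq p0 Ac Vn).
    by rewrite -(iso_rho iGs); lra.
  by rewrite -(iso_rho iGs).
have qy : qform y = rho G * \sum_u y u ^+ 2.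
  rewrite /qform mulr_sumr; apply: eq_bigr => u _.
  by rewrite -mulr_sumr yE; ring.
(* A strict gain would give rho G < rho (star) <= rho H <= rho G. *)
have := lt_le_trans lt (@rayleigh (star_graph A cs) y); rewrite qy.
have [u _] : exists u : G, true.
  by apply/card_gt0P; rewrite -(ltr_nat algR); lra.
have S0 : 0 < \sum_u y u ^+ 2.
  rewrite (bigD1 u) //= ltr_wpDr ?exprn_gt0 // sumr_ge0 // => v _.
  by rewrite exprn_ge0 // ltW.
rewrite ltr_pM2r // ltNge => /negP[].
by apply: le_trans HG; apply: star_rho_le.
Qed.

Lemma qform1 (R : realFieldType) (G : graph) : @qform R G (fun=> 1) = (arcs G)%:R.
Proof.
rewrite /arcs natr_sum; apply: eq_bigr => u _; rewrite degreeE natr_sum.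
by apply: eq_bigr => v _; rewrite mulr1.
Qed.

Lemma dense_arcs p q h : (2 <= p)%N -> (0 < q)%N ->
  exists D N, (2 <= D)%N /\ forall G, ~ config G p q h -> (N <= #|G|)%N -> dense p D G ->
    (arcs G <= arcs (H_join p (q - 1) (#|G| - (q - 1))))%N.
Proof.
move=> p2 q0; have p0 : (0 < p)%N by lia.
have [D [N [D2 DE]]] := core_structure_exists h p2 q0.
exists D, N; split=> // G nconf NG dG.
have [c [B [e [t CS]]]] := DE G NG dG nconf.
have [|v _|A [cs [Ac dom]]] := @star_dominates rat _ _ _ _ _ _ _ _ (fun=> 1) CS.
- by move=> v; lra.
- by rewrite lerBlDr lerDl andbb invr_ge0 mulr_ge0.
have Vn : #|G| = (q - 1 + (#|G| - (q - 1)))%N.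
  by rewrite subnKC // -Ac max_card.
apply: leq_trans (star_arcs_le cs p0 Ac Vn).
case: dom => [|adjE]; last first.
  have iGs : iso G (star_graph A cs) by exists id => //; exists id.
  by rewrite (iso_arcs iGs).
by rewrite (qform1 rat G) (qform1 rat (star_graph A cs)) ltr_nat => /ltnW.
Qed.
End DenseExtremal.

(** * Embedding a critical member into a configuration *)

Section Embedding.
Variables (p q : nat) (H : graph) (c : H -> 'I_p.+1).
Hypotheses (p_gt0 : 0 < p) (c_proper : proper_coloring c).
Let I := induced [set x | c x < 2].
Hypothesis I_indep : independent_edges q I.
Variables (G : graph) (M : seq (G * G)) (j0 : nat) (S : nat -> {set G}) (x0 : G).
Hypotheses (Mq : size M = q) (Mm : matching M) (j0p : j0 < p).
Hypothesis Sh : forall j, j < p -> #|H| <= #|S j|.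
Hypothesis Sc : complete_to S p.
Hypothesis MS : forall j x y, j < p -> j != j0 -> x \in ends M -> y \in S j -> adj x y.
Hypothesis MS0 : forall x, x \in ends M -> x \notin S j0.

(** The place of x is its rank in the whole of [H], so the copies of different colour classes in one
    part never collide. The default is not reached, since each part has at least [#|H|] vertices. *)
Let s j (x : H) : G := nth x0 (enum (S j)) (enum_rank x).

Let s_in j x : j < p -> s j x \in S j.
Proof.
move=> jp; rewrite -mem_enum mem_nth // -cardE.
exact: leq_trans (ltn_ord _) (Sh jp).
Qed.

Let s_inj i j x y : i < p -> j < p -> s i x = s j y -> i = j /\ x = y.
Proof.
move=> ip jp e; have ij : i = j.
  apply/eqP; apply: contraT => ij.
  have := complete_disjoint Sc ip jp ij (s_in x ip).
  by rewrite e s_in.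
split=> //; move: e; rewrite ij => /eqP.
rewrite nth_uniq ?enum_uniq -?cardE ?(leq_trans (ltn_ord _) (Sh jp)) //.
by move/eqP/ord_inj/enum_rank_inj.
Qed.

(* The part receiving the colour class of x. *)
Let cls x : nat := bump j0 (c x - 2).

Let cls_lt x : 2 <= c x -> cls x < p.
Proof. by rewrite /cls /bump; have := ltn_ord (c x); case: leqP; move: j0p; clear; lia. Qed.

Let cls_neq x : cls x != j0.
Proof. by rewrite eq_sym neq_bump. Qed.

Let cls_inj x y : 2 <= c x -> 2 <= c y -> cls x = cls y -> c x = c y.
Proof.
move=> cx cy /(can_inj (bumpK j0)) e; apply: val_inj => /=.
by move: e cx cy; clear; lia.
Qed.

Let edge_index (u v : I) : nat := index [set u; v] (enum (edges I)).

Let edge_index_lt u v : adj u v -> edge_index u v < q.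
Proof.
move=> uv; have [_ <-] := I_indep; rewrite cardE index_mem mem_enum.
by rewrite mem_edges.
Qed.

Let side (b : bool) k : G := nth x0 (if b then unzip1 M else unzip2 M) k.

Let side_in b k : k < q -> side b k \in ends M.
Proof.
move=> kq; rewrite mem_cat /side; case: b; rewrite mem_nth ?orbT ?size_map ?Mq //.
Qed.

Let side_inj b b' k k' : k < q -> k' < q -> side b k = side b' k' -> b = b' /\ k = k'.
Proof.
have := Mm; rewrite /matching /ends cat_uniq => /andP[/and3P[u1 /hasPn dis u2] _].
rewrite /side => kq kq'; case: b; case: b' => e.
- by split=> //; apply/eqP; rewrite -(nth_uniq x0 _ _ u1) ?size_map ?Mq // e.
- by have := dis (nth x0 (unzip2 M) k'); rewrite mem_nth ?size_map ?Mq //=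
    -e mem_nth ?size_map ?Mq // => /(_ isT).
- by have := dis (nth x0 (unzip2 M) k); rewrite mem_nth ?size_map ?Mq //=
    e mem_nth ?size_map ?Mq // => /(_ isT).
- by split=> //; apply/eqP; rewrite -(nth_uniq x0 _ _ u2) ?size_map ?Mq // e.
Qed.

Let side_adj k : k < q -> adj (side true k) (side false k).
Proof.
move=> kq; have /andP[_ /allP a] := Mm.
have := a (nth (x0, x0) M k); rewrite mem_nth ?Mq // => /(_ isT).
by rewrite /side /unzip1 /unzip2 !(nth_map (x0, x0)) ?Mq.
Qed.

(** The k-th edge between the first two colour classes goes to the k-th edge of [M], oriented by
    colour; the isolated vertices of these classes go to the part j0, and the other classes to the
    remaining parts. *)
Let f (x : H) : G :=
  if (insub x : option {z : H | z \in [set z | c z < 2]}) is Some u then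
    if [pick v : I | @adj I u v] is Some v then side (c x == 0 :> nat) (edge_index u v)
    else s j0 x
  else s (cls x) x.

Inductive embed_spec (x : H) : G -> Type :=
| EmbedPart of 2 <= c x : embed_spec x (s (cls x) x)
| EmbedEdge (u v : I) of sval u = x & adj u v :
    embed_spec x (side (c x == 0 :> nat) (edge_index u v))
| EmbedIsolated (u : I) of sval u = x & (forall v, ~~ adj u v) : embed_spec x (s j0 x).

Lemma embedP x : embed_spec x (f x).
Proof.
rewrite /f; case: insubP => [u _ ux|]; last first.
  by rewrite inE -leqNgt => cx; constructor.
case: pickP => [v uv|none]; first by constructor.
by apply: (@EmbedIsolated x u ux) => v; rewrite none.
Qed.

Let I_color (u : I) : c (sval u) < 2.
Proof. by have := valP u; rewrite inE. Qed.

Let I_uniq (u v w : I) : adj u v -> adj u w -> v = w.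
Proof.
have [deg _] := I_indep; have := deg u; rewrite /degree => d uv uw.
by apply: (card_le1_eqP d); rewrite inE.
Qed.

Let I_side (u v : I) : adj u v -> (c (sval u) == 0 :> nat) = ~~ (c (sval v) == 0 :> nat).
Proof.
move=> uv; have := c_proper (uv : adj (sval u) (sval v)).
have := I_color u; have := I_color v; rewrite -val_eqE /=.
by case: (nat_of_ord (c (sval u))) (nat_of_ord (c (sval v))) => [|[|?]] [|[|?]].
Qed.

Lemma subgraph_of_config_parts : subgraph H G.
Proof.
exists f.
  move=> x y; case: (embedP x) => [cx|u v ux uv|u ux nu];
    case: (embedP y) => [cy|u' v' uy uv'|u' uy nu'].
  - by case/(s_inj (cls_lt cx) (cls_lt cy)).
  - move=> e; have := MS (cls_lt cx) (cls_neq x) (side_in (c y == 0 :> nat) (edge_index_lt uv'))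
      (s_in x (cls_lt cx)).
    by rewrite e adj_irr.
  - by case/(s_inj (cls_lt cx) j0p).
  - move=> e; have := MS (cls_lt cy) (cls_neq y) (side_in (c x == 0 :> nat) (edge_index_lt uv))
      (s_in y (cls_lt cy)).
    by rewrite e adj_irr.
  - move=> e; have [eb ek] := side_inj (edge_index_lt uv) (edge_index_lt uv') e.
    have es : [set u; v] = [set u'; v'].
      by move: ek; apply: (index_inj set0); rewrite mem_enum mem_edges.
    have : u \in [set u'; v'] by rewrite -es set21.
    rewrite !inE => /orP[]/eqP eu; first by rewrite -ux -uy eu.
    have := I_side uv'; rewrite -eu uy -eb -ux.
    by case: (_ == _).
  - move=> e; have := MS0 (side_in (c x == 0 :> nat) (edge_index_lt uv)).
    by rewrite e s_in.
  - by case/(s_inj j0p (cls_lt cy)).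
  - move=> e; have := MS0 (side_in (c y == 0 :> nat) (edge_index_lt uv')).
    by rewrite -e s_in.
  - by case/(s_inj j0p j0p).
move=> x y xy; case: (embedP x) => [cx|u v ux uv|u ux nu];
    case: (embedP y) => [cy|u' v' uy uv'|u' uy nu'].
- apply: (Sc (cls_lt cx) (cls_lt cy)); rewrite ?s_in ?cls_lt //.
  by apply: contraNneq (c_proper xy) => /(cls_inj cx cy) ->.
- rewrite adj_sym; apply: (MS (cls_lt cx) (cls_neq x)); last exact: s_in (cls_lt cx).
  exact: side_in (edge_index_lt uv').
- by apply: (Sc (cls_lt cx) j0p (cls_neq x)); rewrite s_in ?cls_lt.
- apply: (MS (cls_lt cy) (cls_neq y)); last exact: s_in (cls_lt cy).
  exact: side_in (edge_index_lt uv).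
- have uu' : @adj I u u' by move: xy; rewrite -ux -uy.
  have ev : v = u' := I_uniq uv uu'.
  have ev' : v' = u by apply: I_uniq uv' _; rewrite adj_sym.
  have ee : edge_index u' v' = edge_index u v by rewrite /edge_index ev ev' setUC.
  have lt := edge_index_lt uv; rewrite ee -ux -uy (I_side uu').
  by case: (c (sval u') == 0 :> nat) => /=; [rewrite adj_sym|]; apply: side_adj.
- by case/negP: (nu' u); move: xy; rewrite adj_sym -ux -uy.
- by apply: (Sc j0p (cls_lt cy)); rewrite ?s_in ?cls_lt // eq_sym.
- by case/negP: (nu u'); move: xy; rewrite -ux -uy.
- by case/negP: (nu u'); move: xy; rewrite -ux -uy.
Qed.
End Embedding.

Lemma subgraph_of_config p q (H G : graph) (c : H -> 'I_p.+1) :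
  0 < p -> proper_coloring c -> independent_edges q (induced [set x | c x < 2]) ->
  config G p q #|H| -> subgraph H G.
Proof.
move=> p0 cp ie [M [j0 [S [Mq Mm j0p Sh [Sc MS MS0]]]]].
(* For empty [H] the parts may be empty, so no default vertex is at hand. *)
have [H0|H0] := posnP #|H|.
  have no (x : H) : False by have := max_card (pred1 x); rewrite H0 card1.
  by exists (fun x => False_rect _ (no x)) => x; case: (no x).
have /card_gt0P[x0 _] : 0 < #|S j0| by apply: leq_trans (Sh j0 j0p).
exact: (subgraph_of_config_parts cp ie x0 Mq Mm j0p Sh Sc MS MS0).
Qed.

(** * Critical families *)

Section MinNat.

Lemma min_natP (P : nat -> Prop) k : P k -> P (min_nat P) /\ min_nat P <= k.
Proof.
move=> Pk; have : exists m, P m /\ forall j, P j -> m <= j.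
  have ex : exists m, (if excluded_middle_informative (P m) then true else false).
    by exists k; case: excluded_middle_informative.
  exists (ex_minn ex); case: ex_minnP => m; case: excluded_middle_informative => // Pm _ mP.
  split=> // j Pj; apply: mP; by case: excluded_middle_informative.
move=> ex; have := epsilon_spec (inhabits 0) _ ex.
by rewrite -/(min_nat P) => -[? lek]; split=> //; apply: lek.
Qed.

Lemma min_nat_eq (P : nat -> Prop) k : P k -> (forall j, P j -> k <= j) -> min_nat P = k.
Proof.
move=> Pk kP; have [Pm mk] := min_natP Pk.
by apply/eqP; rewrite eqn_leq mk kP.
Qed.

Lemma chi_le (G : graph) k : colorable G k -> chi G <= k.
Proof. by move=> Gk; have [] := min_natP Gk. Qed.

End MinNat.

Section CriticalFamily.
Variables (q p : nat) (F : graph_family).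
Hypotheses (hq : 1 <= q) (hp : 2 <= p) (hpF : p_of F = p) (hF : color_critical q F).

Lemma superset_of_card (K : graph) (A : {set K}) k : #|A| <= k -> k <= #|K| ->
  exists2 C : {set K}, A \subset C & #|C| = k.
Proof.
move=> Ak kT; have [|Y YA Yk] := @exists_subset K (~: A) (k - #|A|).
  by rewrite [leqRHS]cardsCs setCK leq_sub2r.
exists (A :|: Y); first exact: subsetUl.
rewrite cardsU Yk [A :&: Y](_ : _ = set0) ?cards0 ?subn0 ?subnKC //.
apply/setP => x; rewrite !inE; apply/negP => /andP[xA /(subsetP YA)].
by rewrite inE xA.
Qed.

(** A smaller set whose removal leaves a p-colourable graph is enlarged to exactly q - 1 vertices,
    the only size criticality speaks of; this is possible because members have at least q - 1
    vertices. *)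
Lemma transversal_ge (K : graph) (S : {set K}) (col : K -> 'I_p) : F K ->
  (forall x y, x \notin S -> y \notin S -> adj x y -> col x != col y) -> q <= #|S|.
Proof.
move=> FK colS; rewrite leqNgt; apply/negP => Sq.
have [_ _ crit _] := hF; have [qK chiK] := crit K FK.
have [|S' SS' S'q] := superset_of_card (_ : #|S| <= q - 1) qK; first by move: Sq; clear; lia.
have := chiK S' S'q; rewrite hpF leqNgt => /negP; apply; rewrite ltnS.
apply: chi_le; exists (fun x => col (val x)) => x y xy.
apply: colS => //.
  by have := valP x; rewrite inE; apply: contra; apply: (subsetP SS').
by have := valP y; rewrite inE; apply: contra; apply: (subsetP SS').
Qed.

(** The vertices sent to the complete part number at most q - 1, and the residues of the Turán part
    colour the rest. *)
Lemma H_join_avoids m : avoids F (H_join p (q - 1) m).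
Proof.
move=> K FK [f finj fadj].
have p0 : 0 < p by lia.
pose S := [set x | if f x is inl _ then true else false].
pose col x := Ordinal (ltn_pmod (if f x is inr j then j : nat else 0) p0).
have : q <= #|S|.
  apply: (@transversal_ge K S col FK) => x y; rewrite !inE /col => + + /fadj.
  by case: (f x) => // i _; case: (f y) => // j _.
rewrite leqNgt => /negP; apply.
apply: (@leq_ltn_trans (q - 1)); last by move: hq; clear; lia.
rewrite -(card_imset _ finj).
apply: (@leq_trans #|[set inl i | i in [set: 'I_(q - 1)]] : {set 'I_(q - 1) + 'I_m}|).
  apply: subset_leq_card; apply/subsetP => z /imsetP[x]; rewrite inE => + ->.
  by case: (f x) => // i _; rewrite imset_f ?inE.
by apply: leq_trans (leq_imset_card _ _) _; rewrite cardsT card_ord.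
Qed.

Lemma decomposes_cover_ge (M : graph) (C : {set M}) :
  decomposes F M -> vertex_cover C -> q <= #|C|.
Proof.
move=> [K FK [t [f finj fadj]]] cov.
pose S := [set x | if f x is inl (inl m) then m \in C else false].
have p1 : 0 < p_of F - 1 by rewrite hpF; lia.
have pE : p = (p_of F - 1).+1 by rewrite hpF; lia.
(* Outside the cover, the vertices in M and in the edgeless part share colour 0; the p - 1 Turán
   classes get the other colours. *)
pose col x : 'I_p := cast_ord (esym pE)
  (if f x is inr j then lift ord0 (Ordinal (ltn_pmod j p1)) else ord0).
apply: (@leq_trans #|S|).
  apply: (@transversal_ge K S col FK) => x y; rewrite !inE /col => + + /fadj.
  case: (f x) => [[m|i]|j]; case: (f y) => [[m'|i']|j'] //=.
  by move=> /negPf mC /negPf mC' mm; have := cov _ _ mm; rewrite mC mC'.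
pose g (x : K) : option M := if f x is inl (inl m) then Some m else None.
have someI : injective (@Some (vertex M)) by move=> a b [].
rewrite -(card_imset _ someI).
have gS : {in S &, injective g}.
  move=> x y; rewrite !inE /g => xS yS e; apply: finj; move: xS yS e.
  by case: (f x) => [[m|?]|?] //; case: (f y) => [[m'|?]|?] // _ _ [->].
rewrite -(card_in_imset gS); apply: subset_leq_card.
apply/subsetP => z /imsetP[x]; rewrite inE /g => + ->.
by case: (f x) => [[m|?]|?] // mC; apply: imset_f.
Qed.

Definition matching_adj : rel ('I_q * bool) := fun u v => (u.1 == v.1) && (u.2 != v.2).
Fact matching_sym : symmetric matching_adj.
Proof. by move=> u v; rewrite /matching_adj eq_sym [u.2 == _]eq_sym. Qed.
Fact matching_irr : irreflexive matching_adj.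
Proof. by move=> u; rewrite /matching_adj !eqxx. Qed.
Definition matching_graph : graph := Graph matching_sym matching_irr.

(** The join is itself a configuration: the edgeless vertices form the part 0 around the matching,
    and the Turán classes have exactly t vertices, enough for the whole member. *)
Lemma matching_graph_decomposes : decomposes F matching_graph.
Proof.
have [_ _ _ [K FK [c cp ie]]] := hF; exists K => //; exists #|K|; move: c cp ie.
rewrite hpF => c cp ie; set t := #|K|; set G := join _ _.
have p0 : 0 < p by lia.
have p1 : 0 < p - 1 by lia.
apply: (subgraph_of_config p0 cp ie).
pose M : seq (G * G) :=
  [seq (inl (inl (i, true)), inl (inl (i, false))) | i <- enum 'I_q].
pose S (j : nat) : {set G} := if j is j'.+1
  then [set inr k | k in [set k : 'I_((p - 1) * t) | k %% (p - 1) == j']]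
  else [set inl (inr k) | k in [set: 'I_t]].
have eM x : x \in ends M -> exists i b, x = inl (inl (i, b)).
  by rewrite mem_cat /unzip1 /unzip2 -!map_comp => /orP[]/mapP[i _ ->];
    [exists i, true|exists i, false].
exists M, 0, S; split=> //.
- by rewrite size_map -cardE card_ord.
- rewrite /matching /ends cat_uniq -!andbA; apply/and4P; split.
  + by rewrite /unzip1 -map_comp map_inj_uniq ?enum_uniq // => i j [].
  + rewrite /unzip1 /unzip2 -!map_comp.
    by apply/hasPn => x /mapP[i _ ->]; apply/negP => /mapP[].
  + by rewrite /unzip2 -map_comp map_inj_uniq ?enum_uniq // => i j [].
  by apply/allP => x /mapP[i _ ->] /=; rewrite /matching_adj /= eqxx.
- move=> [|j] jp /=.
    by rewrite card_imset ?cardsT ?card_ord // => a b [].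
  rewrite card_imset; last by move=> a b [].
  rewrite card_residue //; last by move: jp; clear; lia.
  by rewrite /balanced mulKn // modnMr leq_addr.
split.
- move=> [|i] [|j] ip jp //= ij x y /imsetP[a + ->] /imsetP[b + ->] //=.
  rewrite !inE /turan_adj => /eqP -> /eqP ->.
  by apply: contra ij => /eqP ->.
- move=> [|j] x y jp // _ /eM[i [b ->]] /imsetP[k _ ->] //.
- by move=> x /eM[i [b ->]]; apply/negP => /imsetP[].
Qed.

(** In a decomposing subgraph, the non-isolated vertices on the [false] side form a cover, so there
    are at least q of them. Hence every edge of the matching is present and no vertex is missing. *)
Lemma matching_graph_minimal M : decomposes F M -> subgraph M matching_graph ->
  iso M matching_graph.
Proof.
move=> dM [f finj fadj].
pose C := [set x | ~~ (f x).2 && [exists y, adj x y]].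
have cov : vertex_cover C.
  move=> x y xy; rewrite !inE; have := fadj x y xy; rewrite /= /matching_adj.
  have -> : [exists z, adj x z] by apply/existsP; exists y.
  have -> : [exists z, adj y z] by apply/existsP; exists x; rewrite adj_sym.
  by case: (f x).2; case: (f y).2; rewrite ?andbF.
have qC := decomposes_cover_ge dM cov.
have f1inj : {in C &, injective (fun x => (f x).1)}.
  move=> x y; rewrite !inE => /andP[/negPf fx _] /andP[/negPf fy _] e.
  by apply: finj; rewrite [f x]surjective_pairing [f y]surjective_pairing fx fy e.
have full : [set (f x).1 | x in C] = [set: 'I_q].
  by apply/eqP; rewrite eqEcard subsetT cardsT card_ord card_in_imset.
have pre i : exists x y, [/\ adj x y, f x = (i, false) & f y = (i, true)].
  have : i \in [set (f x).1 | x in C] by rewrite full.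
  case/imsetP => x; rewrite inE => /andP[/negPf fx /existsP[y xy]] ->.
  exists x, y; have := fadj x y xy; rewrite /= /matching_adj fx => /andP[/eqP e1 e2].
  split=> //; rewrite [LHS]surjective_pairing ?fx // e1.
  by move: e2; case: (f y).2.
exists f.
  apply: inj_card_bij => //.
  rewrite -(card_imset _ finj) -cardsT; apply: subset_leq_card.
  apply/subsetP => -[i b] _; have [x [y [_ ex ey]]] := pre i.
  by case: b; apply/imsetP; [exists y|exists x].
move=> x y; apply/idP/idP; last exact: fadj.
rewrite /= /matching_adj => /andP[/eqP e1 e2].
have [a [b [ab fa fb]]] := pre (f x).1.
case ex : (f x).2 e2 => /=; case ey : (f y).2 => //= _.
  have <- : b = x by apply: finj; rewrite fb [RHS]surjective_pairing ex.
  have <- : a = y by apply: finj; rewrite fa [RHS]surjective_pairing ey e1.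
  by rewrite adj_sym.
have <- : a = x by apply: finj; rewrite fa [RHS]surjective_pairing ex.
by have <- : b = y by apply: finj; rewrite fb [RHS]surjective_pairing ey e1.
Qed.

Lemma matching_graph_in : decomposition_family F matching_graph.
Proof.
split=> [|M dM sM]; first exact: matching_graph_decomposes.
exact: matching_graph_minimal.
Qed.

Lemma matching_graph_matching : is_matching matching_graph.
Proof.
move=> [i b]; rewrite /degree (_ : [set y | _] = [set (i, ~~ b)]) ?cards1 //.
apply/setP => -[j b']; rewrite !inE /= /matching_adj /= xpair_eqE eq_sym.
by case: b; case: b'.
Qed.

Definition half_cover : {set matching_graph} := [set u | ~~ u.2].

Lemma card_half_cover : #|half_cover| = q.
Proof.
have pinj : injective (fun i : 'I_q => (i, false)) by move=> i j [].
rewrite -[RHS]card_ord -cardsT -(card_imset _ pinj).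
apply: eq_card => -[i b]; rewrite inE /=; apply/idP/imsetP => [|[j _ [_ ->]] //].
by case: b => // _; exists i.
Qed.

Lemma half_cover_cover : vertex_cover half_cover.
Proof.
by move=> [i b] [j b']; rewrite /= /matching_adj !inE /=; case: b; case: b'; rewrite ?andbF.
Qed.

Lemma half_cover_independent : independent half_cover.
Proof.
move=> [i b] [j b']; rewrite !inE /= => /negPf -> /negPf ->.
by rewrite /matching_adj /= andbF.
Qed.

Lemma beta_fam_eq : beta_fam F = q.
Proof.
apply: min_nat_eq.
  exists matching_graph; first exact: matching_graph_in.
  apply: min_nat_eq; first by exists half_cover; [exact: half_cover_cover|exact: card_half_cover].
  move=> j [S Sc <-]; exact: (decomposes_cover_ge matching_graph_decomposes).
move=> j [M [dM _] <-].
have [] := @min_natP (fun k => exists2 S : {set M}, vertex_cover S & #|S| = k) #|M|.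
  by exists [set: M] => [x y _|]; rewrite ?inE ?cardsT.
move=> [S Sc Sb] _; rewrite /beta -Sb.
exact: decomposes_cover_ge dM Sc.
Qed.

Lemma gamma_fam_eq : gamma_fam F = q.
Proof.
apply: min_nat_eq.
  exists matching_graph; split; first exact: matching_graph_in.
    exists (fun u => if u.2 then ord0 else ord_max) => -[i b] [j b'] /andP[_] /=.
    by case: b; case: b'.
  apply: min_nat_eq.
    exists half_cover; split; [exact: half_cover_independent|exact: half_cover_cover|].
    exact: card_half_cover.
  by move=> j [S [_ Sc <-]]; apply: (decomposes_cover_ge matching_graph_decomposes).
move=> j [M [[dM _] [col colM] <-]].
(* A colour class is an independent cover; it shows that [gamma M] minimises over a nonempty set,
   without which [min_nat] is unspecified. *)
pose S0 := [set x | col x == ord0].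
have [] := @min_natP (fun k => exists S : {set M},
    [/\ independent S, vertex_cover S & #|S| = k]) #|S0|.
  exists S0; split=> // x y; rewrite !inE.
    by move=> /eqP ex /eqP ey; apply/negP => /colM; rewrite ex ey eqxx.
  move=> /colM; case: (col x) => -[|[|?]] // ?; case: (col y) => -[|[|?]] // ?.
move=> [S [_ Sc Sb]] _; rewrite /gamma -Sb.
exact: decomposes_cover_ge dM Sc.
Qed.

(** As beta = gamma = q, the family [B_fam F] consists of the copies of K_q, which are too large for
    q - 1 vertices. *)
Lemma complete_EX : EX (gamma_fam F - 1) (B_fam F) (complete (q - 1)).
Proof.
rewrite /B_fam beta_fam_eq gamma_fam_eq eqxx; split; first by rewrite card_ord.
  move=> K iK [f finj _]; have := leq_card f finj.
  rewrite (iso_card iK) !card_ord leqNgt => /negP; apply.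
  by move: hq; clear; lia.
move=> G' G'c _; rewrite -(leq_pmul2r (isT : 0 < 2)) -!arcs_edges.
have ck (u : complete (q - 1)) : degree u = (q - 1).-1.
  rewrite /degree (_ : [set y | _] = [set~ u]); last first.
    by apply/setP => v; rewrite !inE /= /complete_adj eq_sym.
  by rewrite cardsC1 card_ord.
rewrite [arcs (complete _)](eq_bigr _ (fun u _ => ck u)) sum_nat_const card_ord.
rewrite -{1}G'c -sum_nat_const; apply: leq_sum => u _.
rewrite -G'c -(cardsC1 u); apply: subset_leq_card; apply/subsetP => v.
by rewrite !inE; apply: contraTneq => ->; rewrite adj_irr.
Qed.

Lemma avoids_config : exists h, forall G, avoids F G -> ~ config G p q h.
Proof.
have [_ _ _ [K FK [c cp ie]]] := hF; move: c cp ie; rewrite hpF => c cp ie.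
exists #|K| => G aG cG; apply: (aG K FK).
by apply: (subgraph_of_config _ cp ie) => //; lia.
Qed.

Lemma avoids_del (G : graph) (w : G) : avoids F G -> avoids F (del w).
Proof.
move=> aG K FK sK; apply: (aG K FK); apply: subgraph_trans sK _.
exact: subgraph_del.
Qed.

Lemma arcs_extremal : exists N, forall G, avoids F G -> N <= #|G| ->
  arcs G <= arcs (H_join p (q - 1) (#|G| - (q - 1))).
Proof.
have [h hh] := avoids_config; have [D [N [D2 DE]]] := dense_arcs h hp hq.
apply: (arcs_reduction (P := avoids F) hp avoids_del D2 (N := N)) => G aG NG dG.
by apply: DE => //; apply: hh.
Qed.

Lemma spectral_extremal : exists N, forall G, avoids F G -> N <= #|G| ->
  (rho (H_join p (q - 1) (#|G| - (q - 1))) <= rho G)%R ->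
  iso G (H_join p (q - 1) (#|G| - (q - 1))).
Proof.
have [h hh] := avoids_config; have [D [N [D2 DE]]] := dense_spectral h hp hq.
apply: (spectral_reduction (P := avoids F) hp avoids_del D2 (N := N)) => G aG NG dG.
by apply: DE => //; apply: hh.
Qed.

Lemma edit_close_refl G : edit_close 0 G G.
Proof.
exists id; first by exists id.
have -> : [set id @: e | e : {set G} in edges G] = edges G.
  apply/setP => e; apply/imsetP/idP => [[e' e'G ->]|eG]; first by rewrite imset_id.
  by exists e; rewrite ?imset_id.
by rewrite /= setDv cards0.
Qed.

Lemma family_matching_good : matching_good F.
Proof.
split; first by rewrite hpF.
  by exists matching_graph; [exact: matching_graph_in|exact: matching_graph_matching].
have [N NE] := arcs_extremal; exists 0, (N + q) => n Nn.
exists (complete (q - 1)), (turan p (n - (q - 1))); split.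
- split; first by rewrite card_sum !card_ord subnKC //; move: Nn; clear; lia.
    exact: H_join_avoids.
  move=> G' G'n aG'; rewrite -(leq_pmul2r (isT : 0 < 2)) -!arcs_edges.
  by rewrite -G'n; apply: NE => //; rewrite G'n; move: Nn; clear; lia.
- exact: complete_EX.
- by rewrite hpF gamma_fam_eq; apply: edit_close_refl.
Qed.

Lemma family_SPEX : exists N : nat, forall n : nat, N <= n ->
  forall G : graph, SPEX n F G <-> iso G (H_graph n p q).
Proof.
have [N NE] := spectral_extremal; exists (N + q) => n Nn G.
have Hn : #|H_graph n p q| = n.
  by rewrite card_sum !card_ord subnKC //; move: Nn; clear; lia.
have aH : avoids F (H_graph n p q) by apply: H_join_avoids.
have uniq (G' : graph) : #|G'| = n -> avoids F G' ->
    (rho (H_graph n p q) <= rho G')%R -> iso G' (H_graph n p q).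
  move=> G'n aG'; rewrite /H_graph -G'n; apply: NE => //.
  by rewrite G'n; move: Nn; clear; lia.
split=> [[Gn aG maxG]|iGH].
  by apply: uniq => //; exact: (maxG _ Hn aH).
split; first by rewrite (iso_card iGH).
  exact: iso_avoids (iso_sym iGH) aH.
move=> G' G'n aG'.
(* A competitor with larger spectral radius would also satisfy [uniq], hence be isomorphic to H and
   have the same radius. *)
suff : (rho G' <= rho G)%R by [].
rewrite (iso_rho iGH) leNgt; apply/negP => lt.
have iG' := uniq G' G'n aG' (ltW lt).
by rewrite (iso_rho iG') ltxx in lt.
Qed.
End CriticalFamily.

Theorem theorem1p7 (q p : nat) (F : graph_family) (hq : 1 <= q) (hp : 2 <= p)
    (hpF : p_of F = p) (hF : color_critical q F) :
  matching_good F /\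
  exists N : nat, forall n : nat, N <= n ->
    forall G : graph, SPEX n F G <-> iso G (H_graph n p q).
Proof.
split; first exact: (family_matching_good hq hp hpF hF).
exact: (family_SPEX hq hp hpF hF).
Qed.
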